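(* Let $\{X_n\}_{n\in\mathbb{Z}}$ be a stationary process satisfying either (A1) or (A2) (both spelled out in the context). Let $\{\alpha(n)\}_{n\ge 1}$ be its partial autocorrelation function (Verblunsky coefficients), let $\{c_n\}_{n\ge0}$ and $\{a_n\}_{n\ge0}$ be its MA and AR coefficients, let $\beta_n=\sum_{v=0}^\infty c_v a_{v+n}$ for $n\ge 0$, and define $\alpha_1(n)=\beta_n$ and, for $k=3,5,7,\dots$, $$\alpha_k(n)=\sum_{v_1=0}^\infty\cdots\sum_{v_{k-1}=0}^\infty \beta_{n+v_1}\,\beta_{n+1+v_1+v_2}\cdots\beta_{n+1+v_{k-2}+v_{k-1}}\,\beta_{n+1+v_{k-1}}.$$ Then for every $n=2,3,\dots$ the limit $\lim_{M\to\infty}\sum_{k=1}^{M}\alpha_{2k-1}(n)$ exists and $$\alpha(n)=\lim_{M\to\infty}\sum_{k=1}^{M}\alpha_{2k-1}(n).$$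
   Context: A stationary process is a real, zero-mean, weakly stationary process $\{X_n:n\in\mathbb{Z}\}$ on a probability space $(\Omega,\mathcal{F},P)$ whose spectral measure $\mu$ on $(-\pi,\pi]$ (i.e. the finite measure with $\gamma(n):=E[X_nX_0]=\int_{(-\pi,\pi]}e^{in\theta}\mu(d\theta)$, $n\in\mathbb{Z}$) is not of finite support. Let $H$ be the closed real linear span of $\{X_k:k\in\mathbb{Z}\}$ in $L^2(\Omega,\mathcal{F},P)$, with inner product $(Y_1,Y_2)=E[Y_1Y_2]$ and norm $\|Y\|=(Y,Y)^{1/2}$. For an interval $I\subset\mathbb{Z}$, $H_I$ is the closed subspace spanned by $\{X_k:k\in I\}$, and $P_I^\perp$ is the orthogonal projection of $H$ onto the orthogonal complement of $H_I$ in $H$. The partial autocorrelation function (PACF) is $\alpha(1)=\gamma(1)/\gamma(0)$ and $\alpha(n)=\dfrac{(P^\perp_{[1,n-1]}X_n,\,P^\perp_{[1,n-1]}X_0)}{\|P^\perp_{[1,n-1]}X_n\|^2}$ for $n\ge2$; these are also called the Verblunsky coefficients of $\{X_n\}$. $\{X_n\}$ is purely nondeterministic (PND) if $\bigcap_{n=-\infty}^{\infty}H_{(-\infty,n]}=\{0\}$, equivalently there is a positive even integrable function $\Delta$ on $(-\pi,\pi]$ (the spectral density) with $\int_{-\pi}^\pi|\log\Delta(\theta)|\,d\theta<\infty$ and $\gamma(n)=\int_{-\pi}^\pi e^{in\theta}\Delta(\theta)\,d\theta$ for all $n\in\mathbb{Z}$. For a PND process the Szegő function is $$h(z)=\sqrt{2\pi}\exp\Big\{\frac1{4\pi}\int_{-\pi}^{\pi}\frac{e^{i\theta}+z}{e^{i\theta}-z}\log\Delta(\theta)\,d\theta\Big\},\qquad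 |z|<1,$$ and the MA coefficients $c_n$ and AR coefficients $a_n$ (both real) are defined by $h(z)=\sum_{n\ge0}c_nz^n$ and $-1/h(z)=\sum_{n\ge0}a_nz^n$ for $|z|<1$. (A1): $\{X_n\}$ is PND, $\sum_{n\ge0}|a_n|<\infty$ and $\sum_{n\ge0}|c_n|<\infty$. (A2): $\{X_n\}$ is PND, and for some $d\in(0,1/2)$ and some slowly varying $\ell$ one has, as $n\to\infty$, $c_n\sim n^{-(1-d)}\ell(n)$ and $a_n\sim n^{-(1+d)}\dfrac{1}{\ell(n)}\cdot\dfrac{d\sin(\pi d)}{\pi}$. Here $p_n\sim q_n$ means $p_n/q_n\to1$, and slowly varying means: positive, measurable, defined on some $[A,\infty)$, with $\lim_{x\to\infty}\ell(\lambda x)/\ell(x)=1$ for all $\lambda>0$. Under (A1) or (A2) the series defining $\beta_n$ and $\alpha_k(n)$ converge absolutely. The series over $k$ in the conclusion is understood as a limit of partial sums and is not asserted to converge absolutely. *)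

(* Defs.v *)
From HB Require Import structures.
From mathcomp Require Import all_boot all_order all_algebra.
From mathcomp Require Import all_classical all_reals all_analysis.
From mathcomp Require Import complex.

Set Implicit Arguments.
Unset Strict Implicit.
Unset Printing Implicit Defensive.

Import Order.TTheory GRing.Theory Num.Theory.
Import numFieldNormedType.Exports.

Local Open Scope classical_set_scope.
Local Open Scope ring_scope.
Local Open Scope complex_scope.

Definition cexp (R : realType) (z : R[i]) : R[i] :=
  (expR (complex.Re z))%:C * (cos (complex.Im z) +i* sin (complex.Im z)).

Definition expi (R : realType) (t : R) : R[i] := cexp (0 +i* t).

Definition cintegral (R : realType)
    (mu : {measure set (measurableTypeR R) -> \bar R})
    (D : set R) (f : R -> R[i]) : R[i] :=
  (\int[mu]_(t in D) complex.Re (f t)) +i* (\int[mu]_(t in D) complex.Im (f t)).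

(* Elements of L^2(Omega, F, P) are represented by square-integrable measurable
   functions, not by classes modulo P-a.e. equality. The sets
   [closed_span X I] and [orth_compl X I] are saturated for a.e. equality, and [inner] does not depend on
   representatives. *)

Definition inner d (Omega : measurableType d) (R : realType)
    (P : probability Omega R) (Y1 Y2 : Omega -> R) : R :=
  fine 'E_P[fun w => Y1 w * Y2 w].

Definition L2norm d (Omega : measurableType d) (R : realType)
    (P : probability Omega R) (Y : Omega -> R) : R :=
  Num.sqrt (inner P Y Y).

Definition lin_span d (Omega : measurableType d) (R : realType)
    (P : probability Omega R) (X : int -> {RV P >-> R}) (I : set int) :
    set (Omega -> R) :=
  [set Z | exists s : seq (R * int),
     (forall p, p \in s -> I p.2) /\
     Z = (fun w => \sum_(p <- s) p.1 * X p.2 w)].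

Definition closed_span d (Omega : measurableType d) (R : realType)
    (P : probability Omega R) (X : int -> {RV P >-> R}) (I : set int) :
    set (Omega -> R) :=
  [set Y | Y \in Lfun P 2%:E /\
     forall e : R, 0 < e ->
       exists2 Z, lin_span X I Z & L2norm P (fun w => Y w - Z w) < e].

Definition orth_compl d (Omega : measurableType d) (R : realType)
    (P : probability Omega R) (X : int -> {RV P >-> R}) (I : set int) :
    set (Omega -> R) :=
  [set W | closed_span X [set: int] W /\
     forall Z, closed_span X I Z -> inner P W Z = 0].

(* A representative of the orthogonal projection of Y onto K, unique up to a.e.
   equality; one exists whenever Y is in H and K = orth_compl X I. *)
Definition orth_proj d (Omega : measurableType d) (R : realType)
    (P : probability Omega R) (K : set (Omega -> R)) (Y : Omega -> R) :
    Omega -> R :=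
  xget (fun=> 0)
    [set W | K W /\ forall Z, K Z -> inner P (fun w => Y w - W w) Z = 0].

Definition proj_perp d (Omega : measurableType d) (R : realType)
    (P : probability Omega R) (X : int -> {RV P >-> R}) (I : set int)
    (Y : Omega -> R) : Omega -> R :=
  orth_proj P (orth_compl X I) Y.

Definition autocov d (Omega : measurableType d) (R : realType)
    (P : probability Omega R) (X : int -> {RV P >-> R}) (n : int) : R :=
  inner P (X n) (X 0).

Definition weakly_stationary d (Omega : measurableType d) (R : realType)
    (P : probability Omega R) (X : int -> {RV P >-> R}) : Prop :=
  [/\ forall k, (X k : Omega -> R) \in Lfun P 2%:E,
      forall k, ('E_P[X k] = 0)%E
    & forall m n k : int, inner P (X (m + k)) (X (n + k)) = inner P (X m) (X n)].

Definition circle (R : realType) : set R := `]- pi, pi].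
Arguments circle : clear implicits.

Definition spectral_measure d (Omega : measurableType d) (R : realType)
    (P : probability Omega R) (X : int -> {RV P >-> R})
    (mu : {finite_measure set (measurableTypeR R) -> \bar R}) : Prop :=
  mu (~` circle R) = 0%E /\
  forall n : int,
    (autocov X n)%:C = cintegral mu (circle R) (fun t => expi (n%:~R * t)).

Definition finitely_supported (R : realType)
    (mu : {finite_measure set (measurableTypeR R) -> \bar R}) : Prop :=
  exists F : set R,
    [/\ finite_set F, F `<=` circle R & mu (circle R `\` F) = 0%E].

Definition stationary_process d (Omega : measurableType d) (R : realType)
    (P : probability Omega R) (X : int -> {RV P >-> R}) : Prop :=
  weakly_stationary X /\
  exists mu : {finite_measure set (measurableTypeR R) -> \bar R},
    spectral_measure X mu /\ ~ finitely_supported mu.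

Definition pacf d (Omega : measurableType d) (R : realType)
    (P : probability Omega R) (X : int -> {RV P >-> R}) (n : nat) : R :=
  if (n <= 1)%N then autocov X 1 / autocov X 0
  else
    let I := [set k : int | 1 <= k <= n%:Z - 1] in
    inner P (proj_perp X I (X n%:Z)) (proj_perp X I (X 0))
      / L2norm P (proj_perp X I (X n%:Z)) ^+ 2.

Definition purely_nondeterministic d (Omega : measurableType d) (R : realType)
    (P : probability Omega R) (X : int -> {RV P >-> R}) : Prop :=
  forall Y : Omega -> R,
    (forall n : int, closed_span X [set k : int | k <= n] Y) ->
    {ae P, forall w, Y w = 0}.

(* Such a Delta exists exactly when X is purely nondeterministic, and it is then
   determined up to a.e. equality. Evenness is asked on the open interval since
   -pi is not in the circle. *)
Definition spectral_density d (Omega : measurableType d) (R : realType)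
    (P : probability Omega R) (X : int -> {RV P >-> R}) (Delta : R -> R) : Prop :=
  [/\ forall t, circle R t -> 0 < Delta t,
      forall t, - pi < t < pi -> Delta (- t) = Delta t,
      (@lebesgue_measure R).-integrable (circle R) (EFin \o Delta),
      (\int[@lebesgue_measure R]_(t in circle R) `|ln (Delta t)|%:E < +oo)%E
    & forall n : int,
        (autocov X n)%:C =
        cintegral (@lebesgue_measure R) (circle R)
          (fun t => expi (n%:~R * t) * (Delta t)%:C)].

Definition szego (R : realType) (Delta : R -> R) (z : R[i]) : R[i] :=
  (Num.sqrt (2 * pi))%:C *
  cexp ((4 * pi)^-1%:C *
        cintegral (@lebesgue_measure R) (circle R)
          (fun t => (expi t + z) / (expi t - z) * (ln (Delta t))%:C)).

(* R[i]^o is R[i] with the topology of the modulus. By uniqueness of power series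
   coefficients, f determines u. *)
Definition disk_expansion (R : realType) (f : R[i] -> R[i]) (u : nat -> R) : Prop :=
  forall z : R[i], `|z| < 1 ->
    series (fun n => (u n)%:C * z ^+ n : R[i]^o) @ \oo --> (f z : R[i]^o).

Definition MA_coefficients (R : realType) (Delta : R -> R) (c : nat -> R) : Prop :=
  disk_expansion (szego Delta) c.

Definition AR_coefficients (R : realType) (Delta : R -> R) (a : nat -> R) : Prop :=
  disk_expansion (fun z => - (szego Delta z)^-1) a.

Definition A1 d (Omega : measurableType d) (R : realType)
    (P : probability Omega R) (X : int -> {RV P >-> R}) (c a : nat -> R) : Prop :=
  [/\ purely_nondeterministic X,
      cvgn (series (fun n => `|a n|))
    & cvgn (series (fun n => `|c n|))].

Definition slowly_varying (R : realType) (ell : R -> R) : Prop :=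
  exists A : R,
    [/\ forall x, A <= x -> 0 < ell x,
        measurable_fun `[A, +oo[ ell
      & forall lambda : R, 0 < lambda ->
          ell (lambda * x) / ell x @[x --> +oo] --> (1 : R)].

Definition asymp_equiv (R : realType) (p q : nat -> R) : Prop :=
  p n / q n @[n --> \oo] --> (1 : R).

Definition A2 d (Omega : measurableType d) (R : realType)
    (P : probability Omega R) (X : int -> {RV P >-> R}) (c a : nat -> R) : Prop :=
  purely_nondeterministic X /\
  exists (e : R) (ell : R -> R),
    [/\ 0 < e < 1 / 2, slowly_varying ell,
        asymp_equiv c (fun n => n%:R `^ (- (1 - e)) * ell n%:R)
      & asymp_equiv a (fun n => n%:R `^ (- (1 + e)) * (1 / ell n%:R)
                                * (e * sin (pi * e) / pi))].

Definition beta (R : realType) (c a : nat -> R) (n : nat) : R :=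
  limn (series (fun v => c v * a (v + n)%N)).

(* [iterated_sum m F] is the sum over v_1, then over v_2, etc. up to v_m, of
   F [:: v_1; v_2; ...; v_m], the sum over v_m being the innermost one. *)
Fixpoint iterated_sum (R : realType) (m : nat) (F : seq nat -> R) : R :=
  if m is m'.+1 then
    limn (series (fun v => iterated_sum m' (fun s => F (v :: s))))
  else F [::].

(* With s = [:: v_1; ...; v_(k-1)], v_j is nth 0 s j.-1. *)
Definition alpha_term (R : realType) (c a : nat -> R) (k n : nat) (s : seq nat) : R :=
  beta c a (n + nth 0 s 0)%N
  * (\prod_(0 <= j < k - 2) beta c a (n + 1 + nth 0 s j + nth 0 s j.+1)%N)
  * beta c a (n + 1 + nth 0 s (k - 2))%N.

Definition alpha_ (R : realType) (c a : nat -> R) (k n : nat) : R :=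
  if k == 1%N then beta c a n else iterated_sum k.-1 (alpha_term c a k n).

(* Main.v *)
(** Under (A2) the a_n are eventually nonnegative and the power series -1/h stays negative on
    [0, 1), hence bounded above, so (a_n) is absolutely summable in both cases.

    First, gamma(m) = sum_k c_k c_(k+m). On the circle |z| = r, |h|^2 is 2 pi times the exponential
    of the Poisson integral of log Delta; Jensen's inequality, integrated against the weight
    1 + e cos(m t) with e = 1 or -1, and Parseval's identity give, as r tends to 1,
    C(0) + e C(m) <= gamma(0) + e gamma(m) for C(m) := sum_k c_k c_(k+m). Conversely the boundary
    values of 1/|h|^2 form a continuous function, so comparing averages of log Delta near a Lebesgue
    point shows that |h|^2 / (2 pi) is asymptotically at least Delta almost everywhere, and Fatou's
    argument gives gamma(0) <= C(0). Hence gamma = C.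

    The PACF depends on gamma only, so X may be replaced by the moving average
    x_k = sum_j c_j xi_(k-j) of an orthonormal basis (xi_j) of l^2. With xi~ the innovations of the
    reversed process, (xi~_j, xi_l) = - beta_(j+l) for j + l >= 0. Von Neumann's alternating
    projections onto the orthogonal complements of {xi_l : l >= n} and {xi~_j : j >= 1}, applied to
    x_n, converge to a vector orthogonal to both families, which lies in the span of
    x_0, ..., x_(n-1): it is the predictor of x_n. Its coefficient at x_0, which is alpha(n), is the
    limit of the coefficients of the iterates, whose increments are the sums alpha_(2k-1)(n). *)

From HB Require Import structures.
Require Import Defs.
From mathcomp Require Import all_boot all_order all_algebra.
From mathcomp Require Import all_classical all_reals all_analysis.
From mathcomp Require Import measurable_realfun complex ring lra zify.
Import Order.TTheory GRing.Theory Num.Theory.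
Import numFieldNormedType.Exports.
Set Implicit Arguments.
Unset Strict Implicit.
Unset Printing Implicit Defensive.
Local Open Scope classical_set_scope.
Local Open Scope ring_scope.

(** The obstacle is (A2): there [c] need not be summable, so h may have no continuous boundary
    values and |h|^2 / (2 pi) cannot simply be read off on the circle and identified with Delta.
    Only 1/h extends continuously to the closed disk. This is why gamma = C is reached through
    inequalities: Jensen's bound works strictly inside the disk, and the converse bound at lag 0
    uses the boundary values of 1/h alone. Once C(0) = gamma(0), the choices e = 1 and e = -1 bound
    C(m) by gamma(m) from both sides.

    In l^2 the innovations are given beforehand as a basis instead of being extracted from X, and a
    vector of norm 0 is 0, whereas functions on Omega are only determined up to null sets. The
    transfer back to X goes through the normal equations, which mention gamma only.

    Convergence of the series over k is not obtained by estimating its terms. It is inherited from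
    the norm convergence of the alternating projections, which holds because the composed projection
    can be made self-adjoint: the inner product of the j-th and k-th iterates then depends on j + k
    only. *)

Lemma cvgn_inj (R : realType) (u : nat -> R) (x y : R) :
  u @ \oo --> x -> u @ \oo --> y -> x = y.
Proof. by move=> /cvg_lim <- // /cvg_lim <-. Qed.

Definition hlim (R : realType) (V : lmodType R) (ip : V -> V -> R)
    (u : nat -> V) (v : V) : Prop :=
  (fun n => ip (u n - v) (u n - v)) @ \oo --> (0 : R).

(** Definiteness [ip_eq0] rules out plain functions on Omega, whose inner product ignores null sets;
    the instance is l^2, in [l2_hilbert]. Completeness is phrased with squared distances, so that no
    norm has to be introduced. *)
Record hilbert (R : realType) (V : lmodType R) (ip : V -> V -> R) : Prop := Hilbert {
  ipC : forall x y, ip x y = ip y x;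
  ipDl : forall x y z, ip (x + y) z = ip x z + ip y z;
  ipZl : forall k x y, ip (k *: x) y = k * ip x y;
  ip_ge0 : forall x, 0 <= ip x x;
  ip_eq0 : forall x, ip x x = 0 -> x = 0;
  ip_complete : forall u : nat -> V,
    (forall e : R, 0 < e -> exists N : nat, forall m n, (N <= m)%N -> (N <= n)%N ->
       ip (u m - u n) (u m - u n) < e) ->
    exists v, hlim ip u v }.

(** * Orthogonal projections *)

Section Hilbert.
Context {R : realType} {V : lmodType R} (ip : V -> V -> R) (H : hilbert ip).

Lemma ipDr x y z : ip x (y + z) = ip x y + ip x z.
Proof. by rewrite ipC// ipDl// !(ipC H x). Qed.

Lemma ipZr k x y : ip x (k *: y) = k * ip x y.
Proof. by rewrite ipC// ipZl// (ipC H x). Qed.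

Lemma ip0l x : ip 0 x = 0.
Proof. by rewrite -(scale0r 0) ipZl// mul0r. Qed.

Lemma ip0r x : ip x 0 = 0.
Proof. by rewrite ipC// ip0l. Qed.

Lemma ipNl x y : ip (- x) y = - ip x y.
Proof. by rewrite -scaleN1r ipZl// mulN1r. Qed.

Lemma ipNr x y : ip x (- y) = - ip x y.
Proof. by rewrite ipC// ipNl (ipC H). Qed.

Lemma ipBl x y z : ip (x - y) z = ip x z - ip y z.
Proof. by rewrite ipDl// ipNl. Qed.

Lemma ipBr x y z : ip x (y - z) = ip x y - ip x z.
Proof. by rewrite ipDr ipNr. Qed.

Definition ipE := (ipDl H, ipDr, ipBl, ipBr, ipZl H, ipZr, ipNl, ipNr).

Lemma ip_suml I (r : seq I) (F : I -> V) y :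
  ip (\sum_(i <- r) F i) y = \sum_(i <- r) ip (F i) y.
Proof.
elim: r => [|i r IH]; first by rewrite !big_nil ip0l.
by rewrite !big_cons ipDl// IH.
Qed.

Lemma ip_sumr I (r : seq I) (F : I -> V) y :
  ip y (\sum_(i <- r) F i) = \sum_(i <- r) ip y (F i).
Proof. by rewrite ipC// ip_suml; apply: eq_bigr => i _; rewrite ipC. Qed.

Lemma cauchy_schwarz x y : ip x y ^+ 2 <= ip x x * ip y y.
Proof.
have [/(ip_eq0 H) ->|y0] := eqVneq (ip y y) 0; first by rewrite !ip0r expr0n mulr0.
have yp : 0 < ip y y by rewrite lt_def y0 ip_ge0.
have := ip_ge0 H (ip y y *: x - ip x y *: y); rewrite !ipE (ipC H y x).
rewrite (_ : _ - _ = ip y y * (ip x x * ip y y - ip x y ^+ 2)); last by ring.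
by rewrite pmulr_rge0// subr_ge0.
Qed.

Lemma ip_ext x y : (forall z, ip x z = ip y z) -> x = y.
Proof.
move=> xy; apply/eqP; rewrite -subr_eq0; apply/eqP/(ip_eq0 H).
by rewrite ipBl xy subrr.
Qed.

Lemma hlim_ip u v w : hlim ip u v -> (fun n => ip (u n) w) @ \oo --> ip v w.
Proof.
move=> uv.
apply/subr_cvg0.
apply/norm_cvg0P.
have : (fun n => Num.sqrt (ip (u n - v) (u n - v) * ip w w)) @ \oo --> (0 : R).
  rewrite -(@sqrtr0 R) -(mul0r (ip w w)).
  apply: continuous_cvg; first exact: sqrt_continuous.
  by apply: cvgMl.
apply: (@squeeze_cvgr _ _ _ _ (fun=> 0)); last exact: cvg_cst.
near=> n; rewrite normr_ge0 /= -ipBl -sqrtr_sqr ler_wsqrtr//.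
exact: cauchy_schwarz.
Unshelve. all: by end_near. Qed.

Lemma hlimP u : (exists v, hlim ip u v) -> hlim ip u (xget 0 [set v | hlim ip u v]).
Proof. by move=> [v uv]; apply: (@xgetPex _ 0 [set v | hlim ip u v]); exists v. Qed.

Definition hsummable (b : nat -> R) (y : nat -> V) :=
  exists v, hlim ip (fun n => \sum_(i < n) b i *: y i) v.

Definition hsum (b : nat -> R) (y : nat -> V) : V :=
  xget 0 [set v | hlim ip (fun n => \sum_(i < n) b i *: y i) v].

Lemma hsum_ip b y w : hsummable b y ->
  series (fun k => b k * ip (y k) w) @ \oo --> ip (hsum b y) w.
Proof.
move=> /hlimP /(@hlim_ip _ _ w); apply: cvg_trans; apply: near_eq_cvg.
near=> n; rewrite /series/= big_mkord ip_suml; apply: eq_bigr => i _.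
by rewrite ipZl.
Unshelve. all: by end_near. Qed.

Lemma hsum_ipE b y w : hsummable b y ->
  ip (hsum b y) w = limn (series (fun k => b k * ip (y k) w)).
Proof. by move=> /hsum_ip => /(_ w)/cvg_lim <-. Qed.

Lemma sumB_ord (b : nat -> R) (y : nat -> V) (m n : nat) : (m <= n)%N ->
  \sum_(i < n) b i *: y i - \sum_(i < m) b i *: y i = \sum_(m <= i < n) b i *: y i.
Proof.
move=> mn; rewrite -!(big_mkord predT (fun i => b i *: y i)).
by rewrite (big_cat_nat _ mn)//= addrAC subrr add0r.
Qed.

Lemma hsummable_cauchy (b : nat -> R) (y : nat -> V) :
  (forall e : R, 0 < e -> exists N : nat, forall m n, (N <= m)%N -> (m <= n)%N ->
    ip (\sum_(m <= i < n) b i *: y i) (\sum_(m <= i < n) b i *: y i) < e) ->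
  hsummable b y.
Proof.
move=> hb; apply: (ip_complete H) => e /hb[N hN]; exists N => m n Nm Nn.
have [mn|/ltnW nm] := leqP m n; last by rewrite sumB_ord// hN.
by rewrite -opprB ipNl ipNr opprK sumB_ord// hN.
Qed.

Definition orthonormal (T : eqType) (eta : T -> V) :=
  forall i j, ip (eta i) (eta j) = (i == j)%:R.

Lemma orthonormal_sum (eta : nat -> V) (b : nat -> R) m n : orthonormal eta ->
  ip (\sum_(m <= i < n) b i *: eta i) (\sum_(m <= i < n) b i *: eta i) =
  \sum_(m <= i < n) b i ^+ 2.
Proof.
move=> on; rewrite ip_suml [LHS]big_seq [RHS]big_seq.
apply: eq_bigr => i; rewrite mem_index_iota => imn.
rewrite ip_sumr (bigD1_seq i) ?mem_index_iota ?iota_uniq//=.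
rewrite ipZl// ipZr on eqxx mulr1 expr2 big1 ?addr0// => j /negbTE ji.
by rewrite ipZl// ipZr on eq_sym ji !mulr0.
Qed.

Lemma series_tail (f : nat -> R) : cvgn (series f) ->
  forall e : R, 0 < e -> exists N : nat, forall m n, (N <= m)%N -> (m <= n)%N ->
    `|\sum_(m <= i < n) f i| < e.
Proof.
move=> /cvg_cauchy /cauchyP cf e e0.
have [x2] := cf (e/2) (divr_gt0 e0 (ltr0Sn _ 1)) => -[N2 _ hN2].
exists N2 => m n N2m mn.
have := hN2 m N2m; have := hN2 n (leq_trans N2m mn).
rewrite /ball/= => h1 h2.
have -> : \sum_(m <= i < n) f i = series f n - series f m.
  by rewrite sub_series_geq.
rewrite (_ : _ - _ = (x2 - series f m) - (x2 - series f n)); last by ring.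
by rewrite (le_lt_trans (ler_normB _ _))// [e]splitr ltrD.
Qed.

Lemma orthonormal_summable (eta : nat -> V) (b : nat -> R) : orthonormal eta ->
  cvgn (series (fun i => b i ^+ 2)) -> hsummable b eta.
Proof.
move=> on cb; apply: hsummable_cauchy => e e0.
have [N hN] := series_tail cb e0; exists N => m n Nm mn.
by rewrite orthonormal_sum// (le_lt_trans _ (hN m n Nm mn))// ler_norm.
Qed.

(** Absolutely summable coefficients need only bounded vectors. This lets the AR coefficients act on
    the moving average itself, whose variables are not orthogonal. *)
Lemma abs_summable (y : nat -> V) (b : nat -> R) (B : R) :
  (forall k, ip (y k) (y k) <= B) ->
  cvgn (series (fun i => `|b i|)) -> hsummable b y.
Proof.
move=> yB cb; apply: hsummable_cauchy => e e0.
have B0 : 0 <= B by rewrite (le_trans _ (yB 0%N))// ip_ge0.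
(* The summand 1 keeps the denominator positive when B = 0. *)
pose e' := Num.sqrt (e / (B + 1)).
have e'0 : 0 < e' by rewrite sqrtr_gt0 divr_gt0// ltr_wpDl.
have [N hN] := series_tail cb e'0; exists N => m n Nm mn.
have /lt_le_trans : \sum_(m <= i < n) `|b i| < e'.
  by rewrite (le_lt_trans _ (hN m n Nm mn))// ler_norm.
move=> /(_ _ (lexx _)) sb.
have s0 : 0 <= \sum_(m <= i < n) `|b i| by apply: sumr_ge0.
have yy i j : `|ip (y i) (y j)| <= B.
  rewrite -(@ler_pXn2r _ 2)// ?nnegrE// real_normK ?num_real//.
  by rewrite (le_trans (cauchy_schwarz _ _))// expr2 ler_pM// ip_ge0.
have : ip (\sum_(m <= i < n) b i *: y i) (\sum_(m <= i < n) b i *: y i) <=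
   (\sum_(m <= i < n) `|b i|) * (\sum_(m <= i < n) `|b i|) * B.
  rewrite ip_suml -mulrA [X in _ <= X]mulr_suml; apply: ler_sum => i _.
  rewrite ip_sumr mulr_suml mulr_sumr; apply: ler_sum => j _.
  rewrite ipZl// ipZr (le_trans (ler_norm _))// !normrM.
  by rewrite !ler_wpM2l.
move=> /le_lt_trans; apply.
have : (\sum_(m <= i < n) `|b i|) ^+ 2 < e / (B + 1).
  rewrite -(@sqr_sqrtr _ (e / (B + 1))); last by rewrite divr_ge0 ?ltW// ltr_wpDl.
  by rewrite ltr_pXn2r// nnegrE// ltW.
rewrite ltr_pdivlMr ?ltr_wpDl// -expr2; apply: le_lt_trans.
by rewrite ler_wpM2l ?sqr_ge0// lerDl.
Qed.

Lemma bessel (eta : nat -> V) w n : orthonormal eta ->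
  \sum_(0 <= i < n) ip w (eta i) ^+ 2 <= ip w w.
Proof.
move=> on; set s := \sum_(_ <= i < _) _.
pose v := \sum_(0 <= i < n) ip w (eta i) *: eta i.
have vv : ip v v = s by exact: orthonormal_sum.
have wv : ip w v = s.
  by rewrite ip_sumr; apply: eq_bigr => i _; rewrite ipZr expr2.
have := ip_ge0 H (w - v); rewrite !ipE (ipC H v w) vv wv; lra.
Qed.

Lemma bessel_summable (eta : nat -> V) w : orthonormal eta ->
  cvgn (series (fun i => ip w (eta i) ^+ 2)).
Proof.
move=> on; apply: nondecreasing_is_cvgn.
  by apply: nondecreasing_series => i _ _; rewrite sqr_ge0.
by exists (ip w w) => _ [n _ <-]; exact: bessel.
Qed.

Definition proj (eta : nat -> V) (w : V) : V := hsum (fun i => ip w (eta i)) eta.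

Section projection.
Variables (eta : nat -> V) (on : orthonormal eta).

Lemma proj_summable w : hsummable (fun i => ip w (eta i)) eta.
Proof. exact: orthonormal_summable on (@bessel_summable _ w on). Qed.

Lemma proj_cvg w v :
  series (fun i => ip w (eta i) * ip (eta i) v) @ \oo --> ip (proj eta w) v.
Proof. exact/hsum_ip/proj_summable. Qed.

Lemma proj_sym w v : ip (proj eta w) v = ip w (proj eta v).
Proof.
rewrite [RHS]ipC//; apply: (cvgn_inj (@proj_cvg w v)) => //.
have := @proj_cvg v w; apply: cvg_trans; apply: near_eq_cvg; near=> n.
by apply: eq_bigr => i _; rewrite mulrC (ipC H w) (ipC H (eta i) v).
Unshelve. all: by end_near. Qed.

Lemma proj_coef w i : ip (proj eta w) (eta i) = ip w (eta i).
Proof.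
apply: (cvgn_inj (@proj_cvg w (eta i))) => //.
apply: cvg_near_cst; near=> n.
rewrite /series/= (bigD1_seq i) ?mem_index_iota ?iota_uniq//=; last first.
  by near: n; exists i.+1.
by rewrite on eqxx mulr1 big1 ?addr0// => j /negbTE ji; rewrite on ji mulr0.
Unshelve. all: by end_near. Qed.

Lemma proj_idem w : proj eta (proj eta w) = proj eta w.
Proof.
rewrite /proj; congr (hsum _ _); apply/funext => i; exact: proj_coef.
Qed.

(** Additivity follows from self-adjointness tested against an arbitrary vector, without touching
    the defining limits. *)
Lemma projB v w : proj eta (v - w) = proj eta v - proj eta w.
Proof. by apply: ip_ext => z; rewrite ipBl !proj_sym ipBl. Qed.

Lemma proj0_orth w : (forall i, ip w (eta i) = 0) -> proj eta w = 0.
Proof.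
move=> w0; apply: ip_ext => z; rewrite ip0l.
apply: (cvgn_inj (@proj_cvg w z)) => //.
apply: cvg_near_cst; near=> n; apply: big1 => i _; by rewrite w0 mul0r.
Unshelve. all: by end_near. Qed.

Lemma proj_norm w : ip (proj eta w) (proj eta w) = ip (proj eta w) w.
Proof. by rewrite -proj_sym proj_idem. Qed.

Definition cproj w := w - proj eta w.

Lemma cproj_sym w v : ip (cproj w) v = ip w (cproj v).
Proof. by rewrite ipBl ipBr proj_sym. Qed.

Lemma cproj_idem w : cproj (cproj w) = cproj w.
Proof. by rewrite /cproj projB proj_idem subrr subr0. Qed.

Lemma cproj_orth w i : ip (cproj w) (eta i) = 0.
Proof. by rewrite ipBl proj_coef subrr. Qed.

Lemma cproj_id w : (forall i, ip w (eta i) = 0) -> cproj w = w.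
Proof. by move=> /proj0_orth p; rewrite /cproj p subr0. Qed.

Lemma cproj_pyth w : ip w w = ip (cproj w) (cproj w) + ip (proj eta w) (proj eta w).
Proof. by rewrite cproj_sym cproj_idem proj_norm /cproj ipBr (ipC H w (proj _ _)) subrK. Qed.

Lemma cproj_le w : ip (cproj w) (cproj w) <= ip w w.
Proof. by rewrite [leRHS]cproj_pyth lerDl ip_ge0. Qed.

End projection.
End Hilbert.

(** * Alternating projections onto two orthogonal complements *)

Lemma iter_sym {R : realType} {V : Type} (ip : V -> V -> R) (T : V -> V) k v w :
  (forall v w, ip (T v) w = ip v (T w)) -> ip (iter k T v) w = ip v (iter k T w).
Proof. by move=> T_sym; elim: k v w => //= k IH v w; rewrite T_sym IH -iterSr. Qed.

Section alternating_projections.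
Context {R : realType} {V : lmodType R} (ip : V -> V -> R) (H : hilbert ip).
Variables (eta zeta : nat -> V).
Hypotheses (oneta : orthonormal ip eta) (onzeta : orthonormal ip zeta).
Variable x : V.
Hypothesis x_zeta : forall j, ip x (zeta j) = 0.

(** The repeated outer projection makes [T] self-adjoint; on vectors already orthogonal to [zeta],
    such as all iterates of [x], it agrees with the composition of the two projections. *)
Let T w := cproj ip zeta (cproj ip eta (cproj ip zeta w)).

Let T_sym v w : ip (T v) w = ip v (T w).
Proof. by rewrite /T !cproj_sym. Qed.

Definition alternate (k : nat) : V := iter k T x.

(** Even terms are the squared norms of the iterates, odd terms those of the half steps between them
    ([T_half]). Hence [t] records the lengths along the individual projections and is nonnegative
    and nonincreasing. *)
Let t k := ip (alternate k) x.

Let tD j k : ip (alternate j) (alternate k) = t (j + k).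
Proof. by rewrite /alternate -(iter_sym _ _ _ T_sym) -iterD addnC. Qed.

Let T_half w : ip (T w) w = ip (cproj ip eta (cproj ip zeta w)) (cproj ip eta (cproj ip zeta w)).
Proof. by rewrite /T (cproj_sym H onzeta) [RHS](cproj_sym H oneta) (cproj_idem H oneta);
  exact: ipC. Qed.

Let t_even k : t (k + k) = ip (alternate k) (alternate k).
Proof. by rewrite tD. Qed.

Let t_odd k : t (k + k).+1 = ip (T (alternate k)) (alternate k).
Proof. exact/esym/(tD k.+1 k). Qed.

Let t_ge0 k : 0 <= t k.
Proof.
have [j [->|->]] : exists j, k = (j + j)%N \/ k = (j + j).+1.
  by exists k./2; have := odd_double_half k; case: (odd k); lia.
- by rewrite t_even ip_ge0.
- by rewrite t_odd T_half ip_ge0.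
Qed.

Let t_decr k : t k.+1 <= t k.
Proof.
have [j [->|->]] : exists j, k = (j + j)%N \/ k = (j + j).+1.
  by exists k./2; have := odd_double_half k; case: (odd k); lia.
- by rewrite t_even t_odd T_half (le_trans (cproj_le H oneta _))// cproj_le.
- rewrite (_ : (j + j).+2 = (j.+1 + j.+1)%N); last by lia.
  by rewrite t_even t_odd T_half /alternate iterS cproj_le.
Qed.

Let t_cvg : t @ \oo --> limn t.
Proof.
apply: nonincreasing_is_cvgn; first exact/nonincreasing_seqP.
by exists 0 => _ [k _ <-]; exact: t_ge0.
Qed.

Lemma alternate_zeta k j : ip (alternate k) (zeta j) = 0.
Proof. by case: k => [|k]; [exact: x_zeta | rewrite /alternate iterS cproj_orth]. Qed.

Lemma cproj_alternate k : cproj ip zeta (alternate k) = alternate k.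
Proof. by apply: cproj_id => // j; exact: alternate_zeta. Qed.

Let proj_alternate_norm k :
  ip (proj ip eta (alternate k)) (proj ip eta (alternate k)) = t (k + k) - t (k + k).+1.
Proof.
by rewrite t_even t_odd T_half cproj_alternate [X in X - _](cproj_pyth H oneta) addrAC subrr add0r.
Qed.

Lemma alternate_cvg : exists r, hlim ip alternate r /\
  (forall i, ip r (eta i) = 0) /\ (forall j, ip r (zeta j) = 0).
Proof.
have [r xr] : exists r, hlim ip alternate r.
  apply: (ip_complete H) => e e0.
  have /cvgrPdist_lt/(_ (e / 4) (divr_gt0 e0 (ltr0Sn _ _)))[N _ hN] := t_cvg.
  exists N => m n Nm Nn.
  (* The squared distance of two iterates becomes t (2m) - 2 t (m+n) + t (2n), so convergence of [t]
     is enough; e / 4 is spent once on each outer term and twice on the middle one. *)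
  rewrite !(ipE H) (ipC H (alternate n) (alternate m)) !tD.
  have := hN (m + m)%N (leq_trans Nm (leq_addr _ _)).
  have := hN (m + n)%N (leq_trans Nm (leq_addr _ _)).
  have := hN (n + n)%N (leq_trans Nn (leq_addr _ _)).
  rewrite /= !ltr_norml => /andP[h1 h2] /andP[h3 h4] /andP[h5 h6].
  lra.
exists r; split=> //; split=> [i|j]; last first.
  apply: (cvgn_inj (@hlim_ip _ _ _ H _ _ (zeta j) xr)).
  by under eq_fun do rewrite alternate_zeta; exact: cvg_cst.
apply: (cvgn_inj (@hlim_ip _ _ _ H _ _ (eta i) xr)).
apply/norm_cvg0P.
(* By Pythagoras this is the length of the component of the k-th iterate along [eta]; the gap
   between consecutive values of [t] closes. *)
have : (fun k => Num.sqrt (t (k + k) - t (k + k).+1)) @ \oo --> (0 : R).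
  rewrite -(@sqrtr0 R) -(subrr (limn t)).
  apply: continuous_cvg; first exact: sqrt_continuous.
  apply: cvgB; apply: (cvg_comp _ _ _ t_cvg) => A [N _ hN]; exists N => // k /= Nk;
    apply: hN => /=; lia.
apply: (@squeeze_cvgr _ _ _ _ (fun=> 0)); last exact: cvg_cst.
near=> k; rewrite normr_ge0 /= -proj_alternate_norm -proj_coef// -sqrtr_sqr ler_wsqrtr//.
by rewrite (le_trans (cauchy_schwarz H _ _))// oneta eqxx mulr1.
Unshelve. all: by end_near. Qed.

(** The components of the iterates along [eta] ([proj_alternate]), expressed by projections onto the
    spans instead of the complements: their coefficients along the two families then satisfy a
    linear recursion. *)
Definition echo (k : nat) : V :=
  iter k (fun w => proj ip eta (proj ip zeta w)) (proj ip eta x).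

Lemma proj_echo k : proj ip eta (echo k) = echo k.
Proof. by case: k => [|k]; rewrite /echo ?iterS proj_idem. Qed.

Lemma proj_alternate k : proj ip eta (alternate k) = echo k.
Proof.
elim: k => // k IH.
rewrite /alternate iterS -/(alternate k) /T cproj_alternate.
rewrite {1}/cproj projB// {1}/cproj projB// proj_idem// subrr sub0r.
rewrite {1}/cproj projB//.
have -> : proj ip zeta (alternate k) = 0 by apply: proj0_orth => // j; exact: alternate_zeta.
have p0 : proj ip eta 0 = 0 by apply: (proj0_orth H oneta) => i; exact: ip0l.
by rewrite projB// p0 sub0r opprK IH.
Qed.

Lemma alternateS k : alternate k.+1 = alternate k - cproj ip zeta (echo k).
Proof.
rewrite {1}/alternate iterS -/(alternate k) /T cproj_alternate -proj_alternate.
rewrite -{2}(cproj_alternate k) /cproj !projB//.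
by rewrite !opprB addrACA [RHS]addrACA; congr (_ + _); exact: addrC.
Qed.

(** [alternateS] telescopes, and a test vector orthogonal to [zeta] absorbs the complementary
    projection in each increment. *)
Lemma alternate_ip k w : (forall j, ip w (zeta j) = 0) ->
  ip (alternate k) w = ip x w - \sum_(i < k) ip (echo i) w.
Proof.
move=> w0; elim: k => [|k IH]; first by rewrite big_ord0 subr0.
by rewrite alternateS (ipBl H) IH big_ord_recr/= cproj_sym// cproj_id// opprD addrA.
Qed.

End alternating_projections.

Lemma series_single (R : realType) (f : nat -> R) (m : nat) :
  (forall j, j != m -> f j = 0) -> series f @ \oo --> f m.
Proof.
move=> f0; apply: cvg_near_cst; near=> n.
rewrite /series/= (bigD1_seq m) ?mem_index_iota ?iota_uniq//=; last by near: n; exists m.+1.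
by rewrite big1 ?addr0// => j /f0.
Unshelve. all: by end_near. Qed.

Lemma series_zero (R : realType) (f : nat -> R) :
  (forall j, f j = 0) -> series f @ \oo --> (0 : R).
Proof.
by move=> f0; rewrite -(f0 0%N); apply: series_single => j _.
Qed.

Lemma series_shift (R : realType) (f : nat -> R) (p : nat) (l : R) :
  (forall k, (k < p)%N -> f k = 0) -> series f @ \oo --> l ->
  series (fun v => f (v + p)%N) @ \oo --> l.
Proof.
move=> f0 fl.
have : (fun n => series f (n + p)%N) @ \oo --> l.
  apply: (cvg_comp _ _ _ fl) => A [N _ hN]; exists N => // k /= Nk; apply: hN => /=; lia.
apply: cvg_trans; apply: near_eq_cvg; near=> n.
rewrite /series/= (big_cat_nat (n := p)) ?leq_addl//= big_nat_cond big1 ?add0r => [|k]; last first.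
  by rewrite andbT => /andP[_ /f0].
by rewrite -{1}(add0n p) big_addn addnK.
Unshelve. all: by end_near. Qed.

(** * Predictors of moving averages *)

Section moving_average.
Context {R : realType} {V : lmodType R} (ip : V -> V -> R) (H : hilbert ip).
Variables (xi : int -> V) (onxi : orthonormal ip xi).
Hypothesis xi_complete : forall w, (forall l, ip w (xi l) = 0) -> w = 0.
Variables (c a : nat -> R).
Hypothesis c_l2 : cvgn (series (fun n => c n ^+ 2)).
Hypothesis a_l1 : cvgn (series (fun n => `|a n|)).
Hypothesis ac : forall n, \sum_(i < n.+1) a i * c (n - i)%N = - (n == 0%N)%:R.

Definition cz (m : int) : R := if m is Posz n then c n else 0.

Lemma cz_neg (m : int) : m < 0 -> cz m = 0.
Proof. by case: m. Qed.

Lemma conv_cz (m : int) : series (fun k => a k * cz (m - k%:Z)) @ \oo --> (- (m == 0)%:R : R).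
Proof.
case: m => [m|m]; last first.
  rewrite /= oppr0; apply: series_zero => j; rewrite cz_neg ?mulr0//; lia.
rewrite -[in X in _ --> X](ac m); apply: cvg_near_cst; near=> n.
have mn : (m < n)%N by near: n; exists m.+1.
rewrite /series/= (big_cat_nat (n := m.+1))//= big_mkord [X in _ + X]big_nat_cond.
rewrite [X in _ + X]big1 ?addr0 => [|k]; last first.
  by rewrite andbT => /andP[mk _]; rewrite cz_neg ?mulr0//; lia.
apply: eq_bigr => i _; have im := ltn_ord i.
by rewrite subzn.
Unshelve. all: by end_near. Qed.

Definition mav (k : int) : V := hsum ip c (fun j => xi (k - j%:Z)).

Lemma mav_summable k : hsummable ip c (fun j => xi (k - j%:Z)).
Proof.
apply: orthonormal_summable => // i j; rewrite onxi; congr ((_ : bool)%:R); lia.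
Qed.

Lemma mav_xi k l : ip (mav k) (xi l) = cz (k - l).
Proof.
apply: (cvgn_inj (@hsum_ip _ _ _ H _ _ (xi l) (mav_summable k))).
case E : (k - l) => [p|p].
  have -> : cz (Posz p) = c p * ip (xi (k - p%:Z)) (xi l).
    by rewrite onxi (_ : _ == _) ?mulr1//; lia.
  apply: series_single => j jp; rewrite onxi (_ : _ == _ = false) ?mulr0//; lia.
apply: series_zero => j; rewrite onxi (_ : _ == _ = false) ?mulr0//; lia.
Qed.

Definition acov (p : nat) : R := limn (series (fun j => c j * c (j + p)%N)).

Lemma mav_mavD k (p : nat) : ip (mav k) (mav (k + p%:Z)) = acov p.
Proof.
rewrite (hsum_ipE H); last exact: mav_summable.
congr (limn (series _)); apply/funext => j; rewrite (ipC H) mav_xi.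
by rewrite (_ : _ - _ = Posz (j + p))//; lia.
Qed.

Lemma mav_mav k l : ip (mav k) (mav l) = acov `|k - l|%N.
Proof.
have [kl|/ltW lk] := leP k l.
  by rewrite -(mav_mavD k) (_ : k + _ = l)//; lia.
by rewrite (ipC H) -(mav_mavD l) (_ : l + _ = k)//; lia.
Qed.

Lemma hsum_mav_summable (u : nat -> int) : hsummable ip a (fun k => mav (u k)).
Proof.
apply: (abs_summable H (B := acov 0)) => // k.
by rewrite mav_mav (_ : `|_|%N = 0%N)//; lia.
Qed.

(** Both sides have the same coefficients along [xi], since [a] and [c] are inverse to each other
    under convolution up to sign. *)
Lemma autoregression l : hsum ip a (fun k => mav (l - k%:Z)) = - xi l.
Proof.
apply/eqP; rewrite -subr_eq0; apply/eqP/xi_complete => m.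
rewrite (ipBl H) (ipNl H) onxi opprK.
apply/eqP; rewrite addr_eq0; apply/eqP.
apply: (cvgn_inj (@hsum_ip _ _ _ H _ _ (xi m) (hsum_mav_summable _))).
rewrite (_ : (l == m) = (l - m == 0)); last by rewrite subr_eq0.
have := @conv_cz (l - m); apply: cvg_trans; apply: near_eq_cvg; near=> n.
by apply: eq_bigr => i _; rewrite mav_xi addrAC.
Unshelve. all: by end_near. Qed.

Lemma mav_complete w : (forall k, ip w (mav k) = 0) -> w = 0.
Proof.
move=> w0; apply: xi_complete => l; rewrite (ipC H).
apply/eqP; rewrite -oppr_eq0 -(ipNl H) -autoregression; apply/eqP.
apply: (cvgn_inj (@hsum_ip _ _ _ H _ _ w (hsum_mav_summable _))).
by apply: series_zero => k; rewrite (ipC H) w0 mulr0.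
Qed.

(* The innovations of the time-reversed process. *)
Definition bxi (j : int) : V := - hsum ip a (fun k => mav (k%:Z - j)).

(** Time reversal, which sends [mav l] to [mav (- j - l)], preserves inner products because they
    depend on the distance of the indices only, and it carries the expansion of [bxi j] to that of
    [xi 0]. *)
Lemma bxi_mav j l : ip (bxi j) (mav l) = cz (- j - l).
Proof.
rewrite (ipNl H).
have -> : cz (- j - l) = ip (xi 0) (mav (- j - l)) by rewrite (ipC H) mav_xi subr0.
apply/eqP; rewrite eqr_oppLR -(ipNl H) -autoregression; apply/eqP.
rewrite !(hsum_ipE H); [|exact: hsum_mav_summable..].
congr (limn (series _)); apply/funext => k; rewrite !mav_mav.
by congr (_ * acov _); lia.
Qed.

Lemma bxi_on : orthonormal ip bxi.
Proof.
move=> i j; rewrite (ipC H) {1}/bxi (ipNl H); apply/eqP; rewrite eqr_oppLR; apply/eqP.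
apply: (cvgn_inj (@hsum_ip _ _ _ H _ _ (bxi i) (hsum_mav_summable _))).
rewrite (_ : (i == j) = (j - i == 0)); last by rewrite subr_eq0 eq_sym.
have := @conv_cz (j - i); apply: cvg_trans; apply: near_eq_cvg; near=> n.
by apply: eq_bigr => k _; rewrite (ipC H) bxi_mav; congr (_ * cz _); lia.
Unshelve. all: by end_near. Qed.

(** The k-th variable in the expansion of [bxi j] has no component along [xi l] while k < j + l;
    shifting the index by j + l gives the series that defines beta. *)
Lemma bxi_xi_cvg (j l : int) (p : nat) : j + l = p%:Z ->
  series (fun v => c v * a (v + p)%N) @ \oo --> - ip (bxi j) (xi l).
Proof.
move=> jl; rewrite (ipNl H) opprK.
have := @hsum_ip _ _ _ H _ _ (xi l) (hsum_mav_summable (fun k => k%:Z - j)).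
move=> /(series_shift (p := p)) h.
have {h} : series (fun v => a (v + p)%N * ip (mav ((v + p)%N%:Z - j)) (xi l)) @ \oo -->
   ip (hsum ip a (fun k => mav (k%:Z - j))) (xi l).
  by apply: h => k kp; rewrite mav_xi cz_neg ?mulr0//; lia.
apply: cvg_trans; apply: near_eq_cvg; near=> n; apply: eq_bigr => i _.
rewrite mav_xi (_ : (i + p)%N%:Z - j - l = i%:Z); last by lia.
exact: mulrC.
Unshelve. all: by end_near. Qed.

Lemma bxi_xi (j l : int) (p : nat) : j + l = p%:Z ->
  ip (bxi j) (xi l) = - beta c a p.
Proof.
by move=> /bxi_xi_cvg/cvg_lim h; rewrite /beta h// opprK.
Qed.

(** The family biorthogonal to the process ([dual_mav]). It expands along [xi] from index m on and,
    by [dual_bxi], also along [bxi] from index - m on; having both expansions is what links past and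
    future. *)
Definition dual (m : int) : V := - hsum ip a (fun k => xi (m + k%:Z)).

Lemma dual_summable (m : int) : hsummable ip a (fun k => xi (m + k%:Z)).
Proof. by apply: (abs_summable H (B := 1)) => // k; rewrite onxi eqxx. Qed.

Lemma dual_bsummable (m : int) : hsummable ip a (fun k => bxi (k%:Z - m)).
Proof. by apply: (abs_summable H (B := 1)) => // k; rewrite bxi_on eqxx. Qed.

Lemma dual_mav m n : ip (dual m) (mav n) = (n == m)%:R.
Proof.
rewrite (ipNl H); apply/eqP; rewrite eqr_oppLR; apply/eqP.
apply: (cvgn_inj (@hsum_ip _ _ _ H _ _ (mav n) (dual_summable m))).
rewrite (_ : (n == m) = (n - m == 0)); last by rewrite subr_eq0.
have := @conv_cz (n - m); apply: cvg_trans; apply: near_eq_cvg; near=> N.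
by apply: eq_bigr => k _; rewrite (ipC H) mav_xi; congr (_ * cz _); lia.
Unshelve. all: by end_near. Qed.

Lemma dual_bxi m : dual m = - hsum ip a (fun k => bxi (k%:Z - m)).
Proof.
apply/eqP; rewrite -subr_eq0; apply/eqP/mav_complete => n.
rewrite (ipBl H) dual_mav (ipNl H) opprK; apply/eqP; rewrite addrC addr_eq0; apply/eqP.
apply: (cvgn_inj (@hsum_ip _ _ _ H _ _ (mav n) (dual_bsummable m))).
rewrite (_ : (n == m) = (m - n == 0)); last by rewrite subr_eq0 eq_sym.
have := @conv_cz (m - n); apply: cvg_trans; apply: near_eq_cvg; near=> N.
by apply: eq_bigr => k _; rewrite bxi_mav; congr (_ * cz _); lia.
Unshelve. all: by end_near. Qed.

Lemma a0_neq0 : a 0%N != 0.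
Proof.
apply/eqP => a0; have := ac 0; rewrite big_ord1 a0 mul0r => /eqP.
by rewrite eq_sym oppr_eq0 oner_eq0.
Qed.

Lemma c0_neq0 : c 0%N != 0.
Proof.
apply/eqP => c0; have := ac 0; rewrite big_ord1 c0 mulr0 => /eqP.
by rewrite eq_sym oppr_eq0 oner_eq0.
Qed.

(* The intersection of past and future property: a vector in the closed spans of
   the past up to [n - 1] and of the future from [0] is in the span of the finitely many
   variables in between. *)
Lemma intersection_past_future (n : nat) r :
  (forall i : nat, ip r (xi (n%:Z + i%:Z)) = 0) ->
  (forall j : nat, ip r (bxi (1 + j%:Z)) = 0) ->
  r = \sum_(k < n) ip r (dual k%:Z) *: mav k%:Z.
Proof.
move=> r_xi r_bxi.
apply/eqP; rewrite -subr_eq0; apply/eqP; set z := r - _.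
(* For m < 0 the expansion along [bxi] meets only vectors orthogonal to [r]; for m >= n the
   expansion along [xi] does. In between, biorthogonality makes the subtracted sum cancel the
   coefficient of [r]. *)
have z_dual m : ip z (dual m) = 0.
  rewrite (ipBl H) (ip_suml H).
  under eq_bigr do rewrite (ipZl H) (ipC H (mav _)) dual_mav.
  have [m0|m0] := ltP m 0.
    rewrite big1 => [|k _]; last by rewrite (_ : _ == _ = false) ?mulr0//; lia.
    rewrite subr0 (ipC H) dual_bxi (ipNl H); apply/eqP; rewrite oppr_eq0; apply/eqP.
    apply: (cvgn_inj (@hsum_ip _ _ _ H _ _ r (dual_bsummable m))).
    apply: series_zero => k; rewrite (ipC H) (_ : _ - m = 1 + (k + `|m|.-1)%N%:Z) ?r_bxi ?mulr0//;
      lia.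
  have [nm|mn] := leP n%:Z m.
    rewrite big1 => [|k _]; last first.
      by have kn := ltn_ord k; rewrite (_ : _ == _ = false) ?mulr0//; lia.
    rewrite subr0 (ipC H) (ipNl H); apply/eqP; rewrite oppr_eq0; apply/eqP.
    apply: (cvgn_inj (@hsum_ip _ _ _ H _ _ r (dual_summable m))).
    by apply: series_zero => k;
      rewrite (ipC H) (_ : m + k = n%:Z + (k + `|m| - n)%N%:Z) ?r_xi ?mulr0//; lia.
  have mn' : (`|m| < n)%N by lia.
  rewrite (bigD1 (Ordinal mn'))//= (_ : _ == m) ?mulr1; last by lia.
  rewrite (_ : Posz `|m| = m); last by lia.
  rewrite big1 ?addr0 ?subrr// => k /eqP km; rewrite (_ : _ == m = false) ?mulr0//.
  by apply/eqP => km'; apply: km; apply: val_inj => /=; lia.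
have z_xin (i : nat) : ip z (xi (n%:Z + i%:Z)) = 0.
  rewrite (ipBl H) r_xi (ip_suml H) big1 ?subr0// => k _.
  by have kn := ltn_ord k; rewrite (ipZl H) mav_xi cz_neg ?mulr0//; lia.
(* Descending induction on l: when [dual l] is expanded along [xi], every term but the first is
   orthogonal to [z] already, and [a 0] is not zero. *)
have z_xi (i : nat) : forall l : int, n%:Z - i%:Z <= l -> ip z (xi l) = 0.
  elim: i => [|i IH] l il.
    by rewrite (_ : l = n%:Z + (`|l| - n)%N%:Z) ?z_xin//; lia.
  have [/IH//|li] := leP (n%:Z - i%:Z) l.
  have := z_dual l; rewrite (ipC H) (ipNl H) => /eqP; rewrite oppr_eq0 => /eqP.
  move: (@hsum_ip _ _ _ H _ _ z (dual_summable l)) => /[swap] ->.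
  have h : series (fun k => a k * ip (xi (l + k%:Z)) z) @ \oo --> a 0%N * ip (xi (l + 0%N%:Z)) z.
    apply: (@series_single _ (fun k => a k * ip (xi (l + k%:Z)) z)) => j j0.
    by rewrite (ipC H) IH ?mulr0//; lia.
  move=> /(cvgn_inj h)/eqP; rewrite mulf_eq0 (negbTE a0_neq0)/= addr0 (ipC H) => /eqP.
  by [].
apply: xi_complete => l; apply: (z_xi (`|l| + n)%N); lia.
Qed.

(** Powers of the Hankel matrix with entries beta (n + 1 + i + j), applied to the unit vector at 0.
    Each entry is a bare [limn]; that the series converge is [hankel_iter_cvg]. *)
Fixpoint hankel_iter (n k : nat) : nat -> R :=
  if k is k'.+1 then
    fun i => limn (series (fun j => beta c a (n + 1 + i + j) * hankel_iter n k' j))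
  else fun i => (i == 0%N)%:R.

Section predictor.
Variable n : nat.
Hypothesis n_gt0 : (0 < n)%N.

Let eta (i : nat) := xi (n%:Z + i%:Z).
Let zeta (j : nat) := bxi (1 + j%:Z).
Let oneta : orthonormal ip eta.
Proof. by move=> i j; rewrite onxi; congr ((_ : bool)%:R); lia. Qed.
Let onzeta : orthonormal ip zeta.
Proof. by move=> i j; rewrite bxi_on; congr ((_ : bool)%:R); lia. Qed.

Let mav_zeta (l j : nat) : ip (mav l%:Z) (zeta j) = 0.
Proof. by rewrite (ipC H) bxi_mav cz_neg//; lia. Qed.

Let zeta_eta i j : ip (zeta j) (eta i) = - beta c a (n + 1 + i + j).
Proof. by apply: bxi_xi; lia. Qed.

Let e := echo ip eta zeta (mav n%:Z).

Let proj_e k : proj ip eta (e k) = e k.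
Proof. exact: proj_echo. Qed.

Let e_cvg k w : series (fun i => ip (e k) (eta i) * ip (eta i) w) @ \oo --> ip (e k) w.
Proof. by rewrite -[in X in _ --> X]proj_e; exact: proj_cvg. Qed.

Let e_zeta_cvg k j :
  series (fun i => beta c a (n + 1 + j + i) * ip (e k) (eta i)) @ \oo --> - ip (e k) (zeta j).
Proof.
have /cvgN := @e_cvg k (zeta j).
apply: cvg_trans; apply: near_eq_cvg; near=> N.
rewrite fctE /series/= -sumrN; apply: eq_bigr => i _.
by rewrite (ipC H (eta i)) zeta_eta mulrN opprK mulrC addnAC.
Unshelve. all: by end_near. Qed.

Let eS_cvg k i :
  series (fun j => beta c a (n + 1 + i + j) * - ip (e k) (zeta j)) @ \oo --> ip (e k.+1) (eta i).
Proof.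
rewrite /e /echo iterS -/(echo _ _ _ _ _) -/e proj_coef//.
have := @proj_cvg _ _ _ H _ onzeta (e k) (eta i).
apply: cvg_trans; apply: near_eq_cvg; near=> N.
by apply: eq_bigr => j _; rewrite zeta_eta !mulrN mulrC.
Unshelve. all: by end_near. Qed.

(** Coefficients of the echoes, merged into one sequence: even m reads them along [eta], odd m along
    [zeta] with the sign of [zeta_eta] absorbed. As the mixed inner products depend on i + j only, a
    single symmetric matrix drives both kinds of step. *)
Let E (m : nat) : nat -> R :=
  if odd m then fun j => - ip (e m./2) (zeta j) else fun i => ip (e m./2) (eta i).

Let E_cvg m i : series (fun j => beta c a (n + 1 + i + j) * E m j) @ \oo --> E m.+1 i.
Proof.
rewrite /E /= uphalf_half; case: (odd m) => /=; first exact: eS_cvg.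
exact: e_zeta_cvg.
Qed.

Let E0 i : E 0 i = c 0%N * (i == 0%N)%:R.
Proof.
rewrite /E /= /e /echo /= proj_coef// mav_xi; case: i => [|i].
  by rewrite mulr1 addr0 subrr.
by rewrite mulr0 cz_neg//; lia.
Qed.

Let hankel_iterE m : E m = (fun i => c 0%N * hankel_iter n m i).
Proof.
elim: m => [|m IH]; apply/funext => i; first exact: E0.
have := @E_cvg m i; rewrite IH => h.
rewrite /=; apply: (cvgn_inj h).
have -> : series (fun j => beta c a (n + 1 + i + j) * (c 0%N * hankel_iter n m j)) =
   (fun N => c 0%N * series (fun j => beta c a (n + 1 + i + j) * hankel_iter n m j) N).
  by apply/funext => N; rewrite /series/= mulr_sumr; apply: eq_bigr => j _; rewrite mulrCA.
apply: cvgMl_tmp.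
suff -> : series (fun j => beta c a (n + 1 + i + j) * hankel_iter n m j) =
   (fun N => (c 0%N)^-1 * series (fun j => beta c a (n + 1 + i + j) * E m j) N).
  by apply: is_cvgMl_tmp; apply/cvg_ex; exists (E m.+1 i); exact: E_cvg.
apply/funext => N; rewrite /series/= mulr_sumr; apply: eq_bigr => j _; rewrite IH.
by rewrite mulrCA mulKf// c0_neq0.
Qed.

Lemma hankel_cvg (b : nat -> R) m (l : R) :
  series (fun i => b i * E m i) @ \oo --> l ->
  series (fun i => b i * hankel_iter n m i) @ \oo --> (c 0%N)^-1 * l.
Proof.
move=> h.
have -> : series (fun j => b j * hankel_iter n m j) =
   (fun N => (c 0%N)^-1 * series (fun j => b j * E m j) N).
  apply/funext => N; rewrite /series/= mulr_sumr; apply: eq_bigr => j _.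
  by rewrite hankel_iterE mulrCA mulKf// c0_neq0.
exact: cvgMl_tmp.
Qed.

Lemma hankel_iter_cvg m i :
  cvgn (series (fun j => beta c a (n + 1 + i + j) * hankel_iter n m j)).
Proof. by apply/cvg_ex; eexists; apply: hankel_cvg; exact: E_cvg. Qed.

Let bxi0_cvg k :
  series (fun i => beta c a (n + i) * E k.*2 i) @ \oo --> - ip (e k) (bxi 0).
Proof.
rewrite /E odd_double doubleK.
have /cvgN := @e_cvg k (bxi 0).
apply: cvg_trans; apply: near_eq_cvg; near=> N.
rewrite fctE /series/= -sumrN; apply: eq_bigr => i _.
by rewrite (ipC H (eta i)) (@bxi_xi _ _ (n + i)%N)//= mulrN opprK mulrC.
Unshelve. all: by end_near. Qed.

(** [phi] is characterised through [acov] alone, so that it can be carried over to X. The inequality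
    says that the prediction error is not zero; at order n - 1 that error is the denominator of the
    PACF. *)
Lemma predictor : exists phi : nat -> R,
  (forall l, (l < n)%N ->
     \sum_(k < n) phi k * acov `|k%:Z - l%:Z|%N = acov (n - l)%N) /\
  \sum_(k < n) phi k * acov (n - k)%N != acov 0 /\
  (fun M => \sum_(k < M) limn (series (fun i => beta c a (n + i) * hankel_iter n k.*2 i)))
    @ \oo --> phi 0%N.
Proof.
have [r [xr [r_eta r_zeta]]] := alternate_cvg H oneta onzeta (mav_zeta n).
have rE := intersection_past_future r_eta r_zeta.
(* Tested against a variable before time n, no increment contributes: echoes lie in the span of
   [eta], to which that variable is orthogonal. *)
have r_mav l : (l < n)%N -> ip r (mav l%:Z) = ip (mav n%:Z) (mav l%:Z).
  move=> ln.
  have mav_eta i : ip (mav l%:Z) (eta i) = 0 by rewrite mav_xi cz_neg//; lia.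
  apply: (cvgn_inj (@hlim_ip _ _ _ H _ _ (mav l%:Z) xr)).
  apply: cvg_near_cst; near=> M.
  rewrite (alternate_ip H oneta onzeta (mav_zeta n)); last exact: mav_zeta.
  rewrite big1 ?subr0// => k _.
  by rewrite -proj_echo// proj_sym// proj0_orth// ip0r.
exists (fun k => ip r (dual k%:Z)); split; [move=> l ln|split].
- rewrite (_ : (n - l)%N = `|n%:Z - l%:Z|%N); last by lia.
  rewrite -mav_mav -r_mav// [in RHS]rE (ip_suml H); apply: eq_bigr => k _.
  by rewrite (ipZl H) mav_mav.
(* With zero error x_n would equal [r], hence be orthogonal to its own innovation [xi n], along
   which its coefficient is [c 0]. *)
- apply/eqP => r0.
  have : ip (mav n%:Z - r) (mav n%:Z - r) = 0.
    have rn : ip r (mav n%:Z) = acov 0.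
      rewrite [in LHS]rE (ip_suml H) -r0; apply: eq_bigr => k _; rewrite (ipZl H) mav_mav.
      by congr (_ * acov _); have := ltn_ord k; lia.
    have rr : ip r r = ip r (mav n%:Z).
      rewrite [in RHS](ipC H) [X in ip r X = _]rE [X in _ = ip _ X]rE !(ip_sumr H).
      by apply: eq_bigr => k _; rewrite !(ipZr H) r_mav.
    have nn : ip (mav n%:Z) (mav n%:Z) = acov 0 by rewrite mav_mav subrr.
    by rewrite !(ipE H) (ipC H (mav n%:Z) r) rr rn nn; ring.
  move=> /(ip_eq0 H)/eqP; rewrite subr_eq0 => /eqP xr0.
  by have := r_eta 0%N; rewrite -xr0 mav_xi addr0 subrr /=; exact/eqP/c0_neq0.
have bxi_zeta j : ip (bxi 0) (zeta j) = 0.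
  by rewrite bxi_on (_ : _ == _ = false)//; lia.
have limE k : limn (series (fun i => beta c a (n + i) * hankel_iter n k.*2 i)) =
    (c 0%N)^-1 * - ip (e k) (bxi 0).
  by apply/cvg_lim => //; apply: hankel_cvg; exact: bxi0_cvg.
(* The backward innovation at time 0 is orthogonal to all later variables, so it reads off the
   coefficient of x_0, up to the factor [c 0]. *)
have r_bxi : ip r (bxi 0) = c 0%N * ip r (dual 0%N%:Z).
  rewrite {1}rE (ip_suml H) (bigD1 (Ordinal n_gt0))//= big1 => [|k /eqP k0].
    by rewrite (ipZl H) (ipC H (mav _)) bxi_mav addr0 mulrC.
  rewrite (ipZl H) (ipC H (mav _)) bxi_mav cz_neg ?mulr0//.
  have k0' : k != 0%N :> nat by apply/eqP => k0'; apply: k0; exact: val_inj.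
  lia.
rewrite -[ip r _](mulKf c0_neq0) -r_bxi.
have := @hlim_ip _ _ _ H _ _ (bxi 0) xr.
move=> /(@cvgMl_tmp _ _ _ _ _ (c 0%N)^-1).
apply: cvg_trans; apply: near_eq_cvg; near=> M.
(* The starting vector x_n is orthogonal to [bxi 0] because n > 0, so only the increments remain. *)
rewrite (alternate_ip H oneta onzeta (mav_zeta n))// (ipC H (mav _)) bxi_mav cz_neg; last by lia.
rewrite sub0r -sumrN mulr_sumr; apply: eq_bigr => k _.
by rewrite limE.
Unshelve. all: by end_near. Qed.

End predictor.
End moving_average.

(** * The Hilbert space of square-summable sequences *)

Section square_summable.
Context {R : realType}.

Definition square_summable : {pred (nat -> R)} :=
  fun s => `[< cvgn (series (fun n => s n ^+ 2)) >].

Lemma square_summable_mul (s t : nat -> R) : s \in square_summable ->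
  t \in square_summable -> cvgn (series (fun n => s n * t n)).
Proof.
move=> /asboolP ss /asboolP tt; apply: normed_cvg.
apply: (@series_le_cvg _ _ (fun n => s n ^+ 2 + t n ^+ 2)) => [n|n|n|].
- exact: normr_ge0.
- by rewrite addr_ge0// sqr_ge0.
- rewrite /= normrM -(real_normK (num_real (s n))) -(real_normK (num_real (t n))).
  have := sqr_ge0 (`|s n| - `|t n|); have := sqr_ge0 `|s n|; have := sqr_ge0 `|t n|; nra.
- have -> : series (fun n => s n ^+ 2 + t n ^+ 2) =
      series (fun n => s n ^+ 2) + series (fun n => t n ^+ 2).
    by apply/funext => n; rewrite /series/= big_split.
  exact: is_cvgD.
Qed.

Lemma square_summable_bounded (s : nat -> R) (B : R) :
  (forall N, \sum_(0 <= i < N) s i ^+ 2 <= B) -> s \in square_summable.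
Proof.
move=> sB; apply/asboolP; apply: nondecreasing_is_cvgn.
  by apply: nondecreasing_series => i _ _; rewrite sqr_ge0.
by exists B => _ [n _ <-]; exact: sB.
Qed.

Lemma square_summable_le (s : nat -> R) (N : nat) : s \in square_summable ->
  \sum_(0 <= i < N) s i ^+ 2 <= limn (series (fun n => s n ^+ 2)).
Proof.
move=> /asboolP ss; apply: (nondecreasing_cvgn_le (u_ := series (fun n => s n ^+ 2))) => //.
by apply: nondecreasing_series => i _ _; rewrite sqr_ge0.
Qed.

Lemma square_summable_submod : submod_closed square_summable.
Proof.
split; first by apply: (@square_summable_bounded _ 0) => N; rewrite big1// => i _; rewrite expr0n.
move=> k s t ss tt; apply/asboolP.
have st := square_summable_mul ss tt.
have {ss}/asboolP ss := ss; have {tt}/asboolP tt := tt.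
have -> : series (fun n => (k *: s + t) n ^+ 2) =
   (fun N => k ^+ 2 * series (fun n => s n ^+ 2) N + (2 * k) * series (fun n => s n * t n) N
     + series (fun n => t n ^+ 2) N).
  apply/funext => N; rewrite /series/= !mulr_sumr -!big_split/=.
  by apply: eq_bigr => i _; rewrite (_ : (k *: s + t) i = k * s i + t i)//; ring.
apply: is_cvgD => //; apply: is_cvgD; exact: is_cvgMl_tmp.
Qed.

HB.instance Definition _ :=
  GRing.isSubmodClosed.Build R (nat -> R) square_summable square_summable_submod.

Record l2 := L2 { l2val :> nat -> R; l2P : l2val \in square_summable }.

HB.instance Definition _ := [isSub for l2val].
HB.instance Definition _ := [Choice of l2 by <:].
HB.instance Definition _ := [SubChoice_isSubLmodule of l2 by <:].

Definition l2ip (s t : l2) : R := limn (series (fun n => s n * t n)).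

Lemma l2ip_cvg (s t : l2) : series (fun n => s n * t n) @ \oo --> l2ip s t.
Proof. exact: square_summable_mul (l2P s) (l2P t). Qed.

Lemma l2ipxx (s : l2) : l2ip s s = limn (series (fun n => s n ^+ 2)).
Proof. by congr (limn (series _)); apply/funext => n; rewrite expr2. Qed.

Lemma l2ip_le (s : l2) N : \sum_(0 <= i < N) s i ^+ 2 <= l2ip s s.
Proof. by rewrite l2ipxx; exact: square_summable_le (l2P s). Qed.

Lemma l2_complete (u : nat -> l2) :
  (forall e : R, 0 < e -> exists N : nat, forall m n, (N <= m)%N -> (N <= n)%N ->
     l2ip (u m - u n) (u m - u n) < e) ->
  exists v, hlim l2ip u v.
Proof.
move=> hu.
have u_cvg i : cvgn (fun n => u n i).
  apply/cauchy_cvgP/cauchyP => e e0.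
  have [N hN] := hu (e ^+ 2) (exprn_gt0 _ e0).
  exists (u N i), N => // n /= Nn; rewrite /ball/=.
  rewrite -(@ltr_pXn2r _ 2)// ?nnegrE ?ltW// real_normK ?num_real//.
  apply: le_lt_trans (hN _ _ (leqnn N) Nn).
  apply: le_trans (l2ip_le _ i.+1); rewrite big_nat_recr//= lerDr sumr_ge0// => j _.
  exact: sqr_ge0.
pose s i := limn (fun n => u n i).
(* On finitely many coordinates the Cauchy bound passes to the coordinatewise limit, with a bound
   that does not depend on K. *)
have us e : 0 < e -> exists N : nat, forall m, (N <= m)%N -> forall K : nat,
    \sum_(0 <= i < K) (u m i - s i) ^+ 2 <= e.
  move=> e0; have [N hN] := hu e e0; exists N => m Nm K.
  have h : (fun n => \sum_(0 <= i < K) (u m i - u n i) ^+ 2) @ \oo -->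
      \sum_(0 <= i < K) (u m i - s i) ^+ 2.
    apply: cvg_big => [|i _]; first exact: add_continuous.
    by rewrite expr2; under eq_fun do rewrite expr2; apply: cvgM; (apply: cvgB;
      [exact: cvg_cst|exact: u_cvg]).
  rewrite -(cvg_lim _ h)//; apply: limr_le; first by apply/cvg_ex; eexists; exact: h.
  near=> n; apply: le_trans (l2ip_le (u m - u n) K) _; apply/ltW/hN => //.
  by near: n; exists N.
have sP : s \in square_summable.
  have [N hN] := us 1 ltr01.
  have d : ((u N : nat -> R) - s) \in square_summable.
    by apply: (@square_summable_bounded _ 1) => K; exact: hN.
  by rewrite -(subKr (u N : nat -> R) s) rpredB// l2P.
exists (L2 sP).
apply/cvgrPdist_le => e e0; have [N hN] := us e e0; near=> n.
have Nn : (N <= n)%N by near: n; exists N.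
have h0 : 0 <= l2ip (u n - L2 sP) (u n - L2 sP).
  by apply: le_trans (l2ip_le _ 0); rewrite big_nil.
rewrite sub0r normrN ger0_norm// l2ipxx; apply: limr_le; first exact/asboolP/l2P.
by near=> K; exact: hN.
Unshelve. all: by end_near. Qed.

Lemma l2_hilbert : hilbert l2ip.
Proof.
split.
- by move=> x y; congr (limn (series _)); apply/funext => n; rewrite mulrC.
- move=> x y z; apply/cvg_lim => //.
  have -> : series (fun n => (x + y) n * z n) =
      series (fun n => x n * z n) + series (fun n => y n * z n).
    by apply/funext => n; rewrite fctE /series/= -big_split; apply: eq_bigr => i _; exact: mulrDl.
  exact: cvgD (@l2ip_cvg x z) (@l2ip_cvg y z).
- move=> k x y; apply/cvg_lim => //.
  have -> : series (fun n => (k *: x) n * y n) = (fun N => k * series (fun n => x n * y n) N).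
    by apply/funext => n; rewrite /series/= mulr_sumr; apply: eq_bigr => i _; rewrite mulrA.
  exact: cvgMl_tmp (@l2ip_cvg x y).
- by move=> x; apply: le_trans (l2ip_le _ 0); rewrite big_nil.
- move=> x x0; apply: val_inj; apply/funext => i /=; apply/eqP.
  rewrite -sqrf_eq0 eq_le sqr_ge0 andbT -x0; apply: le_trans (l2ip_le x i.+1).
  by rewrite big_nat_recr//= lerDr sumr_ge0// => j _; exact: sqr_ge0.
- exact: l2_complete.
Qed.

(** The innovations are indexed by all integers, the coordinates of l^2 by naturals; even codes are
    the nonnegative integers. *)
Definition int_code (l : int) : nat :=
  match l with Posz n => n.*2 | Negz n => n.*2.+1 end.

Lemma int_code_inj : injective int_code.
Proof. by move=> [m|m] [n|n] /= h; [congr Posz| | |congr Negz]; lia. Qed.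

Definition delta_seq (k : nat) : nat -> R := fun n => (n == k)%:R.

Lemma delta_seq_square_summable k : delta_seq k \in square_summable.
Proof.
apply/asboolP/cvgP; apply: (@series_single _ (fun n => delta_seq k n ^+ 2) k) => j /negbTE.
by rewrite /delta_seq => ->; rewrite expr0n.
Qed.

Definition l2_basis (l : int) : l2 := L2 (delta_seq_square_summable (int_code l)).

Lemma l2ip_basis (w : l2) l : l2ip w (l2_basis l) = w (int_code l).
Proof.
apply: (cvgn_inj (@l2ip_cvg w (l2_basis l))).
rewrite -[in X in _ --> X](mulr1 (w (int_code l))).
have -> : 1 = l2_basis l (int_code l) by rewrite /= /delta_seq eqxx.
apply: (@series_single _ (fun n => w n * l2_basis l n)) => j /negbTE.
by rewrite /= /delta_seq => ->; rewrite mulr0.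
Qed.

Lemma l2_basis_on : orthonormal l2ip l2_basis.
Proof. by move=> i j; rewrite l2ip_basis /= /delta_seq (inj_eq int_code_inj) eq_sym. Qed.

Lemma l2_basis_complete (w : l2) : (forall l, l2ip w (l2_basis l) = 0) -> w = 0.
Proof.
move=> w0; apply: val_inj; apply/funext => n /=.
rewrite -(odd_double_half n); case: (odd n); rewrite /= ?add0n ?add1n.
  by have := w0 (Negz n./2); rewrite l2ip_basis.
by have := w0 (Posz n./2); rewrite l2ip_basis.
Qed.

End square_summable.

(** * Iterated sums as powers of a Hankel matrix *)

Lemma eq_iterated_sum (R : realType) (m : nat) (F G : seq nat -> R) :
  (forall s, size s = m -> F s = G s) -> iterated_sum m F = iterated_sum m G.
Proof.
elim: m F G => [|m IH] F G FG /=; first exact: FG.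
congr (limn (series _)); apply/funext => v; apply: IH => s sm.
by apply: FG => /=; rewrite sm.
Qed.

Lemma iterated_sumS (R : realType) (m : nat) (F : seq nat -> R) :
  iterated_sum m.+1 F = limn (series (fun v => iterated_sum m (fun s => F (v :: s)))).
Proof. by []. Qed.

Lemma hankel_iterS (R : realType) (c a : nat -> R) (n k i : nat) :
  hankel_iter c a n k.+1 i =
  limn (series (fun j => beta c a (n + 1 + i + j) * hankel_iter c a n k j)).
Proof. by []. Qed.

Section alpha_hankel.
Context {R : realType} (c a : nat -> R) (n : nat).
Hypothesis hankel_cvg : forall m i,
  cvgn (series (fun j => beta c a (n + 1 + i + j) * hankel_iter c a n m j)).

Lemma limn_seriesZ (K : R) (f : nat -> R) : cvgn (series f) ->
  limn (series (fun v => K * f v)) = K * limn (series f).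
Proof.
move=> cf.
have -> : series (fun v => K * f v) = (fun N => K * series f N).
  by apply/funext => N; rewrite /series/= mulr_sumr.
by apply/cvg_lim => //; exact: cvgMl_tmp.
Qed.

Lemma hankel1 i : hankel_iter c a n 1 i = beta c a (n + 1 + i).
Proof.
apply/cvg_lim => //.
have := @series_single R (fun j => beta c a (n + 1 + i + j) * (j == 0%N)%:R) 0%N.
rewrite mulr1 addn0; apply => j /negbTE ->; exact: mulr0.
Qed.

(* The tail of the iterated sum once v_1, ..., v_p are fixed, with v_p = i. *)
Lemma iterated_sum_hankel (m i : nat) (K : R) :
  iterated_sum m (fun s => K * ((\prod_(0 <= j < m)
      beta c a (n + 1 + nth 0%N (i :: s) j + nth 0%N (i :: s) j.+1)%N)
    * beta c a (n + 1 + nth 0%N (i :: s) m)%N)) = K * hankel_iter c a n m.+1 i.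
Proof.
elim: m i K => [|m IH] i K.
  by rewrite /iterated_sum big_nil mul1r hankel1.
rewrite iterated_sumS hankel_iterS -(limn_seriesZ K (@hankel_cvg m.+1 i)).
congr (limn (series _)); apply/funext => v.
rewrite mulrA -IH; apply: eq_iterated_sum => s sm.
by rewrite big_nat_recl//= !mulrA.
Qed.

(** The last factor is one more application of the matrix, to the unit vector at 0; the first, beta
    (n + v_1), lacks the summand 1 and stays outside. *)
Lemma alpha_hankel k : alpha_ c a k.*2.+1 n =
  limn (series (fun i => beta c a (n + i) * hankel_iter c a n k.*2 i)).
Proof.
rewrite /alpha_; case: k => [|k].
  rewrite /= ; apply/esym/cvg_lim => //.
  have := @series_single R (fun i => beta c a (n + i) * (i == 0%N)%:R) 0%N.
  rewrite mulr1 addn0; apply => j /negbTE ->; exact: mulr0.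
rewrite doubleS (_ : _ == _ = false)// iterated_sumS; congr (limn (series _)); apply/funext => v.
rewrite -(iterated_sum_hankel k.*2.+1); apply: eq_iterated_sum => s sm.
by rewrite /alpha_term subn2 /= mulrA.
Qed.

End alpha_hankel.

Theorem finite_predictor (R : realType) (c a : nat -> R) (n : nat) :
  cvgn (series (fun n => c n ^+ 2)) -> cvgn (series (fun n => `|a n|)) ->
  (forall n, \sum_(i < n.+1) a i * c (n - i)%N = - (n == 0%N)%:R) ->
  (0 < n)%N ->
  exists phi : nat -> R,
  (forall l, (l < n)%N ->
     \sum_(k < n) phi k * acov c `|k%:Z - l%:Z|%N = acov c (n - l)%N) /\
  \sum_(k < n) phi k * acov c (n - k)%N != acov c 0 /\
  (fun M : nat => \sum_(1 <= k < M.+1) alpha_ c a (2 * k - 1)%N n) @ \oo --> phi 0%N.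
Proof.
move=> c2 a1 ac n0.
have [phi [phi1 [phi2 phi3]]] :=
  predictor l2_hilbert l2_basis_on l2_basis_complete c2 a1 ac n0.
exists phi; split=> //; split=> //.
move: phi3; apply: cvg_trans; apply: near_eq_cvg; near=> M.
rewrite big_add1/= big_mkord; apply: eq_bigr => k _.
rewrite (_ : (2 * k.+1 - 1)%N = k.*2.+1); last by lia.
apply/esym/alpha_hankel => m i.
exact: (hankel_iter_cvg l2_hilbert l2_basis_on l2_basis_complete).
Unshelve. all: by end_near. Qed.

(** * The partial autocorrelation function *)

Section inner_L2.
Context d (Omega : measurableType d) (R : realType) (P : probability Omega R).
Local Notation L2 := (Lfun P 2%:E).

Let lee12 : (1 <= 2%:E :> \bar R)%E.
Proof. by rewrite lee_fin ler1n. Qed.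

Lemma L2_lin (k : R) (f g : Omega -> R) : f \in L2 -> g \in L2 ->
  (fun w => k * f w + g w) \in L2.
Proof. by move=> hf hg; exact: ((Lfun_submod_closed P lee12).2 k f g). Qed.

Lemma L2_0 : (fun=> 0) \in L2.
Proof. exact: (Lfun_submod_closed P lee12).1. Qed.

Lemma L2B (f g : Omega -> R) : f \in L2 -> g \in L2 -> (fun w => f w - g w) \in L2.
Proof.
move=> hf hg; rewrite (_ : (fun w => _) = (fun w => (-1) * g w + f w)).
  exact: L2_lin.
by apply/funext => w; rewrite mulN1r addrC.
Qed.

Lemma inner_integrable (f g : Omega -> R) : f \in L2 -> g \in L2 ->
  P.-integrable setT (EFin \o (fun w => f w * g w)).
Proof. by move=> hf hg; apply/Lfun1_integrable; exact: Lfun2_mul_Lfun1. Qed.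

Lemma innerE (f g : Omega -> R) : inner P f g = \int[P]_w (f w * g w).
Proof. by rewrite /inner unlock. Qed.

Lemma innerC (f g : Omega -> R) : inner P f g = inner P g f.
Proof. by rewrite !innerE; apply: eq_Rintegral => w _; rewrite mulrC. Qed.

Lemma inner_lin (k : R) (f g h : Omega -> R) : f \in L2 -> g \in L2 -> h \in L2 ->
  inner P (fun w => k * f w + g w) h = k * inner P f h + inner P g h.
Proof.
move=> hf hg hh; rewrite !innerE -RintegralZl//; last exact: inner_integrable.
rewrite -RintegralD//; first by apply: eq_Rintegral => w _; rewrite mulrDl mulrA.
- rewrite (_ : EFin \o _ = EFin \o (fun w => (k * f w + 0) * h w)).
    apply: inner_integrable => //; exact: (L2_lin k hf L2_0).
  by apply/funext => w /=; rewrite addr0 mulrA.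
- exact: inner_integrable.
Qed.

Lemma inner_ge0 (f : Omega -> R) : 0 <= inner P f f.
Proof. by rewrite innerE; apply: Rintegral_ge0 => w _; rewrite -expr2 sqr_ge0. Qed.

Lemma inner0l (h : Omega -> R) : h \in L2 -> inner P (fun=> 0) h = 0.
Proof.
move=> hh; have := inner_lin 1 L2_0 L2_0 hh.
rewrite (_ : (fun w => _) = (fun=> 0)); last by apply/funext => w; rewrite mulr0 addr0.
by move=> h0; lra.
Qed.

Lemma innerBl (f g h : Omega -> R) : f \in L2 -> g \in L2 -> h \in L2 ->
  inner P (fun w => f w - g w) h = inner P f h - inner P g h.
Proof.
move=> hf hg hh; rewrite (_ : (fun w => _) = (fun w => (-1) * g w + f w)).
  by rewrite inner_lin// mulN1r addrC.
by apply/funext => w; rewrite mulN1r addrC.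
Qed.

(** [inner] is only semidefinite on functions, so the case of a factor of norm 0 has to be argued
    through the quadratic polynomial [key]. *)
Lemma inner_cauchy_schwarz (f g : Omega -> R) : f \in L2 -> g \in L2 ->
  `|inner P f g| <= L2norm P f * L2norm P g.
Proof.
move=> hf hg.
have key t : 0 <= t ^+ 2 * inner P g g + 2 * t * inner P f g + inner P f f.
  have htg := L2_lin t hg hf.
  have := inner_ge0 (fun w => t * g w + f w).
  rewrite (inner_lin t hg hf htg) (innerC g) (innerC f).
  rewrite (inner_lin t hg hf hg) (inner_lin t hg hf hf) (innerC g f).
  by congr (0 <= _); ring.
rewrite /L2norm -sqrtrM ?inner_ge0// -sqrtr_sqr ler_sqrt; last by rewrite mulr_ge0// inner_ge0.
have [g0|g0] := eqVneq (inner P g g) 0.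
  rewrite g0 mulr0 expr2 le_eqVlt mulf_eq0 orbb; apply/orP; left.
  apply/negP => /negP fg0.
  (* The quadratic has become affine in t, and this t gives it the value -1. *)
  have := key (- (inner P f f + 1) / (2 * inner P f g)).
  rewrite g0 mulr0 add0r (_ : _ + _ = -1); first by rewrite ler0N1.
  by field.
have gp : 0 < inner P g g by rewrite lt_def g0 inner_ge0.
have := key (- inner P f g / inner P g g).
rewrite (_ : _ + _ = (inner P f f * inner P g g - inner P f g ^+ 2) / inner P g g); last by field.
by rewrite pmulr_lge0 ?invr_gt0// subr_ge0.
Qed.

Variable X : int -> {RV P >-> R}.
Hypothesis X2 : forall k, (X k : Omega -> R) \in L2.

Definition comb (s : seq (R * int)) : Omega -> R := fun w => \sum_(p <- s) p.1 * X p.2 w.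

Lemma comb_cons p s : comb (p :: s) = (fun w => p.1 * X p.2 w + comb s w).
Proof. by apply/funext => w; rewrite /comb big_cons. Qed.

Lemma comb_nil : comb [::] = (fun=> 0).
Proof. by apply/funext => w; rewrite /comb big_nil. Qed.

Lemma comb_L2 s : comb s \in L2.
Proof.
elim: s => [|p s IH]; first by rewrite comb_nil; exact: L2_0.
by rewrite comb_cons; apply: L2_lin.
Qed.

Lemma inner_comb s Z : Z \in L2 -> inner P (comb s) Z = \sum_(p <- s) p.1 * inner P (X p.2) Z.
Proof.
move=> hZ; elim: s => [|p s IH]; first by rewrite comb_nil inner0l// big_nil.
by rewrite comb_cons inner_lin ?comb_L2// IH big_cons.
Qed.

Lemma L2norm0 : L2norm P (fun=> 0) = 0.
Proof. by rewrite /L2norm inner0l ?L2_0// sqrtr0. Qed.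

Lemma comb_closed_span s (I : set int) : (forall p, p \in s -> I p.2) ->
  closed_span X I (comb s).
Proof.
move=> sI; split; first exact: comb_L2.
move=> e e0; exists (comb s); first by exists s.
by rewrite (_ : (fun w => _) = fun=> 0) ?L2norm0//; apply/funext => w; rewrite subrr.
Qed.

(** Orthogonality to the generators passes to their closed span by approximation and the
    Cauchy-Schwarz inequality. *)
Lemma comb_orth_compl s (I : set int) :
  (forall l, I l -> inner P (comb s) (X l) = 0) -> orth_compl X I (comb s).
Proof.
move=> sI; split; first exact: comb_closed_span.
move=> Z [Z2 hZ]; apply/eqP; rewrite -normr_le0; apply/ler_addgt0Pr => e e0; rewrite add0r.
have [|Z' [t [tI ->]] Zt] := hZ (e / (L2norm P (comb s) + 1)).
  by rewrite divr_gt0// ltr_wpDl// sqrtr_ge0.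
have t0 : inner P (comb t) (comb s) = 0.
  rewrite inner_comb ?comb_L2// big_seq big1// => p pt.
  by rewrite innerC sI ?mulr0//; exact: tI.
have -> : inner P (comb s) Z = inner P (comb s) (fun w => Z w - comb t w).
  by rewrite [RHS]innerC innerBl ?comb_L2// t0 subr0 innerC.
rewrite (le_trans (inner_cauchy_schwarz _ _)) ?comb_L2 ?L2B ?comb_L2//.
move: Zt; rewrite ltr_pdivlMr ?ltr_wpDl ?sqrtr_ge0// => /ltW; apply: le_trans.
by rewrite mulrC ler_wpM2l ?sqrtr_ge0// lerDl.
Qed.

(** [proj_perp] picks an unspecified representative, of which only the inner products with
    [orth_compl X I] are determined. The explicit residual shows that one exists and has these same
    inner products. *)
Lemma inner_proj_perp (s : seq (R * int)) (I : set int) (m : int) :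
  (forall p, p \in s -> I p.2) ->
  (forall l, I l -> inner P (comb ((1, m) :: s)) (X l) = 0) ->
  orth_compl X I (proj_perp X I (X m)) /\
  forall Z, orth_compl X I Z -> inner P (proj_perp X I (X m)) Z = inner P (comb ((1, m) :: s)) Z.
Proof.
move=> sI WI; set W := comb _ in WI *.
have KW : orth_compl X I W by exact: comb_orth_compl.
have W2 : W \in L2 by exact: comb_L2.
have XW Z : orth_compl X I Z -> inner P (fun w => X m w - W w) Z = 0.
  move=> [[Z2 _] hZ]; rewrite innerBl//.
  rewrite {1}/W comb_cons inner_lin ?comb_L2// mul1r opprD addrA subrr sub0r.
  by rewrite innerC hZ ?oppr0//; exact: comb_closed_span.
have [KV XV] : [set W | orth_compl X I W /\
    forall Z, orth_compl X I Z -> inner P (fun w => X m w - W w) Z = 0]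
    (proj_perp X I (X m)) by apply: xgetPex; exists W.
split=> // Z KZ; have := XV Z KZ; have := XW Z KZ.
have Z2 : Z \in L2 by case: KZ => -[].
have V2 : proj_perp X I (X m) \in L2 by case: KV => -[].
by rewrite !innerBl// => /eqP; rewrite subr_eq0 => /eqP -> /eqP; rewrite subr_eq0 => /eqP ->.
Qed.

End inner_L2.

(** [phi] solves the normal equations of order n and [psi] those of order n - 1. The latter give
    both residuals in the PACF; their inner product is [phi 0] times the error variance, which is
    also the denominator. *)
Lemma pacf_predictor d (Omega : measurableType d) (R : realType)
    (P : probability Omega R) (X : int -> {RV P >-> R}) (g : nat -> R) (n : nat)
    (phi psi : nat -> R) :
  weakly_stationary X -> (forall m : nat, autocov X m%:Z = g m) -> (2 <= n)%N ->
  (forall l, (l < n)%N -> \sum_(k < n) phi k * g `|k%:Z - l%:Z|%N = g (n - l)%N) ->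
  (forall l, (l < n.-1)%N -> \sum_(k < n.-1) psi k * g `|k%:Z - l%:Z|%N = g (n.-1 - l)%N) ->
  \sum_(k < n.-1) psi k * g (n.-1 - k)%N != g 0%N ->
  pacf X n = phi 0%N.
Proof.
move=> [X2 _ Xst] Xg n2 hphi hpsi hv.
have XX (i j : int) : inner P (X i) (X j) = g `|i - j|%N.
  wlog ji : i j / j <= i.
    move=> wl; have [/wl//|/ltW/wl ij] := leP j i; rewrite innerC ij; congr g; lia.
  rewrite -Xg /autocov; have := Xst `|i - j|%N%:Z 0 j.
  by rewrite add0r (_ : `|_|%N%:Z + j = i)//; lia.
set I := [set k : int | 1 <= k <= n%:Z - 1].
(* By stationarity the same coefficients, read backwards in time, serve to predict X 0 from the
   variables between 0 and n. *)
pose sn : seq (R * int) := [seq (- psi k, k%:Z + 1) | k <- iota 0 n.-1].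
pose s0 : seq (R * int) := [seq (- psi k, n%:Z - (k%:Z + 1)) | k <- iota 0 n.-1].
have snI p : p \in sn -> I p.2.
  by move=> /mapP[k]; rewrite mem_iota => kn -> /=; rewrite /I/=; lia.
have s0I p : p \in s0 -> I p.2.
  by move=> /mapP[k]; rewrite mem_iota => kn -> /=; rewrite /I/=; lia.
have sn_in m : inner P (comb X ((1, n%:Z) :: sn)) (X m) =
    g `|n%:Z - m|%N - \sum_(k < n.-1) psi k * g `|(k%:Z + 1 - m)%R|%N.
  rewrite inner_comb// big_cons big_map /= mul1r XX; congr (_ + _).
  rewrite -sumrN -(big_mkord predT (fun k =>
    - (psi k * g `|(k%:Z + 1 - m)%R|%N))) /index_iota subn0.
  by apply: eq_bigr => k _; rewrite XX mulNr.
have s0_in m : inner P (comb X ((1, 0) :: s0)) (X m) =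
    g `|0 - m|%N - \sum_(k < n.-1) psi k * g `|(n%:Z - (k%:Z + 1) - m)%R|%N.
  rewrite inner_comb// big_cons big_map /= mul1r XX; congr (_ + _).
  rewrite -sumrN -(big_mkord predT (fun k =>
    - (psi k * g `|(n%:Z - (k%:Z + 1) - m)%R|%N))) /index_iota subn0.
  by apply: eq_bigr => k _; rewrite XX mulNr.
have snO l : I l -> inner P (comb X ((1, n%:Z) :: sn)) (X l) = 0.
  rewrite /I /= => Il; rewrite sn_in; apply/eqP; rewrite subr_eq0 eq_sym; apply/eqP.
  have := hpsi `|l - 1|%N; rewrite (_ : (n.-1 - `|l - 1|)%N = `|n%:Z - l|%N); last by lia.
  move=> <-; last by lia.
  by apply: eq_bigr => k _; congr (_ * g _); lia.
have s0O l : I l -> inner P (comb X ((1, 0) :: s0)) (X l) = 0.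
  rewrite /I /= => Il; rewrite s0_in; apply/eqP; rewrite subr_eq0 eq_sym; apply/eqP.
  have := hpsi (n.-1 - `|l|)%N; rewrite (_ : (n.-1 - (n.-1 - `|l|))%N = `|0 - l|%N); last by lia.
  move=> <-; last by lia.
  by apply: eq_bigr => k _; congr (_ * g _); lia.
have [Kn pn] := inner_proj_perp X2 snI snO.
have [K0 p0] := inner_proj_perp X2 s0I s0O.
have KWn : orth_compl X I (comb X ((1, n%:Z) :: sn)) by exact: comb_orth_compl.
have KW0 : orth_compl X I (comb X ((1, 0) :: s0)) by exact: comb_orth_compl.
set Wn := comb X _ in pn KWn snO sn_in; set W0 := comb X _ in p0 KW0 s0O s0_in.
pose v := g 0%N - \sum_(k < n.-1) psi k * g (n.-1 - k)%N.
have Wn2 : Wn \in Lfun P 2%:E by exact: comb_L2.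
have W02 : W0 \in Lfun P 2%:E by exact: comb_L2.
have XnWn : inner P (X n%:Z) Wn = v.
  rewrite innerC sn_in subrr; congr (_ - _); apply: eq_bigr => k _.
  by congr (_ * g _); have := ltn_ord k; lia.
have X0W0 : inner P (X 0) W0 = v.
  rewrite innerC s0_in subrr; congr (_ - _); apply: eq_bigr => k _.
  by congr (_ * g _); have := ltn_ord k; lia.
have WZ s m Z : (forall p, p \in s -> I p.2) -> Z \in Lfun P 2%:E ->
    (forall l, I l -> inner P Z (X l) = 0) ->
    inner P (comb X ((1, m) :: s)) Z = inner P (X m) Z.
  move=> sI Z2 ZO; rewrite inner_comb// big_cons mul1r big_seq big1 ?addr0// => p ps.
  by rewrite innerC ZO ?mulr0//; exact: sI.
have WnWn : inner P Wn Wn = v by rewrite {1}/Wn WZ.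
(* [W0] is a combination of X 0, ..., X (n-1), so the normal equations of order n allow replacing X
   n by its predictor; orthogonality of [W0] to X 1, ..., X (n-1) leaves the term of [phi 0]
   alone. *)
have WnW0 : inner P Wn W0 = phi 0%N * v.
  rewrite {1}/Wn WZ//.
  have XnW0 : \sum_(k < n) phi k * inner P (X k%:Z) W0 = inner P (X n%:Z) W0.
    have W0X m : inner P (X m) W0 = \sum_(p <- (1, 0) :: s0) p.1 * g `|p.2 - m|%N.
      by rewrite innerC inner_comb//; apply: eq_bigr => p _; rewrite XX.
    under eq_bigr do rewrite W0X mulr_sumr.
    rewrite exchange_big W0X big_seq [RHS]big_seq; apply: eq_bigr => p ps /=.
    have [p0' pn'] : 0 <= p.2 /\ p.2 < n%:Z.
      move: ps; rewrite inE => /predU1P[->/=|/s0I]; first by lia.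
      by rewrite /I/=; lia.
    have := hphi `|p.2|%N; rewrite (_ : (n - `|p.2|)%N = `|p.2 - n%:Z|%N); last by lia.
    move=> <-; last by lia.
    rewrite mulr_sumr; apply: eq_bigr => k _; rewrite mulrCA; congr (_ * (_ * g _)).
    by move: (p.2 : int) p0' pn' => q; lia.
  have n0 : (0 < n)%N by lia.
  rewrite -XnW0 (bigD1 (Ordinal n0))//= X0W0 big1 ?addr0// => k /eqP k0.
  rewrite innerC s0O ?mulr0// /I /=.
  have k0' : k != 0%N :> nat by apply/eqP => k0'; apply: k0; exact: val_inj.
  by have := ltn_ord k; lia.
rewrite /pacf leqNgt n2/= -/I /L2norm sqr_sqrtr ?inner_ge0//.
rewrite pn// innerC p0// innerC [X in _ / X]pn// [X in _ / X]innerC pn// WnWn WnW0 mulfK//.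
by rewrite subr_eq0 eq_sym.
Qed.

(** * Power series on circles *)

Section series_tools.
Context {R : realType}.

Lemma series_dominated (f M : nat -> R) :
  (forall n, `|f n| <= M n) -> cvgn (series M) -> cvgn (series f).
Proof.
move=> fM cM; apply: normed_cvg; apply: series_le_cvg cM => // n; first exact: normr_ge0.
by rewrite (le_trans _ (fM n)).
Qed.

Lemma series_dist_tail (f M : nat -> R) (N : nat) (e : R) :
  (forall n, `|f n| <= M n) -> cvgn (series M) ->
  (forall n, (N <= n)%N -> \sum_(N <= i < n) M i <= e) ->
  `|limn (series f) - series f N| <= e.
Proof.
move=> fM cM Me; have cf := series_dominated fM cM.
have : (fun n => `|series f n - series f N|) @ \oo --> `|limn (series f) - series f N|.
  by apply: cvg_norm; apply: cvgB => //; exact: cvg_cst.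
move=> /cvg_lim h; rewrite -h//; apply: limr_le.
  by apply/cvg_ex; eexists; apply: cvg_norm; apply: cvgB; [exact: cf|exact: cvg_cst].
near=> n; have Nn : (N <= n)%N by near: n; exists N.
rewrite sub_series_geq// (le_trans (ler_norm_sum _ _ _))// (le_trans _ (Me n Nn))//.
exact: ler_sum.
Unshelve. all: by end_near. Qed.

Lemma mtest_continuous (T : topologicalType) (f : nat -> T -> R) (M : nat -> R) :
  (forall n, continuous (f n)) -> (forall n t, `|f n t| <= M n) ->
  cvgn (series M) -> continuous (fun t => limn (series (f^~ t))).
Proof.
move=> cf fM cM t0; apply/cvgrPdist_lt => e e0.
have [N hN] := series_tail cM (divr_gt0 e0 (ltr0Sn _ 2)).
have tl t : `|limn (series (f^~ t)) - series (f^~ t) N| <= e / 3.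
  apply: (@series_dist_tail _ M) => // n Nn.
  by rewrite (le_trans (ler_norm _))// ltW// hN.
have cN : {for t0, continuous (fun t => series (f^~ t) N)}.
  by apply: cvg_big => [|i _]; [exact: add_continuous|exact: cf].
move/cvgrPdist_lt: cN => /(_ _ (divr_gt0 e0 (ltr0Sn _ 2))) cN.
near=> t.
have h : `|series (f^~ t0) N - series (f^~ t) N| < e / 3 by near: t; exact: cN.
have h1 := tl t0; have h2 := tl t.
move: h h1 h2; rewrite ltr_norml !ler_norml => /andP[? ?] /andP[? ?] /andP[? ?].
by rewrite ltr_norml; apply/andP; split; lra.
Unshelve. all: by end_near. Qed.

Lemma geometric_bound_cvg (u : nat -> R) (K r s : R) : 0 <= r -> r < s ->
  (forall n, `|u n| * s ^+ n <= K) -> cvgn (series (fun n => `|u n| * r ^+ n)).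
Proof.
move=> r0 rs uK; have s0 : 0 < s by exact: le_lt_trans rs.
apply: (@series_dominated _ (fun n => K * (r / s) ^+ n)).
  move=> n; rewrite normrM normr_id (ger0_norm (exprn_ge0 _ r0)) expr_div_n mulrA.
  rewrite ler_pdivlMr ?exprn_gt0// mulrAC ler_wpM2r ?exprn_ge0//; exact: uK.
have := @is_cvg_geometric_series R K (r / s); rewrite ger0_norm; last by rewrite divr_ge0// ltW.
by apply; rewrite ltr_pdivrMr// mul1r.
Qed.

Lemma cvg_series_bounded_terms (u : nat -> R) : cvgn (series u) ->
  exists K, forall n, `|u n| <= K.
Proof.
move=> /cvg_series_cvg_0 /cvgP /cvg_seq_bounded [M [_ hM]].
exists (`|M| + 1) => n; apply: hM => //.
by rewrite (le_lt_trans (ler_norm _))// ltrDl.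
Qed.

End series_tools.

Section disk.
Context {R : realType}.
Local Open Scope complex_scope.

Definition polar (r t : R) : R[i] := (r * cos t) +i* (r * sin t).

Lemma polar_expr (r t : R) n :
  polar r t ^+ n = (r ^+ n * cos (n%:R * t)) +i* (r ^+ n * sin (n%:R * t)).
Proof.
elim: n => [|n IH]; first by rewrite !expr0 mul0r cos0 sin0 mul1r mulr0.
rewrite exprS IH /polar; simpc.
rewrite -addn1 natrD mulrDl mul1r cosD sinD exprD expr1.
by congr (_ +i* _); ring.
Qed.

Lemma norm_polar (r t : R) : `|polar r t| = `|r|%:C.
Proof.
by rewrite normc_def /= !exprMn -mulrDr cos2Dsin2 mulr1 sqrtr_sqr.
Qed.

Lemma polar_lt1 (r t : R) : 0 <= r < 1 -> `|polar r t| < 1.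
Proof. by case/andP=> r0 r1; rewrite norm_polar (ger0_norm r0) ltcR. Qed.

Lemma cvg_ReIm (u : nat -> R[i]) (l : R[i]) :
  (u : nat -> R[i]^o) @ \oo --> (l : R[i]^o) ->
  (fun n => complex.Re (u n)) @ \oo --> complex.Re l /\
  (fun n => complex.Im (u n)) @ \oo --> complex.Im l.
Proof.
move=> ul.
have h (e : R) : 0 < e -> \forall n \near \oo, `|l - u n| < e%:C.
  by move=> e0; move/cvgrPdist_lt: ul => /(_ e%:C); apply; rewrite ltcR.
split; apply/cvgrPdist_lt => e e0; near=> n.
- have : `|l - u n| < e%:C by near: n; exact: h.
  rewrite normc_def ltcR; apply: le_lt_trans.
  by rewrite -raddfB/= -sqrtr_sqr ler_wsqrtr// lerDl sqr_ge0.
- have : `|l - u n| < e%:C by near: n; exact: h.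
  rewrite normc_def ltcR; apply: le_lt_trans.
  by rewrite -raddfB/= -sqrtr_sqr ler_wsqrtr// lerDr sqr_ge0.
Unshelve. all: by end_near. Qed.

(** With [sin_sum], the real and imaginary parts of the power series with real coefficients [u] at
    [polar r t]. *)
Definition cos_sum (u : nat -> R) (r t : R) : R :=
  limn (series (fun n => u n * r ^+ n * cos (n%:R * t))).
Definition sin_sum (u : nat -> R) (r t : R) : R :=
  limn (series (fun n => u n * r ^+ n * sin (n%:R * t))).

Lemma disk_polar (f : R[i] -> R[i]) (u : nat -> R) (r t : R) :
  disk_expansion f u -> 0 <= r < 1 ->
  [/\ series (fun n => u n * r ^+ n * cos (n%:R * t)) @ \oo --> complex.Re (f (polar r t)),
      series (fun n => u n * r ^+ n * sin (n%:R * t)) @ \oo --> complex.Im (f (polar r t))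
    & f (polar r t) = cos_sum u r t +i* sin_sum u r t].
Proof.
move=> fu r01; have [h1 h2] := cvg_ReIm (fu _ (polar_lt1 t r01)).
have E n : (u n)%:C * polar r t ^+ n =
    (u n * r ^+ n * cos (n%:R * t)) +i* (u n * r ^+ n * sin (n%:R * t)).
  by rewrite polar_expr; simpc; rewrite !mulrA.
have cR : series (fun n => u n * r ^+ n * cos (n%:R * t)) @ \oo --> complex.Re (f (polar r t)).
  move: h1; apply: cvg_trans; apply: near_eq_cvg; near=> n.
  rewrite /series/= (big_morph (@complex.Re R) (id1 := 0) (op1 := +%R))//;
    last by move=> [? ?] [? ?].
  by apply: eq_bigr => i _; rewrite E.
have cI : series (fun n => u n * r ^+ n * sin (n%:R * t)) @ \oo --> complex.Im (f (polar r t)).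
  move: h2; apply: cvg_trans; apply: near_eq_cvg; near=> n.
  rewrite /series/= (big_morph (@complex.Im R) (id1 := 0) (op1 := +%R))//;
    last by move=> [? ?] [? ?].
  by apply: eq_bigr => i _; rewrite E.
split => //; rewrite /cos_sum /sin_sum (cvg_lim _ cR)// (cvg_lim _ cI)//.
by case: (f _).
Unshelve. all: by end_near. Qed.

Lemma disk_abs_cvg (f : R[i] -> R[i]) (u : nat -> R) (r : R) :
  disk_expansion f u -> 0 <= r < 1 -> cvgn (series (fun n => `|u n| * r ^+ n)).
Proof.
move=> fu /andP[r0 r1].
(* At a radius strictly between r and 1 the terms are bounded, so at r they decay geometrically. *)
have s01 : 0 <= (r + 1) / 2 < 1 by apply/andP; split; lra.
have [h _ _] := disk_polar 0 fu s01.
have [K hK] := cvg_series_bounded_terms (cvgP _ h).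
apply: (@geometric_bound_cvg _ _ K r ((r + 1) / 2)) => //; first lra.
move=> n; have := hK n; rewrite mulr0 cos0 mulr1 normrM (ger0_norm (exprn_ge0 _ _))//.
by case/andP: s01.
Qed.

End disk.

(** * Products of power series on the real axis *)

Section real_axis.
Context {R : realType}.

(* p.[x] = O(x^m) near 0 forces the coefficients below m to vanish. *)
Lemma poly_bigO_coef0 (p : {poly R}) (m : nat) (B : R) :
  (forall x, 0 < x -> x <= 4^-1 -> `|p.[x]| <= B * x ^+ m) ->
  forall i, (i < m)%N -> p`_i = 0.
Proof.
elim: m p B => // m IH p B hp.
have p0 : p`_0 = 0.
  have x0 : (fun n => 4^-1 / n.+1%:R) @ \oo --> (0 : R).
    by rewrite -(mulr0 4^-1); apply: cvgMl_tmp; exact: cvg_harmonic.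
  have c0 : (fun n => `|p.[4^-1 / n.+1%:R]|) @ \oo --> `|p.[0]|.
    apply: cvg_norm; exact: cvg_comp x0 (@continuous_horner R p 0).
  rewrite -horner_coef0; apply/eqP; rewrite -normr_le0.
  have h : (fun n => B * (4^-1 / n.+1%:R) ^+ m.+1) @ \oo --> (0 : R).
    rewrite -(mulr0 B); apply: cvgMl_tmp.
    have -> : 0 = 0 ^+ m.+1 :> R by rewrite expr0n.
    exact: cvg_comp x0 (@exprn_continuous R m.+1 0).
  apply: (ler_cvg_to c0 h); near=> n; apply: hp; first by rewrite divr_gt0.
  by rewrite ler_pdivrMr// ler_peMr// ler1n.
have [q pq] : exists q, p = q * 'X.
  by apply/dvdpP; rewrite -['X]subr0 dvdp_XsubCl rootE horner_coef0 p0.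
have hq : forall i, (i < m)%N -> q`_i = 0.
  apply: (IH q B) => x x0 x1; have := hp x x0 x1.
  by rewrite pq hornerMX normrM (gtr0_norm x0) exprSr mulrA ler_pM2r.
by case=> [|i] im //; rewrite pq coefMX /= hq.
Unshelve. all: by end_near. Qed.

(** The coefficients are at most K 2^n, so for x <= 1/4 the tail is dominated by a geometric series
    of ratio 2x <= 1/2, whose summation costs the extra factor 2. *)
Lemma power_series_remainder (u : nat -> R) (K : R) (m : nat) (x l : R) :
  (forall n, `|u n| * 2^-1 ^+ n <= K) -> 0 < x -> x <= 4^-1 ->
  series (fun n => u n * x ^+ n) @ \oo --> l ->
  `|l - (\poly_(i < m) u i).[x]| <= K * 2 ^+ m.+1 * x ^+ m.
Proof.
move=> uK x0 x1 ul.
have K0 : 0 <= K by rewrite (le_trans _ (uK 0%N))// mulr_ge0.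
rewrite -(cvg_lim _ ul)// horner_poly -(big_mkord predT (fun i => u i * x ^+ i)).
have MK n : `|u n * x ^+ n| <= K * (2 * x) ^+ n.
  rewrite normrM (ger0_norm (exprn_ge0 _ (ltW x0))).
  rewrite exprMn mulrA ler_wpM2r ?exprn_ge0 ?(ltW x0)//.
  by rewrite -ler_pdivrMr ?exprn_gt0// -exprVn.
have x21 : `|2 * x| < 1 by rewrite ger0_norm ?mulr_ge0 ?ltW//; lra.
apply: (series_dist_tail (M := fun n => K * (2 * x) ^+ n)) => //.
  exact: is_cvg_geometric_series.
move=> n mn.
have -> : \sum_(m <= i < n) K * (2 * x) ^+ i =
  K * (2 * x) ^+ m * \sum_(0 <= i < n - m) (2 * x) ^+ i.
  rewrite -{1}(add0n m) big_addn mulr_sumr; apply: eq_bigr => i _.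
  by rewrite addnC exprD mulrA.
have -> : K * 2 ^+ m.+1 * x ^+ m = K * (2 * x) ^+ m * 2 by rewrite exprMn exprS; ring.
apply: ler_wpM2l; first by rewrite mulr_ge0// exprn_ge0// mulr_ge0// ltW.
have g : \sum_(0 <= i < n - m) (2 * x) ^+ i * (1 - 2 * x) = 1 - (2 * x) ^+ (n - m).
  rewrite -mulr_suml; elim: (n - m)%N => [|k IH]; first by rewrite big_nil expr0 subrr mul0r.
  by rewrite big_nat_recr//= mulrDl IH exprSr; ring.
have d0 : 0 < 1 - 2 * x by lra.
rewrite -(ler_pM2r d0) mulr_suml g.
have : 0 <= (2 * x) ^+ (n - m) by rewrite exprn_ge0// mulr_ge0// ltW.
lra.
Qed.

(** The product of the truncations to degree n differs from k by O(x^(n+1)) on ]0, 1/4], which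
    determines its coefficient of degree n by [poly_bigO_coef0]. *)
Lemma power_series_convolution (a c : nat -> R) (F G : R -> R) (k : R) :
  (forall x, 0 <= x < 1 -> series (fun n => a n * x ^+ n) @ \oo --> F x) ->
  (forall x, 0 <= x < 1 -> series (fun n => c n * x ^+ n) @ \oo --> G x) ->
  (forall x, 0 <= x < 1 -> F x * G x = k) ->
  forall n, \sum_(i < n.+1) a i * c (n - i)%N = (n == 0%N)%:R * k.
Proof.
move=> aF cG FG n.
have half : 0 <= (2^-1 : R) < 1 by apply/andP; split; lra.
have bounded (u : nat -> R) (l : R) : series (fun n => u n * 2^-1 ^+ n) @ \oo --> l ->
    exists K, forall n, `|u n| * 2^-1 ^+ n <= K.
  move=> /cvgP/cvg_series_bounded_terms[K hK]; exists K => m.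
  by have := hK m; rewrite normrM (ger0_norm (exprn_ge0 _ _)).
have [K hK] := bounded _ _ (aF _ half); have [L hL] := bounded _ _ (cG _ half).
have K0 : 0 <= K by rewrite (le_trans _ (hK 0%N))// mulr_ge0.
have L0 : 0 <= L by rewrite (le_trans _ (hL 0%N))// mulr_ge0.
pose p := \poly_(i < n.+1) a i; pose q := \poly_(i < n.+1) c i.
have pq : (p * q)`_n = \sum_(i < n.+1) a i * c (n - i)%N.
  rewrite coefM; apply: eq_bigr => i _; rewrite !coef_poly ltn_ord.
  by rewrite ltnS leq_subr.
pose B := K * 2 ^+ n.+2; pose D := L * 2 ^+ n.+2.
have B0 : 0 <= B by rewrite mulr_ge0// exprn_ge0.
have D0 : 0 <= D by rewrite mulr_ge0// exprn_ge0.
pose T := \sum_(i < n.+1) `|a i|; pose S := \sum_(i < n.+1) `|c i|.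
have T0 : 0 <= T by apply: sumr_ge0.
have poly_le (u : nat -> R) x : 0 < x -> x <= 4^-1 ->
    `|(\poly_(i < n.+1) u i).[x]| <= \sum_(i < n.+1) `|u i|.
  move=> x0 x1; rewrite horner_poly (le_trans (ler_norm_sum _ _ _))//.
  apply: ler_sum => i _; rewrite normrM ler_piMr//.
  by rewrite ger0_norm ?exprn_ge0 ?exprn_ile1 ?ltW//; lra.
have : (p * q - k%:P)`_n = 0.
  apply: (@poly_bigO_coef0 _ n.+1 (B * S + (B + T) * D)) => // x x0 x1.
  have x01 : 0 <= x < 1 by apply/andP; split; lra.
  have hF := power_series_remainder n.+1 hK x0 x1 (aF x x01).
  have hG := power_series_remainder n.+1 hL x0 x1 (cG x x01).
  rewrite -/p -/q -/B -/D in hF hG.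
  have xn1 : x ^+ n.+1 <= 1 by rewrite exprn_ile1 ?ltW//; lra.
  have xn0 : 0 <= x ^+ n.+1 by rewrite exprn_ge0// ltW.
  have FT : `|F x| <= B + T.
    rewrite -(subrK p.[x] (F x)) (le_trans (ler_normD _ _))// lerD ?poly_le//.
    by rewrite (le_trans hF)// ler_piMr.
  rewrite hornerD hornerN hornerC hornerM -(FG x x01).
  rewrite (_ : _ - _ = - ((F x - p.[x]) * q.[x]) - F x * (G x - q.[x])); last by ring.
  rewrite [leRHS]mulrDl (le_trans (ler_normB _ _))// normrN !normrM lerD//.
    by rewrite mulrAC ler_pM// poly_le.
  by rewrite -mulrA ler_pM.
rewrite coefB coefC pq => /eqP; rewrite subr_eq0 => /eqP ->.
by case: (n == 0%N); rewrite ?mul1r ?mul0r.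
Qed.

End real_axis.

(** * The modulus of the Szego function and the sign of its reciprocal *)

Section szego_modulus.
Context {R : realType}.
Local Open Scope complex_scope.

Lemma Re_realMl (k : R) (z : R[i]) : complex.Re (k%:C * z) = k * complex.Re z.
Proof. by case: z => x y; simpc. Qed.

Lemma Re_realMr (k : R) (z : R[i]) : complex.Re (z * k%:C) = complex.Re z * k.
Proof. by case: z => x y; simpc. Qed.

Lemma Im_realMl (k : R) (z : R[i]) : complex.Im (k%:C * z) = k * complex.Im z.
Proof. by case: z => x y; simpc. Qed.

Definition poisson (r s : R) : R := (1 - r ^+ 2) / (1 - 2 * r * cos s + r ^+ 2).

Lemma poisson_den (r s : R) :
  1 - 2 * r * cos s + r ^+ 2 = (1 - r) ^+ 2 + 2 * r * (1 - cos s).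
Proof. by ring. Qed.

Lemma poisson_den_ge (r s : R) : 0 <= r -> (1 - r) ^+ 2 <= 1 - 2 * r * cos s + r ^+ 2.
Proof.
by move=> r0; rewrite poisson_den lerDl mulr_ge0 ?mulr_ge0// subr_ge0 cos_le1.
Qed.

Lemma poisson_den_gt0 (r s : R) : 0 <= r < 1 -> 0 < 1 - 2 * r * cos s + r ^+ 2.
Proof.
move=> /andP[r0 r1]; apply: lt_le_trans (poisson_den_ge s r0).
by rewrite exprn_gt0// subr_gt0.
Qed.

Lemma poisson_gt0 (r s : R) : 0 <= r < 1 -> 0 < poisson r s.
Proof.
move=> r01; apply: divr_gt0; last exact: poisson_den_gt0.
by rewrite subr_gt0 expr_lt1//; case/andP: r01.
Qed.

Lemma expiE (t : R) : expi t = cos t +i* sin t.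
Proof. by rewrite /expi /cexp /= expR0; simpc. Qed.

Lemma Re_herglotz (r t th : R) :
  complex.Re ((expi th + polar r t) / (expi th - polar r t)) = poisson r (th - t).
Proof.
rewrite expiE /polar; simpc.
rewrite /= !mulrA -mulrDl /poisson cosB.
have <- : (cos th + r * cos t) * (cos th - r * cos t) + (sin th + r * sin t) * (sin th - r * sin t)
    = 1 - r ^+ 2.
  have := cos2Dsin2 th; have := cos2Dsin2 t => h1 h2.
  rewrite (_ : 1 - r ^+ 2 = (cos th ^+ 2 + sin th ^+ 2) - r ^+ 2 * (cos t ^+ 2 + sin t ^+ 2)).
    by ring.
  by rewrite h1 h2 mulr1.
have <- : (cos th - r * cos t) ^+ 2 + (sin th - r * sin t) ^+ 2 =
    1 - 2 * r * (cos th * cos t + sin th * sin t) + r ^+ 2.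
  have := cos2Dsin2 th; have := cos2Dsin2 t => h1 h2.
  rewrite (_ : 1 - _ + r ^+ 2 = (cos th ^+ 2 + sin th ^+ 2) -
      2 * r * (cos th * cos t + sin th * sin t) + r ^+ 2 * (cos t ^+ 2 + sin t ^+ 2)).
    by ring.
  by rewrite h1 h2 mulr1.
by [].
Qed.

Lemma norm_cexp (z : R[i]) : `|cexp z| = (expR (complex.Re z))%:C.
Proof.
have n1 : `|cos (complex.Im z) +i* sin (complex.Im z)| = 1 :> R[i].
  by rewrite normc_def /= cos2Dsin2 sqrtr1.
by rewrite /cexp normrM n1 mulr1 ger0_norm// ler0c expR_ge0.
Qed.

Lemma szego_neq0 (Delta : R -> R) (z : R[i]) : szego Delta z != 0.
Proof.
rewrite -normr_eq0 normrM norm_cexp mulf_neq0//.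
  by rewrite normr_eq0 fmorph_eq0 sqrtr_eq0 -ltNge mulr_gt0// pi_gt0.
by rewrite gt_eqF// ltcR expR_gt0.
Qed.

Definition log_poisson (Delta : R -> R) (r t : R) : R :=
  (2 * pi)^-1 * \int[@lebesgue_measure R]_(th in circle R) (poisson r (th - t) * ln (Delta th)).

Lemma szego_norm (Delta : R -> R) (r t : R) :
  `|szego Delta (polar r t)| ^+ 2 = (2 * pi * expR (log_poisson Delta r t))%:C.
Proof.
rewrite normrM norm_cexp Re_realMl exprMn.
have -> : complex.Re (cintegral (@lebesgue_measure R) (circle R) (fun th =>
      (expi th + polar r t) / (expi th - polar r t) * (ln (Delta th))%:C)) =
    \int[@lebesgue_measure R]_(th in circle R) (poisson r (th - t) * ln (Delta th)).
  by apply: eq_Rintegral => th _; rewrite Re_realMr Re_herglotz.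
have p0 : 0 <= 2 * pi :> R by rewrite mulr_ge0// pi_ge0.
rewrite ger0_norm ?ler0c ?sqrtr_ge0// -!rmorphXn -rmorphM; congr (_%:C).
rewrite sqr_sqrtr// -expRM_natl; congr (_ * expR _).
rewrite /log_poisson mulrA; congr (_ * _).
rewrite (_ : 4 * pi = 2 * (2 * pi)); last by ring.
by rewrite invfM mulVKf.
Qed.

Lemma szego_polar_modulus (Delta : R -> R) (c a : nat -> R) (r t : R) :
  MA_coefficients Delta c -> AR_coefficients Delta a -> 0 <= r < 1 ->
  cos_sum c r t ^+ 2 + sin_sum c r t ^+ 2 = 2 * pi * expR (log_poisson Delta r t) /\
  (cos_sum c r t ^+ 2 + sin_sum c r t ^+ 2) * (cos_sum a r t ^+ 2 + sin_sum a r t ^+ 2) = 1.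
Proof.
move=> hc ha r01.
have [_ _ cE] := disk_polar t hc r01; have [_ _ aE] := disk_polar t ha r01.
have nc := add_Re2_Im2 (szego Delta (polar r t)).
have na := add_Re2_Im2 (- (szego Delta (polar r t))^-1).
rewrite aE cE /= in na nc; split.
  by apply: (@complexI R); rewrite nc -cE szego_norm.
apply: (@complexI R); rewrite rmorphM/= nc na -aE -cE -exprMn -normrM mulrN normrN divff.
  by rewrite normr1 expr1n.
exact: szego_neq0.
Qed.

Lemma szego_real_axis (Delta : R -> R) (c a : nat -> R) (x : R) :
  MA_coefficients Delta c -> AR_coefficients Delta a -> 0 <= x < 1 ->
  [/\ series (fun n => c n * x ^+ n) @ \oo --> cos_sum c x 0,
      series (fun n => a n * x ^+ n) @ \oo --> cos_sum a x 0
    & cos_sum a x 0 * cos_sum c x 0 = - 1].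
Proof.
move=> hc ha x01.
have cos0E (u : nat -> R) : (fun n => u n * x ^+ n * cos (n%:R * 0)) = (fun n => u n * x ^+ n).
  by apply/funext => n; rewrite mulr0 cos0 mulr1.
have sin0E (u : nat -> R) : sin_sum u x 0 = 0.
  by apply/cvg_lim => //; apply: series_zero => n; rewrite mulr0 sin0 mulr0.
have [c1 _ cE] := disk_polar 0 hc x01; have [a1 _ aE] := disk_polar 0 ha x01.
rewrite cE /= cos0E in c1; rewrite aE /= cos0E in a1; split=> //.
apply: (@complexI R); rewrite rmorphM rmorphN rmorph1.
rewrite !sin0E in cE aE; rewrite -[X in _ * X]cE -[X in X * _]aE mulNr mulVf//.
exact: szego_neq0.
Qed.

Lemma MA_AR_convolution (Delta : R -> R) (c a : nat -> R) :
  MA_coefficients Delta c -> AR_coefficients Delta a ->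
  forall n, \sum_(i < n.+1) a i * c (n - i)%N = - (n == 0%N)%:R.
Proof.
move=> hc ha n; rewrite -mulrN1.
apply: (power_series_convolution (F := cos_sum a ^~ 0) (G := cos_sum c ^~ 0)) => x x01;
  by have [] := szego_real_axis hc ha x01.
Qed.

(* [min (max x 0) 1], in a form whose continuity is immediate. *)
Definition clamp (x : R) : R := (1 + `|x| - `|x - 1|) / 2.

Lemma clamp_bound (x : R) : 0 <= clamp x <= 1.
Proof.
by rewrite /clamp; case: (ger0P x) => ?; case: (ger0P (x - 1)) => ?; apply/andP; split; lra.
Qed.

Lemma clamp_id (x : R) : 0 <= x <= 1 -> clamp x = x.
Proof.
move=> /andP[x0 x1]; rewrite /clamp (ger0_norm x0) ler0_norm ?subr_le0//; lra.
Qed.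

Lemma clamp_continuous : continuous clamp.
Proof.
move=> x; apply: cvgMr_tmp; apply: cvgB.
  by apply: cvgD; [exact: cvg_cst|exact: norm_continuous].
by apply: cvg_norm; apply: cvgB; [exact: cvg_id|exact: cvg_cst].
Qed.

(** At the origin the kernel (e^(it) + z) / (e^(it) - z) is identically 1, so the exponent is
    real. *)
Lemma Re_szego0 (Delta : R -> R) : 0 < complex.Re (szego Delta (polar 0 0)).
Proof.
rewrite Re_realMl mulr_gt0//; first by rewrite sqrtr_gt0 mulr_gt0// pi_gt0.
rewrite /cexp Re_realMl mulr_gt0 ?expR_gt0// Im_realMl.
rewrite [X in _ * X](_ : _ = 0) ?mulr0 ?cos0//.
have -> : polar 0 0 = 0 :> R[i] by rewrite /polar !mul0r.
transitivity (\int[@lebesgue_measure R]_(t in circle R)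
  complex.Im ((expi t + 0) / (expi t - 0) * (ln (Delta t))%:C)) => //.
rewrite -[RHS](mul0r (fine (@lebesgue_measure R (circle R)))) -Rintegral_cst//.
apply: eq_Rintegral => t _; rewrite addr0 subr0 divff ?mul1r//.
  by rewrite -normr_eq0 norm_cexp gt_eqF// ltcR expR_gt0.
exact: measurable_itv.
Qed.

(** -1/h has no zero on [0, 1) and is negative at 0, so a positive value would contradict the
    intermediate value theorem. Composition with [clamp] makes the function continuous on the whole
    line. *)
Lemma cos_sum_axis_neg (Delta : R -> R) (c a : nat -> R) (x : R) :
  MA_coefficients Delta c -> AR_coefficients Delta a -> 0 <= x < 1 ->
  cos_sum a x 0 < 0.
Proof.
move=> hc ha x01; have /andP[x0 x1] := x01.
have z01 : 0 <= (0 : R) < 1 by rewrite lexx ltr01.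
have Fneq y : 0 <= y < 1 -> cos_sum a y 0 != 0.
  move=> y01; have [_ _ FG] := szego_real_axis hc ha y01.
  by apply/eqP => F0; move: FG; rewrite F0 mul0r => /eqP; rewrite eq_sym oppr_eq0 oner_eq0.
have c0 : 0 < cos_sum c 0 0.
  have [_ _ h] := disk_polar 0 hc z01.
  have <- : complex.Re (szego Delta (polar 0 0)) = cos_sum c 0 0 by rewrite h.
  exact: Re_szego0.
rewrite ltNge; apply/negP => F0.
have Fx : 0 < cos_sum a x 0 by rewrite lt_def Fneq.
have F00 : cos_sum a 0 0 < 0.
  have [_ _ FG] := szego_real_axis hc ha z01.
  by rewrite -(pmulr_llt0 _ c0) FG ltrN10.
pose G y := limn (series (fun n => a n * (clamp y * x) ^+ n)).
have Gc : continuous G.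
  apply: (@mtest_continuous _ _ (fun n y => a n * (clamp y * x) ^+ n) (fun n => `|a n| * x ^+ n)).
  - move=> n y; apply: cvgMl_tmp.
    have h : clamp z * x @[z --> y] --> clamp y * x.
      by apply: cvgMr_tmp; exact: clamp_continuous.
    exact: cvg_comp h (@exprn_continuous R n (clamp y * x)).
  - move=> n y; have /andP[y0 y1] := clamp_bound y.
    rewrite normrM (ger0_norm (exprn_ge0 _ (mulr_ge0 y0 x0))) ler_wpM2l//.
    have yx : clamp y * x <= x by rewrite -[leRHS]mul1r ler_wpM2r.
    by rewrite lerXn2r// nnegrE// mulr_ge0.
  - exact: disk_abs_cvg ha x01.
have GF y : 0 <= y <= 1 -> G y = cos_sum a (y * x) 0.
  move=> y01; rewrite /G clamp_id//; congr (limn (series _)); apply/funext => n.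
  by rewrite mulr0 cos0 mulr1.
have [||y] := @IVT R G 0 1 0 ler01.
- exact: continuous_subspaceT.
- by rewrite !GF ?lexx ?ler01// mul0r mul1r ge_min le_max (ltW F00) (ltW Fx) orbT.
rewrite in_itv/= => y01; rewrite GF// => /eqP; apply/negP/Fneq.
have /andP[y0 y1] := y01.
by rewrite mulr_ge0//= (le_lt_trans _ x1)// ler_piMl.
Qed.

(** For n >= N and x < 1 the remaining terms are nonnegative, so the sum of a_i x^i over i < n is at
    most the full sum, which is negative. Letting x tend to 1 bounds the partial sums of [a] by
    0. *)
Lemma AR_abs_summable (Delta : R -> R) (c a : nat -> R) :
  MA_coefficients Delta c -> AR_coefficients Delta a ->
  (\forall n \near \oo, 0 <= a n) -> cvgn (series (fun n => `|a n|)).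
Proof.
move=> hc ha [N _ a0].
have suma n : (N <= n)%N -> series a n <= 0.
  move=> Nn.
  have h : (fun m => series (fun i => a i * (1 - m.+2%:R^-1) ^+ i) n) @ \oo --> series a n.
    have x1 : (fun m => 1 - m.+2%:R^-1) @ \oo --> (1 : R).
      rewrite -[X in _ --> X]subr0; apply: cvgB; first exact: cvg_cst.
      by apply: (cvg_comp _ _ _ (@cvg_harmonic R)) => A [M _ hM]; exists M => // k /= Mk;
        apply: (hM k.+1) => /=; rewrite ltnW.
    apply: cvg_big => [|i _]; first exact: add_continuous.
    rewrite -[X in _ --> X]mulr1 -[X in _ * X](expr1n _ i).
    by apply: cvgMl_tmp; exact: cvg_comp x1 (@exprn_continuous R i 1).
  rewrite -(cvg_lim _ h)//; apply: limr_le; first by apply/cvg_ex; eexists; exact: h.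
  near=> m.
  have x01 : 0 <= (1 - m.+2%:R^-1 : R) < 1.
    by rewrite subr_ge0 invf_le1// ler1n/= gtrBl invr_gt0.
  have [_ cF _] := szego_real_axis hc ha x01.
  have := cos_sum_axis_neg hc ha x01; rewrite -(cvg_lim _ cF)// => /ltW; apply: le_trans.
  apply: limr_ge; first exact: cvgP cF.
  near=> k; rewrite -subr_ge0 sub_series_geq; last by near: k; exists n.
  rewrite big_nat_cond sumr_ge0// => i; rewrite andbT => /andP[ni _].
  by rewrite mulr_ge0 ?exprn_ge0//; [apply: a0 => /=; exact: leq_trans ni|case/andP: x01].
apply: nondecreasing_is_cvgn; first by apply: nondecreasing_series.
(* From N on absolute values change nothing, so the two partial sums differ by what they have
   accumulated before N. *)
exists (series (fun n => `|a n|) N - series a N) => _ [n _ <-].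
have [nN|Nn] := leqP n N.
  rewrite (@le_trans _ _ (series (fun n => `|a n|) N))//; first exact: nondecreasing_series.
  by rewrite lerBrDr -lerBrDl subrr suma.
rewrite -lerBlDl sub_series_geq 1?ltnW// big_nat_cond.
under eq_bigr => i /andP[/andP[Ni _] _] do rewrite (ger0_norm (a0 _ Ni)).
by rewrite -big_nat_cond -(sub_series_geq a (ltnW Nn)) lerBlDr addrC subrr suma// ltnW.
Unshelve. all: by end_near. Qed.

End szego_modulus.

(** * Poisson integrals *)

Section lebesgue_circle.
Context {R : realType}.
Local Notation mu := (@lebesgue_measure R).

Lemma measurable_circle : measurable (circle R : set (measurableTypeR R)).
Proof. exact: measurable_itv. Qed.

Lemma Npi_lt_pi : - pi < pi :> R.
Proof. by rewrite gtrN// pi_gt0. Qed.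

Lemma circle_measure : mu (circle R) = (2 * pi)%:E.
Proof.
rewrite /circle lebesgue_measure_itv/= lte_fin Npi_lt_pi -EFinD; congr EFin; ring.
Qed.

Lemma continuous_circle_integrable (f : R -> R) (D : set R) : continuous f ->
  measurable (D : set (measurableTypeR R)) -> D `<=` circle R ->
  mu.-integrable D (EFin \o f).
Proof.
move=> cf mD Dc.
apply: (@integrableS _ _ _ mu `[- pi, pi]%classic) => //.
- move=> t /Dc; rewrite /circle /= !in_itv/= => /andP[/ltW -> ->] //.
- apply: continuous_compact_integrable; first exact: segment_compact.
  exact: continuous_subspaceT.
Qed.

Lemma sin_intpi (k : int) : sin (k%:~R * pi) = 0 :> R.
Proof.
have nat_case (n : nat) : sin (n%:R * pi) = 0 :> R.
  elim: n => [|n IH]; first by rewrite mul0r sin0.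
  by rewrite -addn1 natrD mulrDl mul1r sinDpi IH oppr0.
case: k => n; first exact: nat_case.
by rewrite NegzE mulrNz mulNr sinN nat_case oppr0.
Qed.

Lemma continuous_cos_affine (k p : R) : continuous (fun t => cos (k * t + p)).
Proof.
move=> t.
have h : k * x + p @[x --> t] --> k * t + p.
  by apply: cvgD; [apply: cvgMl_tmp; exact: cvg_id|exact: cvg_cst].
exact: cvg_comp h (@continuous_cos R (k * t + p)).
Qed.

Lemma integral_cos (k : int) (p : R) :
  \int[mu]_(t in circle R) cos (k%:~R * t + p) = 2 * pi * cos p * (k == 0)%:R.
Proof.
have [->|k0] := eqVneq k 0.
  under eq_Rintegral do rewrite mul0r add0r.
  rewrite Rintegral_cst//; last exact: measurable_circle.
  by rewrite [X in fine X]circle_measure /= mulr1 mulrC.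
have kR : k%:~R != 0 :> R by rewrite intr_eq0.
rewrite mulr0 /circle Rintegral_itv_obnd_cbnd; last first.
  apply: continuous_circle_integrable => //; exact: continuous_cos_affine.
pose F t := (k%:~R)^-1 * sin (k%:~R * t + p) : R.
have dF (t : R) : is_derive t 1 F (cos (k%:~R * t + p)).
  have h : is_derive t 1 (fun t => k%:~R * t + p) (k%:~R : R).
    have := @is_deriveD _ _ _ (fun t : R => k%:~R * t) (fun=> p) t 1 _ _
      (is_deriveZ k%:~R (@is_derive_id _ _ t 1)) (is_derive_cst p t 1).
    by rewrite addr0 /GRing.scale/= mulr1.
  have h2 := @is_derive1_comp R (@sin R) (fun t => k%:~R * t + p) t _ _ (is_derive_sin _) h.
  have := is_deriveZ (k%:~R)^-1 h2.
  by rewrite /GRing.scale/= mulrCA mulVf// mulr1.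
have cF : continuous F.
  by move=> t; apply: differentiable_continuous; apply/derivable1_diffP; have [] := dF t.
rewrite /Rintegral (@continuous_FTC2 _ _ F)//=.
- rewrite /F mulrN !sinD sinN cosN sin_intpi oppr0; ring.
- exact: Npi_lt_pi.
- by apply: continuous_subspaceT; exact: continuous_cos_affine.
- split=> [t _||].
  + by have [] := dF t.
  + exact/cvg_at_right_filter/cF.
  + exact/cvg_at_left_filter/cF.
- by move=> t _; rewrite derive1E; have [_ ->] := dF t.
Qed.

Lemma continuous_le_cvg_integral (f : nat -> R -> R) (g : R -> R) (D : set R) (e : nat -> R) :
  (forall n, continuous (f n)) -> continuous g ->
  measurable (D : set (measurableTypeR R)) -> D `<=` circle R ->
  (forall n t, `|f n t - g t| <= e n) -> e @ \oo --> (0 : R) ->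
  (fun n => \int[mu]_(t in D) f n t) @ \oo --> \int[mu]_(t in D) g t.
Proof.
move=> cf cg mD Dc fg e0.
have cfg n : continuous (fun t => f n t - g t) by move=> t; apply: cvgB; [exact: cf|exact: cg].
have ig := continuous_circle_integrable cg mD Dc.
have Dfin : (mu D < +oo)%E.
  rewrite (@le_lt_trans _ _ (mu (circle R)))//; last by rewrite circle_measure ltry.
  by apply: le_measure; rewrite ?inE//; exact: measurable_circle.
apply/subr_cvg0; apply/norm_cvg0P.
have : (fun n => e n * fine (mu D)) @ \oo --> (0 : R).
  by rewrite -(mul0r (fine (mu D))); apply: cvgMr_tmp.
apply: (@squeeze_cvgr _ _ _ _ (fun=> 0)); last exact: cvg_cst.
near=> n; rewrite normr_ge0 /= -RintegralB//; last exact: continuous_circle_integrable.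
rewrite (le_trans (le_normr_Rintegral _ _))//; first exact: continuous_circle_integrable.
rewrite -Rintegral_cst//; apply: le_Rintegral => //.
- apply: (continuous_circle_integrable (f := fun t => `|f n t - g t|)) => // t.
  by apply: cvg_norm; exact: cfg.
- by apply: continuous_circle_integrable => //; exact: cst_continuous.
Unshelve. all: by end_near. Qed.

End lebesgue_circle.

(** * Fubini's theorem for convolution kernels *)

Section convolution_swap.
Context {R : realType}.
Local Notation mu := (@lebesgue_measure R).
Variables (k w v : R -> R) (K W : R) (D1 D2 : set R).
Hypothesis ck : continuous k.
Hypothesis cw : continuous w.
Hypothesis kK : forall x, `|k x| <= K.
Hypothesis wW : forall x, `|w x| <= W.
Hypothesis mD1 : measurable (D1 : set (measurableTypeR R)).
Hypothesis mD2 : measurable (D2 : set (measurableTypeR R)).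
Hypothesis fD2 : (mu D2 < +oo)%E.
Hypothesis iv : mu.-integrable D1 (EFin \o v).

(** Extension by zero moves both domains into the integrand, so that Fubini's theorem applies on the
    whole plane; the first coordinate is t, the second theta. *)
Let f (p : measurableTypeR R * measurableTypeR R) : \bar R :=
  (k (p.2 - p.1) * (w \_ D2) p.1 * (v \_ D1) p.2)%:E.

Let mvD : measurable_fun [set: measurableTypeR R] (v \_ D1).
Proof.
apply/(measurable_restrictT _ mD1).
by apply/measurable_EFinP; apply: measurable_int iv.
Qed.

Let mwD : measurable_fun [set: measurableTypeR R] (w \_ D2).
Proof.
apply/(measurable_restrictT _ mD2).
by apply: measurable_funTS; exact: continuous_measurable_fun.
Qed.

Let mf : measurable_fun [set: measurableTypeR R * measurableTypeR R] f.
Proof.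
apply/measurable_EFinP; apply: measurable_funM.
  apply: measurable_funM.
    apply: (@measurableT_comp _ _ _ _ _ _ k); first exact: continuous_measurable_fun.
    by apply: measurable_funB; [exact: measurable_snd|exact: measurable_fst].
  exact: (measurableT_comp mwD measurable_fst).
exact: (measurableT_comp mvD measurable_snd).
Qed.

Let mf1 t : measurable_fun [set: measurableTypeR R] (fun th => f (t, th)).
Proof. exact: (measurableT_comp mf (measurable_pair1 t)). Qed.

Let mf2 th : measurable_fun [set: measurableTypeR R] (fun t => f (t, th)).
Proof. exact: (measurableT_comp mf (measurable_pair2 th)). Qed.

Let K0 : 0 <= K. Proof. exact: le_trans (kK 0). Qed.
Let W0 : 0 <= W. Proof. exact: le_trans (wW 0). Qed.
Let D20 : 0 <= fine (mu D2). Proof. exact: fine_ge0. Qed.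

Let ivD : mu.-integrable setT (EFin \o (v \_ D1)).
Proof. by rewrite -restrict_EFin; apply/(integrable_mkcond _ _).1. Qed.

Let inner_le th :
  (\int[mu]_t `|f (t, th)| <= (K * W * fine (mu D2))%:E * `|(EFin \o (v \_ D1)) th|)%E.
Proof.
have -> : ((K * W * fine (mu D2))%:E * `|(EFin \o (v \_ D1)) th| =
    \int[mu]_(y in D2) (K * W * `|(v \_ D1) th|)%:E)%E.
  rewrite integral_cst// -EFinM mulrAC EFinM fineK//.
  by rewrite ge0_fin_numE// measure_ge0.
rewrite [leRHS]integral_mkcond; apply: ge0_le_integral => //.
- by apply: measurableT_comp => //; exact: mf2.
- by apply/(measurable_restrictT _ mD2); exact: measurable_cst.
- move=> y _; rewrite patchE /f /= !normrM.
  case: ifPn => [yD2|yD2].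
    by rewrite lee_fin ler_wpM2r// ler_pM// patchE yD2.
  by rewrite patchE (negbTE yD2) normr0 mulr0 mul0r.
Qed.

Let if_ : (mu \x mu)%E.-integrable setT f.
Proof.
apply/integrable21ltyP => //.
apply: (@le_lt_trans _ _
  (\int[mu]_th ((K * W * fine (mu D2))%:E * `|(EFin \o (v \_ D1)) th|))%E).
  apply: ge0_le_integral => //.
  - by move=> x _; exact: integral_ge0.
  - apply: (measurable_fun_fubini_tonelli_G (abse \o f)) => //.
      exact: measurableT_comp.
    by move=> x; exact: abse_ge0.
  - apply: measurable_funeM; apply: measurableT_comp => //.
    exact: measurable_int ivD.
rewrite ge0_integralZl//; last 2 first.
- by apply: measurableT_comp => //; exact: measurable_int ivD.
- by rewrite lee_fin !mulr_ge0.
rewrite lte_mul_pinfty//; first by rewrite lee_fin !mulr_ge0.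
by have /integrableP[_] := ivD.
Qed.

Let k_int t : mu.-integrable D1 (EFin \o (fun th => k (th - t) * v th)).
Proof.
apply: (@le_integrable _ _ _ mu D1 _ _ (EFin \o (fun th => K * v th))) => //.
- apply/measurable_EFinP; apply: measurable_funM; last first.
    by apply/measurable_EFinP; apply: measurable_int iv.
  apply: measurable_funTS; apply: (@measurableT_comp _ _ _ _ _ _ k).
    exact: continuous_measurable_fun.
  exact: measurable_funB.
- move=> x _; rewrite /= lee_fin !normrM ler_wpM2r//.
  by rewrite (le_trans (kK _))// ler_norm.
- rewrite (_ : EFin \o _ = (fun x => K%:E * (EFin \o v) x)%E)//.
  exact: integrableZl.
Qed.

Let FE (t : R) : (\int[mu]_th f (t, th) =
  ((w \_ D2) t * \int[mu]_(th in D1) (k (th - t) * v th))%:E)%E.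
Proof.
rewrite EFinM fineK; last by apply: integrable_fin_num => //; exact: k_int.
rewrite -integralZl//; last exact: k_int.
rewrite [RHS]integral_mkcond; apply: eq_integral => th _.
rewrite /f /=; move: ((w \_ D2) t) => wt; rewrite !patchE -?EFinM.
by case: ifP => _; rewrite ?mulr0// mulrCA mulrA.
Qed.

Let GE (th : R) : (\int[mu]_t f (t, th) =
  ((v \_ D1) th * \int[mu]_(t in D2) (k (th - t) * w t))%:E)%E.
Proof.
have i2 : mu.-integrable D2 (EFin \o (fun t => k (th - t) * w t)).
  apply: (@le_integrable _ _ _ mu D2 _ _ (EFin \o (fun=> K * W))) => //.
  - apply/measurable_EFinP; apply: measurable_funM; apply: measurable_funTS; last first.
      exact: continuous_measurable_fun.
    apply: (@measurableT_comp _ _ _ _ _ _ k); first exact: continuous_measurable_fun.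
    exact: measurable_funB.
  - move=> x _; rewrite /= lee_fin normrM [leRHS]ger0_norm ?mulr_ge0//.
    exact: ler_pM.
  - apply/integrableP; split; first exact: measurable_cst.
    by rewrite integral_cst// lte_mul_pinfty.
rewrite EFinM fineK; last by apply: integrable_fin_num.
rewrite -integralZl//.
rewrite [RHS]integral_mkcond; apply: eq_integral => t _.
rewrite /f /=; move: ((v \_ D1) th) => vth; rewrite !patchE -?EFinM.
by case: ifP => _; rewrite ?mulr0 ?mul0r// mulrC.
Qed.

Lemma convolution_integrable :
  mu.-integrable D2 (EFin \o (fun t => w t * \int[mu]_(th in D1) (k (th - t) * v th))).
Proof.
apply/(integrable_mkcond _ mD2); rewrite restrict_EFin.
apply: eq_integrable (integrable_fubini_F if_) => // t _.
rewrite /fubini_F FE /=; congr EFin; rewrite !patchE.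
by case: ifP => // _; rewrite mul0r.
Qed.

Lemma convolution_swap :
  \int[mu]_(t in D2) (w t * \int[mu]_(th in D1) (k (th - t) * v th)) =
  \int[mu]_(th in D1) (v th * \int[mu]_(t in D2) (k (th - t) * w t)).
Proof.
have := Fubini if_.
under eq_integral do rewrite FE.
under [in X in _ = X -> _]eq_integral do rewrite GE.
move=> h; rewrite Rintegral_mkcond [RHS]Rintegral_mkcond /Rintegral.
have -> : ((fun t => w t * \int[mu]_(th in D1) (k (th - t) * v th)) \_ D2) =
    (fun t => (w \_ D2) t * \int[mu]_(th in D1) (k (th - t) * v th)).
  by apply/funext => t; rewrite !patchE; case: ifP => // _; rewrite mul0r.
have -> : ((fun th => v th * \int[mu]_(t in D2) (k (th - t) * w t)) \_ D1) =
    (fun th => (v \_ D1) th * \int[mu]_(t in D2) (k (th - t) * w t)).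
  by apply/funext => th; rewrite !patchE; case: ifP => // _; rewrite mul0r.
by rewrite h.
Qed.

End convolution_swap.

Section poisson_kernel.
Context {R : realType}.
Local Notation mu := (@lebesgue_measure R).
Variable r : R.
Hypothesis r01 : 0 <= r < 1.

Let r0 : 0 <= r. Proof. by case/andP: r01. Qed.
Let r1 : r < 1. Proof. by case/andP: r01. Qed.

Lemma poisson_continuous : continuous (poisson r).
Proof.
move=> s; apply: cvgM; first exact: cvg_cst.
apply: cvgV; first by rewrite gt_eqF// poisson_den_gt0.
apply: cvgD; last exact: cvg_cst.
apply: cvgB; first exact: cvg_cst.
by apply: cvgMl_tmp; exact: continuous_cos.
Qed.

Lemma poisson_le s (d : R) : 0 < d -> d <= 1 - 2 * r * cos s + r ^+ 2 ->
  `|poisson r s| <= (1 - r ^+ 2) / d.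
Proof.
move=> d0 ds; rewrite (ger0_norm (ltW (poisson_gt0 s r01))) /poisson.
apply: ler_wpM2l; first by rewrite subr_ge0 exprn_ile1// ltW.
by rewrite lef_pV2// posrE poisson_den_gt0.
Qed.

Lemma poisson_bound s : `|poisson r s| <= (1 - r ^+ 2) / (1 - r) ^+ 2.
Proof. by apply: poisson_le; [rewrite exprn_gt0// subr_gt0|exact: poisson_den_ge]. Qed.

Lemma poissonN s : poisson r (- s) = poisson r s.
Proof. by rewrite /poisson cosN. Qed.

(** Partial sums of the Fourier series of the Poisson kernel. *)
Definition poisson_sum (N : nat) (s : R) : R :=
  \sum_(n < N) (if n == 0%N :> nat then 1 else 2) * r ^+ n * cos (n%:R * s).

(** Multiplication by the denominator telescopes because 2 cos s cos (k s) = cos ((k+1) s) + cos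
    ((k-1) s). *)
Lemma poisson_sumE N s : (1 - 2 * r * cos s + r ^+ 2) * poisson_sum N.+1 s =
  1 - r ^+ 2 - 2 * r ^+ N.+1 * cos (N.+1%:R * s) + 2 * r ^+ N.+2 * cos (N%:R * s).
Proof.
elim: N => [|N IH].
  by rewrite /poisson_sum big_ord1 /= expr0 !mul0r cos0 (mul1r s); ring.
rewrite /poisson_sum big_ord_recr/= -/(poisson_sum _ _) mulrDr IH.
have h : 2 * cos s * cos (N.+1%:R * s) = cos (N.+2%:R * s) + cos (N%:R * s).
  rewrite (_ : N.+2%:R * s = N.+1%:R * s + s); last first.
    by rewrite -[N.+2]addn1 natrD mulrDl mul1r.
  rewrite cosD.
  rewrite (_ : N%:R * s = N.+1%:R * s - s); last by rewrite -addn1 natrD mulrDl mul1r addrK.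
  rewrite cosB; ring.
have -> : cos (N.+2%:R * s) = 2 * cos s * cos (N.+1%:R * s) - cos (N%:R * s) by rewrite h addrK.
rewrite !exprS; ring.
Qed.

Lemma poisson_sum_dist N s : `|poisson_sum N.+1 s - poisson r s| <= 4 / (1 - r) ^+ 2 * r ^+ N.+1.
Proof.
have d0 := poisson_den_gt0 s r01.
have -> : poisson_sum N.+1 s - poisson r s =
   (2 * r ^+ N.+2 * cos (N%:R * s) - 2 * r ^+ N.+1 * cos (N.+1%:R * s)) /
   (1 - 2 * r * cos s + r ^+ 2).
  apply: (mulIf (lt0r_neq0 d0)); rewrite mulrBl /poisson !mulfVK ?lt0r_neq0//.
  by rewrite mulrC poisson_sumE; ring.
rewrite normrM normfV (gtr0_norm d0) ler_pdivrMr//.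
have rN : 0 <= r ^+ N.+1 by exact: exprn_ge0.
apply: (@le_trans _ _ (4 * r ^+ N.+1)).
  have rN2 : 0 <= r ^+ N.+2 by exact: exprn_ge0.
  have h1 : `|cos (N%:R * s)| <= 1 by rewrite ler_norml cos_geN1 cos_le1.
  have h2 : `|cos (N.+1%:R * s)| <= 1 by rewrite ler_norml cos_geN1 cos_le1.
  have h3 : r ^+ N.+2 <= r ^+ N.+1 by rewrite [leLHS]exprS ler_piMl// ltW.
  move: rN rN2 h1 h2 h3; move: (r ^+ N.+1) (r ^+ N.+2) (cos _) (cos _) => p q y x.
  move=> p0 q0 x1 y1 qp; rewrite (le_trans (ler_normB _ _))// !normrM !normr_nat.
  rewrite (ger0_norm p0) (ger0_norm q0).
  have h4 : 2 * q * `|x| <= 2 * q by rewrite ler_piMr// mulr_ge0.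
  have h5 : 2 * p * `|y| <= 2 * p by rewrite ler_piMr// mulr_ge0.
  by lra.
have q0 : 0 < (1 - r) ^+ 2 by rewrite exprn_gt0// subr_gt0.
rewrite [leRHS](_ : _ = 4 * r ^+ N.+1 * ((1 - 2 * r * cos s + r ^+ 2) / (1 - r) ^+ 2)).
  by rewrite ler_peMr ?mulr_ge0// ler_pdivlMr// mul1r poisson_den_ge.
by move: ((1 - r) ^+ 2)^-1 (1 - 2 * r * cos s + r ^+ 2) (r ^+ N.+1) => x y z; ring.
Qed.

Lemma cos_cosM (n m : nat) (th t : R) :
  cos (n%:R * (th - t)) * cos (m%:R * t) =
  2^-1 * (cos ((m%:Z - n%:Z)%:~R * t + n%:R * th) + cos ((- (m%:Z + n%:Z))%:~R * t + n%:R * th)).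
Proof.
rewrite (_ : (m%:Z - n%:Z)%:~R * t + n%:R * th = n%:R * (th - t) + m%:R * t); last first.
  by rewrite rmorphB/=; ring.
rewrite (_ : (- (m%:Z + n%:Z))%:~R * t + n%:R * th = n%:R * (th - t) - m%:R * t); last first.
  by rewrite rmorphN rmorphD/=; ring.
by rewrite cosD cosB; field.
Qed.

Lemma continuous_poisson_sum_cos N (m : nat) th :
  continuous (fun t => poisson_sum N (th - t) * cos (m%:R * t)).
Proof.
move=> t; apply: cvgM; last first.
  have h : m%:R * x @[x --> t] --> m%:R * t by apply: cvgMl_tmp; exact: cvg_id.
  exact: cvg_comp h (@continuous_cos R _).
apply: cvg_big => [|i _]; first exact: add_continuous.
apply: cvgMl_tmp.
have h : i%:R * (th - x) @[x --> t] --> i%:R * (th - t).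
  by apply: cvgMl_tmp; apply: cvgB; [exact: cvg_cst|exact: cvg_id].
exact: cvg_comp h (@continuous_cos R _).
Qed.

Lemma integral_poisson_sum_cos N (m : nat) th :
  \int[mu]_(t in circle R) (poisson_sum N (th - t) * cos (m%:R * t)) =
  if (m < N)%N then 2 * pi * r ^+ m * cos (m%:R * th) else 0.
Proof.
have mc := @measurable_circle R.
elim: N => [|N IH].
  rewrite ltn0 (_ : (fun t => _) = (fun=> 0)); first by rewrite Rintegral_cst// mul0r.
  by apply/funext => t; rewrite /poisson_sum big_ord0 mul0r.
pose k : R := if N == 0%N then 1 else 2.
pose g1 t : R := cos ((m%:Z - N%:Z)%:~R * t + N%:R * th).
pose g2 t : R := cos ((- (m%:Z + N%:Z))%:~R * t + N%:R * th).
have i1 : mu.-integrable (circle R) (EFin \o g1).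
  by apply: continuous_circle_integrable => //; exact: continuous_cos_affine.
have i2 : mu.-integrable (circle R) (EFin \o g2).
  by apply: continuous_circle_integrable => //; exact: continuous_cos_affine.
have i12 : mu.-integrable (circle R) (EFin \o (fun t => g1 t + g2 t)).
  rewrite (_ : EFin \o _ = (EFin \o g1) \+ (EFin \o g2))%E//.
  exact: integrableD.
have E t : poisson_sum N.+1 (th - t) * cos (m%:R * t) =
    poisson_sum N (th - t) * cos (m%:R * t) + k * r ^+ N * 2^-1 * (g1 t + g2 t).
  rewrite /poisson_sum big_ord_recr/= mulrDl; congr (_ + _).
  by rewrite -[LHS]mulrA cos_cosM !mulrA.
under eq_Rintegral do rewrite E.
rewrite RintegralD//; last 2 first.
- apply: continuous_circle_integrable => //; exact: continuous_poisson_sum_cos.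
- rewrite (_ : EFin \o _ = (fun t => (k * r ^+ N * 2^-1)%:E * (g1 t + g2 t)%:E)%E)//.
  exact: integrableZl.
rewrite IH RintegralZl// RintegralD// !integral_cos.
rewrite subr_eq0 eqz_nat oppr_eq0 -PoszD eqz_nat addn_eq0.
have [mN|Nm|->] := ltngtP m N.
- rewrite ltnS (ltnW mN) (_ : (N == 0%N) = false) ?andbF; last by lia.
  by rewrite !mulr0 addr0 mulr0 addr0.
- rewrite ltnS leqNgt Nm/= (_ : (m == 0%N) = false)/=; last by lia.
  by rewrite !mulr0 addr0 mulr0 addr0.
- by rewrite ltnSn andbb add0r /k; case: (N == 0%N); rewrite /= ?mulr1 ?mulr0; field.
Qed.

Lemma integral_poisson_cos (m : nat) th :
  \int[mu]_(t in circle R) (poisson r (th - t) * cos (m%:R * t)) =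
  2 * pi * r ^+ m * cos (m%:R * th).
Proof.
have h : (fun N => \int[mu]_(t in circle R) (poisson_sum N.+1 (th - t) * cos (m%:R * t)))
   @ \oo --> \int[mu]_(t in circle R) (poisson r (th - t) * cos (m%:R * t)).
  apply: (@continuous_le_cvg_integral _ _ _ _ (fun N => 4 / (1 - r) ^+ 2 * r ^+ N.+1)).
  - by move=> N; exact: continuous_poisson_sum_cos.
  - move=> t; apply: cvgM.
      have h : th - x @[x --> t] --> th - t by apply: cvgB; [exact: cvg_cst|exact: cvg_id].
      exact: cvg_comp h (@poisson_continuous (th - t)).
    have h : m%:R * x @[x --> t] --> m%:R * t by apply: cvgMl_tmp; exact: cvg_id.
    exact: cvg_comp h (@continuous_cos R _).
  - exact: measurable_circle.
  - by [].
  - move=> N t; rewrite -mulrBl normrM -[leRHS]mulr1 ler_pM//; first exact: poisson_sum_dist.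
    by rewrite ler_norml cos_geN1 cos_le1.
  - rewrite -(mulr0 (4 / (1 - r) ^+ 2)); apply: cvgMl_tmp.
    have := @cvg_expr R r; rewrite ger0_norm// => /(_ r1) hr.
    by apply: (cvg_comp _ _ _ hr) => A [M _ hM]; exists M => // n /= Mn; apply: hM => /=;
      rewrite ltnW.
apply: (cvgn_inj h); apply: cvg_near_cst; near=> N.
rewrite integral_poisson_sum_cos ifT// ltnS; near: N; exact: nbhs_infty_ge.
Unshelve. all: by end_near. Qed.

Lemma integral_poisson th : \int[mu]_(t in circle R) poisson r (th - t) = 2 * pi.
Proof.
have := integral_poisson_cos 0 th; rewrite mul0r cos0 !mulr1 => <-.
by apply: eq_Rintegral => t _; rewrite mul0r cos0 mulr1.
Qed.

Lemma integral_poisson_swap t : \int[mu]_(th in circle R) poisson r (th - t) = 2 * pi.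
Proof.
by rewrite -(integral_poisson t); apply: eq_Rintegral => th _; rewrite -poissonN opprB.
Qed.

End poisson_kernel.

(** * Jensen's inequality for the Poisson kernel *)

Section jensen.
Context {R : realType}.
Local Notation mu := (@lebesgue_measure R).
Variable Delta : R -> R.
Hypothesis Delta_gt0 : forall t, circle R t -> 0 < Delta t.
Hypothesis iDelta : mu.-integrable (circle R) (EFin \o Delta).
Hypothesis ilog : mu.-integrable (circle R) (EFin \o (fun t => ln (Delta t))).
Variable r : R.
Hypothesis r01 : 0 <= r < 1.

Let mc := @measurable_circle R.

Let twopi_gt0 : 0 < 2 * pi :> R. Proof. by rewrite mulr_gt0// pi_gt0. Qed.

Lemma continuous_poisson_shift t : continuous (fun th => poisson r (th - t)).
Proof.
move=> th; have h : x - t @[x --> th] --> th - t by apply: cvgB; [exact: cvg_id|exact: cvg_cst].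
exact: cvg_comp h (@poisson_continuous _ _ r01 _).
Qed.

Lemma poisson_mul_integrable (v : R -> R) t : mu.-integrable (circle R) (EFin \o v) ->
  mu.-integrable (circle R) (EFin \o (fun th => poisson r (th - t) * v th)).
Proof.
move=> iv; pose K := (1 - r ^+ 2) / (1 - r) ^+ 2.
apply: (@le_integrable _ _ _ mu _ _ _ (EFin \o (fun th => K * v th))) => //.
- apply/measurable_EFinP; apply: measurable_funM; last first.
    by apply/measurable_EFinP; apply: measurable_int iv.
  apply: measurable_funTS; apply: continuous_measurable_fun.
  exact: continuous_poisson_shift.
- move=> x _; rewrite /= lee_fin (normrM (poisson _ _)) (normrM K) ler_wpM2r//.
  by rewrite (le_trans (poisson_bound r01 _))// ler_norm.
- rewrite (_ : EFin \o _ = (fun x => K%:E * (EFin \o v) x)%E)//.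
  exact: integrableZl.
Qed.

(** The tangent line of exp at E = [log_poisson Delta r t] gives Delta >= e^E (1 + ln Delta - E).
    Integrated against the Poisson kernel, which has mass 2 pi, the contribution of ln Delta - E
    vanishes. *)
Lemma exp_log_poisson_le t : expR (log_poisson Delta r t) <=
  (2 * pi)^-1 * \int[mu]_(th in circle R) (poisson r (th - t) * Delta th).
Proof.
set E := log_poisson Delta r t.
have iP : mu.-integrable (circle R) (EFin \o (fun th => poisson r (th - t))).
  by apply: continuous_circle_integrable => //; exact: continuous_poisson_shift.
have iPl := poisson_mul_integrable t ilog.
have iPD := poisson_mul_integrable t iDelta.
have iPE : mu.-integrable (circle R) (EFin \o (fun th => (1 - E) * poisson r (th - t))).
  rewrite (_ : EFin \o _ =
    (fun th => (1 - E)%:E * (EFin \o (fun th => poisson r (th - t))) th)%E)//.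
  exact: integrableZl.
have iS : mu.-integrable (circle R) (EFin \o (fun th =>
    (1 - E) * poisson r (th - t) + poisson r (th - t) * ln (Delta th))).
  rewrite (_ : EFin \o _ = (EFin \o (fun th => ((1 - E) * poisson r (th - t))%R)) \+
    (EFin \o (fun th => (poisson r (th - t) * ln (Delta th))%R)))%E//.
  exact: integrableD.
have lower : \int[mu]_(th in circle R) (expR E * ((1 - E) * poisson r (th - t) +
      poisson r (th - t) * ln (Delta th))) <=
    \int[mu]_(th in circle R) (poisson r (th - t) * Delta th).
  apply: le_Rintegral => //.
    rewrite (_ : EFin \o _ = (fun th => (expR E)%:E * (EFin \o (fun th =>
      ((1 - E) * poisson r (th - t) + poisson r (th - t) * ln (Delta th))%R)) th)%E)//.
    exact: integrableZl.
  move=> th cth.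
  have -> : (1 - E) * poisson r (th - t) + poisson r (th - t) * ln (Delta th) =
    poisson r (th - t) * (1 + (ln (Delta th) - E)) by ring.
  rewrite mulrCA ler_wpM2l//; first exact/ltW/poisson_gt0.
  rewrite -[leRHS](lnK (Delta_gt0 cth)) -[in leRHS](subrK E (ln (Delta th))) expRD mulrC.
  by rewrite ler_wpM2r ?expR_ge0// expR_ge1Dx.
rewrite -(ler_pM2l twopi_gt0) mulVKf ?gt_eqF//; apply: le_trans lower.
rewrite RintegralZl// RintegralD// RintegralZl// integral_poisson_swap//.
have -> : \int[mu]_(th in circle R) (poisson r (th - t) * ln (Delta th)) = 2 * pi * E.
  by rewrite /E /log_poisson mulVKf ?gt_eqF.
by rewrite le_eqVlt; apply/orP; left; apply/eqP; ring.
Qed.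

Lemma continuous_cos_scale (m : nat) : continuous (fun t : R => cos (m%:R * t)).
Proof.
move=> t; have h : m%:R * x @[x --> t] --> m%:R * t by apply: cvgMl_tmp; exact: cvg_id.
exact: cvg_comp h (@continuous_cos R _).
Qed.

Lemma continuous_cos_weight (m : nat) (e : R) : continuous (fun t : R => 1 + e * cos (m%:R * t)).
Proof.
move=> t; apply: cvgD; first exact: cvg_cst.
apply: cvgMl_tmp; exact: continuous_cos_scale.
Qed.

Lemma integral_poisson_weight (m : nat) (e th : R) :
  \int[mu]_(t in circle R) (poisson r (th - t) * (1 + e * cos (m%:R * t))) =
  2 * pi * (1 + e * r ^+ m * cos (m%:R * th)).
Proof.
have cP : continuous (fun t => poisson r (th - t)).
  move=> t; have h : th - x @[x --> t] --> th - t by apply: cvgB; [exact: cvg_cst|exact: cvg_id].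
  exact: cvg_comp h (@poisson_continuous _ _ r01 _).
have cPc : continuous (fun t => poisson r (th - t) * cos (m%:R * t)).
  move=> t; apply: cvgM; first exact: cP.
  have h : m%:R * x @[x --> t] --> m%:R * t by apply: cvgMl_tmp; exact: cvg_id.
  exact: cvg_comp h (@continuous_cos R _).
have -> : (fun t => poisson r (th - t) * (1 + e * cos (m%:R * t))) =
    (fun t => poisson r (th - t) + e * (poisson r (th - t) * cos (m%:R * t))).
  by apply/funext => t; ring.
rewrite RintegralD//; last 2 first.
- exact: continuous_circle_integrable.
- rewrite (_ : EFin \o _ = (fun t => e%:E *
      (EFin \o (fun t => (poisson r (th - t) * cos (m%:R * t))%R)) t)%E)//.
  by apply: integrableZl => //; exact: continuous_circle_integrable.
rewrite RintegralZl//; last exact: continuous_circle_integrable.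
by rewrite integral_poisson// integral_poisson_cos//; ring.
Qed.

Lemma weight_bound (m : nat) (e t : R) : `|e| <= 1 -> `|e * cos (m%:R * t)| <= 1.
Proof.
by move=> e1; rewrite normrM -[leRHS]mulr1 ler_pM// ler_norml cos_geN1 cos_le1.
Qed.

Lemma weighted_Delta_integrable (m : nat) (e : R) : `|e| <= 1 ->
  mu.-integrable (circle R) (EFin \o (fun t => Delta t * (1 + e * cos (m%:R * t)))).
Proof.
move=> e1.
apply: (@le_integrable _ _ _ mu _ _ _ (EFin \o (fun th => 2 * Delta th))).
- exact: mc.
- apply/measurable_EFinP; apply: measurable_funM.
    by apply/measurable_EFinP; apply: measurable_int iDelta.
  by apply: measurable_funTS; apply: continuous_measurable_fun; exact: continuous_cos_weight.
- move=> th _; rewrite /= lee_fin normrM (normrM 2) mulrC ler_wpM2r// normr_nat.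
  rewrite (le_trans (ler_normD _ _))// normr1.
  by have := weight_bound m th e1; lra.
- rewrite (_ : EFin \o _ = (fun x => 2%:E * (EFin \o Delta) x)%E)//.
  by apply: integrableZl => //; exact: mc.
Qed.

(** The bound on e keeps the weight nonnegative, so the pointwise inequality can be integrated
    against it. After the swap the kernel acts on the weight and merely damps its cosine by
    [r ^+ m]. *)
Lemma integral_exp_log_poisson_le (m : nat) (e : R) : `|e| <= 1 ->
  continuous (fun t => expR (log_poisson Delta r t)) ->
  \int[mu]_(t in circle R) ((1 + e * cos (m%:R * t)) * expR (log_poisson Delta r t)) <=
  \int[mu]_(t in circle R) (Delta t * (1 + e * r ^+ m * cos (m%:R * t))).
Proof.
move=> e1 cE.
pose w t : R := 1 + e * cos (m%:R * t).
have cw : continuous w by exact: continuous_cos_weight.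
have w0 t : 0 <= w t by have := weight_bound m t e1; rewrite ler_norml /w => /andP[]; lra.
have w2 t : `|w t| <= 2.
  by rewrite ger0_norm//; have := weight_bound m t e1; rewrite ler_norml /w => /andP[]; lra.
have fc : (mu (circle R) < +oo)%E by rewrite circle_measure ltry.
have erm : `|e * r ^+ m| <= 1.
  have /andP[r0 r1] := r01.
  by rewrite normrM -[leRHS]mulr1 ler_pM// ger0_norm ?exprn_ge0// exprn_ile1// ltW.
have -> : \int[mu]_(t in circle R) (Delta t * (1 + e * r ^+ m * cos (m%:R * t))) =
    (2 * pi)^-1 * \int[mu]_(t in circle R)
      (w t * \int[mu]_(th in circle R) (poisson r (th - t) * Delta th)).
  rewrite (convolution_swap (@poisson_continuous _ _ r01) cw (poisson_bound r01) w2 mc mc fc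
    iDelta).
  under [in RHS]eq_Rintegral do rewrite integral_poisson_weight mulrCA.
  rewrite RintegralZl; first by rewrite mulKf// gt_eqF.
  - exact: mc.
  - exact: weighted_Delta_integrable.
have isw := convolution_integrable (@poisson_continuous _ _ r01) cw (poisson_bound r01) w2
  mc mc fc iDelta.
rewrite -RintegralZl; [|exact: mc|exact: isw].
apply: le_Rintegral; first exact: mc.
- by apply: continuous_circle_integrable => [t||];
    [apply: cvgM; [exact: cw|exact: cE]|exact: mc|].
- rewrite (_ : EFin \o _ = (fun t => (2 * pi)^-1%:E * (EFin \o (fun t =>
    (w t * \int[mu]_(th in circle R) (poisson r (th - t) * Delta th))%R)) t)%E)//.
  by apply: integrableZl; [exact: mc|exact: isw].
- move=> t _; rewrite [leRHS]mulrCA; apply: ler_wpM2l; first exact: w0.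
  exact: exp_log_poisson_le.
Qed.

End jensen.

(** * Parseval's identity on a circle inside the disk *)

Section parseval.
Context {R : realType}.
Local Notation mu := (@lebesgue_measure R).

Lemma cos_sum_continuous (u : nat -> R) (r : R) : 0 <= r ->
  cvgn (series (fun n => `|u n| * r ^+ n)) -> continuous (cos_sum u r).
Proof.
move=> r0 cu; apply: (@mtest_continuous _ _ _ (fun n => `|u n| * r ^+ n)) => //.
- by move=> n t; apply: cvgMl_tmp; exact: continuous_cos_scale.
- move=> n t; rewrite !normrM (ger0_norm (exprn_ge0 _ r0)) ler_piMr//.
    by rewrite mulr_ge0// exprn_ge0.
  by rewrite ler_norml cos_geN1 cos_le1.
Qed.

Lemma sin_sum_continuous (u : nat -> R) (r : R) : 0 <= r ->
  cvgn (series (fun n => `|u n| * r ^+ n)) -> continuous (sin_sum u r).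
Proof.
move=> r0 cu; apply: (@mtest_continuous _ _ _ (fun n => `|u n| * r ^+ n)) => //.
- move=> n t; apply: cvgMl_tmp.
  have h : n%:R * x @[x --> t] --> n%:R * t by apply: cvgMl_tmp; exact: cvg_id.
  exact: cvg_comp h (@continuous_sin R _).
- move=> n t; rewrite !normrM (ger0_norm (exprn_ge0 _ r0)) ler_piMr//.
    by rewrite mulr_ge0// exprn_ge0.
  by rewrite ler_norml sin_geN1 sin_le1.
Qed.

Lemma Rintegral_circle_sum (n : nat) (F : 'I_n -> R -> R) : (forall i, continuous (F i)) ->
  \int[mu]_(t in circle R) (\sum_(i < n) F i t) = \sum_(i < n) \int[mu]_(t in circle R) F i t.
Proof.
have mc := @measurable_circle R.
elim: n F => [|n IH] F cF.
  rewrite big_ord0 (_ : (fun t => _) = (fun=> 0)); first by rewrite Rintegral_cst// mul0r.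
  by apply/funext => t; rewrite big_ord0.
under eq_Rintegral do rewrite big_ord_recr/=.
rewrite RintegralD//; last 2 first.
- apply: continuous_circle_integrable => // t.
  by apply: cvg_big => [|i _]; [exact: add_continuous|exact: cF].
- exact: continuous_circle_integrable.
by rewrite IH// big_ord_recr.
Qed.

Definition psum (f : R -> R) (d : nat -> R) (N : nat) (t : R) : R :=
  \sum_(k < N) d k * f (k%:R * t).

Lemma psum_sqr (d : nat -> R) (N : nat) (t : R) :
  psum cos d N t ^+ 2 + psum sin d N t ^+ 2 =
  \sum_(j < N) \sum_(k < N) d j * d k * cos ((j%:Z - k%:Z)%:~R * t + 0).
Proof.
rewrite /psum !expr2 !mulr_suml -big_split/=; apply: eq_bigr => j _.
rewrite !mulr_sumr -big_split/=; apply: eq_bigr => k _.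
rewrite addr0 rmorphB/= mulrBl cosB; ring.
Qed.

Lemma integral_cos_cos (j k m : nat) :
  \int[mu]_(t in circle R) (cos ((j%:Z - k%:Z)%:~R * t + 0) * cos (m%:R * t)) =
  pi * ((k == j + m)%N%:R + (j == k + m)%N%:R).
Proof.
have mc := @measurable_circle R.
have E t : cos ((j%:Z - k%:Z)%:~R * t + 0) * cos (m%:R * t) =
    2^-1 * (cos ((j%:Z - k%:Z + m%:Z)%:~R * t + 0) + cos ((j%:Z - k%:Z - m%:Z)%:~R * t + 0)) :> R.
  by rewrite !addr0 (rmorphD _ _ m%:Z) (rmorphB _ _ m%:Z) /= mulrDl mulrBl cosD cosB; field.
under eq_Rintegral do rewrite E.
have ic l : mu.-integrable (circle R) (EFin \o (fun t => cos (l * t + 0))).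
  by apply: continuous_circle_integrable => //; exact: continuous_cos_affine.
rewrite RintegralZl//; last first.
  by apply: continuous_circle_integrable => // t; apply: cvgD; exact: continuous_cos_affine.
rewrite RintegralD// !integral_cos cos0.
rewrite (_ : (j%:Z - k%:Z + m%:Z == 0) = (k == j + m)%N); last by lia.
rewrite (_ : (j%:Z - k%:Z - m%:Z == 0) = (j == k + m)%N); last by lia.
by field.
Qed.

Lemma sum_diagonal (d : nat -> R) (N m : nat) :
  \sum_(j < N) \sum_(k < N) d j * d k * (k == j + m :> nat)%N%:R =
  \sum_(0 <= j < N - m) d j * d (j + m)%N.
Proof.
have -> : \sum_(j < N) \sum_(k < N) d j * d k * (k == j + m :> nat)%N%:R =
    \sum_(j < N) (if (j < N - m)%N then d j * d (j + m)%N else 0).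
  apply: eq_bigr => j _; case: ifPn => jm.
    have jmN : (j + m < N)%N by lia.
    rewrite (bigD1 (Ordinal jmN))//= eqxx mulr1 big1 ?addr0// => k /eqP kj.
    rewrite (_ : _ == _ = false) ?mulr0//; apply/eqP => kj'; apply: kj; exact: val_inj.
  rewrite big1// => k _; rewrite (_ : _ == _ = false) ?mulr0//.
  by have kN := ltn_ord k; lia.
rewrite -big_mkcond/= -(big_ord_widen _ (fun j => d j * d (j + m)%N)) ?leq_subr//.
by rewrite big_mkord.
Qed.

Lemma integral_psum_sqr (d : nat -> R) (N m : nat) :
  \int[mu]_(t in circle R) ((psum cos d N t ^+ 2 + psum sin d N t ^+ 2) * cos (m%:R * t)) =
  2 * pi * \sum_(0 <= j < N - m) d j * d (j + m)%N.
Proof.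
have mc := @measurable_circle R.
have cjk (j k : nat) : continuous (fun t : R => d j * d k *
    (cos ((j%:Z - k%:Z)%:~R * t + 0) * cos (m%:R * t))).
  move=> t; apply: cvgMl_tmp; apply: cvgM; first exact: continuous_cos_affine.
  exact: continuous_cos_scale.
have -> : (fun t => (psum cos d N t ^+ 2 + psum sin d N t ^+ 2) * cos (m%:R * t)) =
    (fun t => \sum_(j < N) \sum_(k < N) d j * d k *
      (cos ((j%:Z - k%:Z)%:~R * t + 0) * cos (m%:R * t))).
  apply/funext => t; rewrite psum_sqr mulr_suml; apply: eq_bigr => j _.
  by rewrite mulr_suml; apply: eq_bigr => k _; rewrite mulrA.
rewrite Rintegral_circle_sum; last first.
  by move=> j t; apply: cvg_big => [|k _]; [exact: add_continuous|exact: cjk].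
transitivity (\sum_(j < N) \sum_(k < N) d j * d k *
    (pi * ((k == j + m :> nat)%N%:R + (j == k + m :> nat)%N%:R))).
  apply: eq_bigr => j _; rewrite Rintegral_circle_sum//; apply: eq_bigr => k _.
  rewrite RintegralZl//; first by rewrite integral_cos_cos.
  apply: continuous_circle_integrable => // t; apply: cvgM; first exact: continuous_cos_affine.
  exact: continuous_cos_scale.
transitivity (pi * (\sum_(j < N) \sum_(k < N) d j * d k * (k == j + m :> nat)%N%:R
   + \sum_(j < N) \sum_(k < N) d j * d k * (j == k + m :> nat)%N%:R)).
  rewrite mulrDr !mulr_sumr -big_split/=; apply: eq_bigr => j _.
  rewrite !mulr_sumr -big_split/=; apply: eq_bigr => k _; ring.
(* The two diagonals k = j + m and j = k + m contribute equally, which turns the factor pi into 2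
   pi. *)
rewrite [X in _ * (_ + X)]exchange_big/= sum_diagonal.
under [X in _ * (_ + X)]eq_bigr do under eq_bigr do rewrite [d _ * d _]mulrC.
by rewrite sum_diagonal; ring.
Qed.

Lemma parseval (u : nat -> R) (r : R) (m : nat) : 0 <= r ->
  cvgn (series (fun n => `|u n| * r ^+ n)) ->
  series (fun k => u k * u (k + m)%N * r ^+ (k.*2 + m)) @ \oo -->
  (2 * pi)^-1 *
    \int[mu]_(t in circle R) ((cos_sum u r t ^+ 2 + sin_sum u r t ^+ 2) * cos (m%:R * t)).
Proof.
move=> r0 cu; pose d k := u k * r ^+ k.
have dE k : `|d k| = `|u k| * r ^+ k by rewrite normrM (ger0_norm (exprn_ge0 _ r0)).
have cd : cvgn (series (fun k => `|d k|)) by under eq_fun do rewrite dE.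
pose L := limn (series (fun k => `|d k|)).
pose tail N := L - series (fun k => `|d k|) N.
have sumL N : \sum_(0 <= k < N) `|d k| <= L.
  by apply: (nondecreasing_cvgn_le (u_ := series (fun k => `|d k|))) => //;
    exact: nondecreasing_series.
have tail_ge0 N : 0 <= tail N by rewrite subr_ge0; exact: sumL.
have L0 : 0 <= L by apply: le_trans (sumL 0%N); rewrite big_nil.
have bound (f : R -> R) : (forall x, `|f x| <= 1) -> forall t N,
   [/\ `|psum f d N t| <= L, `|limn (series (fun k => d k * f (k%:R * t)))| <= L &
   `|psum f d N t - limn (series (fun k => d k * f (k%:R * t)))| <= tail N].
  move=> f1 t N.
  have fd k : `|d k * f (k%:R * t)| <= `|d k| by rewrite normrM ler_piMr.
  have e0 M : series (fun k => d k * f (k%:R * t)) M = psum f d M t.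
    by rewrite /series/= big_mkord.
  have h M : `|limn (series (fun k => d k * f (k%:R * t))) - psum f d M t| <= tail M.
    rewrite -e0; apply: (series_dist_tail fd cd) => n Mn.
    rewrite -(sub_series_geq (fun k => `|d k|) Mn) lerD2r; exact: sumL.
  split; last by rewrite distrC.
    rewrite /psum (le_trans (ler_norm_sum _ _ _))// (le_trans _ (sumL N))// big_mkord.
    by apply: ler_sum.
  have := h 0%N; rewrite /psum big_ord0 subr0 => /le_trans; apply.
  by rewrite /tail /series/= big_nil subr0.
have cosE t : cos_sum u r t = limn (series (fun k => d k * cos (k%:R * t))) by [].
have sinE t : sin_sum u r t = limn (series (fun k => d k * sin (k%:R * t))) by [].
have cos1 (x : R) : `|cos x| <= 1 by rewrite ler_norml cos_geN1 cos_le1.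
have sin1 (x : R) : `|sin x| <= 1 by rewrite ler_norml sin_geN1 sin_le1.
pose G N t : R := (psum cos d N t ^+ 2 + psum sin d N t ^+ 2) * cos (m%:R * t).
pose G' t : R := (cos_sum u r t ^+ 2 + sin_sum u r t ^+ 2) * cos (m%:R * t).
have lim : (fun N => \int[mu]_(t in circle R) G N t) @ \oo --> \int[mu]_(t in circle R) G' t.
  (* Each of the two differences of squares is at most [tail N] times 2 L. *)
  apply: (@continuous_le_cvg_integral _ _ _ _ (fun N => 4 * L * tail N)).
  - move=> N t; apply: cvgM; last exact: continuous_cos_scale.
    have cps (f : R -> R) : continuous f -> continuous (psum f d N).
      move=> cf x; apply: cvg_big => [|k _]; first exact: add_continuous.
      apply: cvgMl_tmp; have h : k%:R * y @[y --> x] --> k%:R * x by apply: cvgMl_tmp;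
        exact: cvg_id.
      exact: cvg_comp h (cf _).
    have cC := cps _ (@continuous_cos R); have cS := cps _ (@continuous_sin R).
    by apply: cvgD; rewrite expr2; apply: cvgM; [exact: cC..|exact: cS|exact: cS].
  - move=> t; apply: cvgM; last exact: continuous_cos_scale.
    have cC := cos_sum_continuous r0 cu; have cS := sin_sum_continuous r0 cu.
    by apply: cvgD; rewrite expr2; apply: cvgM; [exact: cC..|exact: cS|exact: cS].
  - exact: measurable_circle.
  - by [].
  - move=> N t; rewrite /G /G' -mulrBl normrM -[leRHS]mulr1 ler_pM//.
    have [c1 c2 c3] := bound _ cos1 t N; have [s1 s2 s3] := bound _ sin1 t N.
    rewrite -cosE in c2 c3; rewrite -sinE in s2 s3.
    move: c1 c2 c3 s1 s2 s3.
    move: (psum cos d N t) (psum sin d N t) (cos_sum u r t) (sin_sum u r t) =>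
      p q x y p1 x1 px q1 y1 qy.
    rewrite (_ : _ - _ = (p - x) * (p + x) + (q - y) * (q + y)); last by ring.
    rewrite (le_trans (ler_normD _ _))// !normrM.
    have h1 : `|p + x| <= 2 * L by rewrite (le_trans (ler_normD _ _))//; lra.
    have h2 : `|q + y| <= 2 * L by rewrite (le_trans (ler_normD _ _))//; lra.
    have h3 : `|p - x| * `|p + x| <= tail N * (2 * L) by rewrite ler_pM.
    have h4 : `|q - y| * `|q + y| <= tail N * (2 * L) by rewrite ler_pM.
    by lra.
  - rewrite -(mulr0 (4 * L)); apply: cvgMl_tmp; rewrite -(subrr L).
    by apply: cvgB; [exact: cvg_cst|exact: cd].
have p0 : 2 * pi != 0 :> R by rewrite mulf_neq0// gt_eqF// pi_gt0.
have lim2 : (fun N => series (fun k => d k * d (k + m)%N) N) @ \oo -->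
    (2 * pi)^-1 * \int[mu]_(t in circle R) G' t.
  have {}lim : (fun N => (2 * pi)^-1 * \int[mu]_(t in circle R) G (N + m)%N t) @ \oo -->
      (2 * pi)^-1 * \int[mu]_(t in circle R) G' t.
    apply: cvgMl_tmp; apply: (cvg_comp _ _ _ lim) => A [M _ hM]; exists M => // n /= Mn.
    by apply: hM => /=; rewrite (leq_trans Mn)// leq_addr.
  move: lim; apply: cvg_trans; apply: near_eq_cvg; near=> N.
  by rewrite integral_psum_sqr mulKf// addnK.
move: lim2; apply: cvg_trans; apply: near_eq_cvg; near=> N.
apply: eq_bigr => k _; rewrite /d -addnn !exprD; ring.
Unshelve. all: by end_near. Qed.

End parseval.

(** * Boundary values of the spectral density *)

Section poisson_localization.
Context {R : realType}.
Local Notation mu := (@lebesgue_measure R).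

(** Radii form a sequence so that dominated convergence applies; starting at 1/2 secures 2r >= 1 in
    [poisson_away]. *)
Definition abel_radius (j : nat) : R := 1 - j.+2%:R^-1.

Lemma abel_radius01 j : 0 <= abel_radius j < 1.
Proof. by rewrite /abel_radius subr_ge0 invf_le1// ler1n/= gtrBl invr_gt0. Qed.

Lemma abel_radius_ge_half j : 2^-1 <= abel_radius j.
Proof.
rewrite /abel_radius; have : j.+2%:R^-1 <= 2^-1 :> R by rewrite lef_pV2 ?posrE// ler_nat.
by move: (j.+2%:R^-1) => z; lra.
Qed.

Lemma abel_radius_cvg : abel_radius @ \oo --> (1 : R).
Proof.
rewrite -[X in _ --> X]subr0; apply: cvgB; first exact: cvg_cst.
by apply: (cvg_comp _ _ _ (@cvg_harmonic R)) => A [M _ hM]; exists M => // k /= Mk;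
  apply: (hM k.+1) => /=; rewrite ltnW.
Qed.

Lemma cos_lt1 (s : R) : 0 < `|s| < 2 * pi -> cos s < 1.
Proof.
wlog s0 : s / 0 <= s.
  move=> wl; have [s0|s0] := leP 0 s; first exact: wl.
  by rewrite -normrN -cosN; apply: wl; rewrite oppr_ge0 ltW.
rewrite (ger0_norm s0) => /andP[sp s2].
have hs : s = s / 2 + s / 2 by rewrite -splitr.
have := cos2Dsin2 (s / 2); rewrite [X in cos X < 1]hs cosD => h.
have : 0 < sin (s / 2) by apply: sin_gt0_pi; apply/andP; split; lra.
by move=> sp2; have := mulr_gt0 sp2 sp2; rewrite -!expr2; lra.
Qed.

(** For c = pi: two points of [-pi, pi] differ by a full period, where the kernel peaks again, only
    if they are its opposite ends. *)
Lemma dist_lt (c a b : R) : - c < a -> a <= c -> - c <= b -> b <= c ->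
  (a < c) || (- c < b) -> `|a - b| < 2 * c.
Proof.
by move=> ? ? ? ? /orP[?|?]; rewrite ltr_norml; apply/andP; split; lra.
Qed.

(* Off the diagonal the Poisson kernel is O(1 - r). *)
Lemma poisson_away (th p q : R) (A : set R) : p <= q ->
  (forall t, p <= t <= q -> 0 < `|th - t| < 2 * pi) ->
  measurable (A : set (measurableTypeR R)) -> A `<=` circle R -> A `<=` `[p, q]%classic ->
  (fun j => \int[mu]_(t in A) poisson (abel_radius j) (th - t)) @ \oo --> (0 : R).
Proof.
move=> pq thpq mA Ac Apq.
have cc : {within `[p, q], continuous (fun t => cos (th - t))}.
  apply: continuous_subspaceT => t.
  have h : th - x @[x --> t] --> th - t by apply: cvgB; [exact: cvg_cst|exact: cvg_id].
  exact: cvg_comp h (@continuous_cos R _).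
(* By compactness the cosine stays below a constant less than 1, which bounds the denominator of the
   kernel from below uniformly in j. *)
have [t0 t0pq hmax] := EVT_max pq cc.
pose k := 1 - cos (th - t0).
have k0 : 0 < k by rewrite subr_gt0 cos_lt1// thpq//; move: t0pq; rewrite in_itv.
have fA : (mu A < +oo)%E.
  rewrite (@le_lt_trans _ _ (mu (circle R)))//; last by rewrite circle_measure ltry.
  by apply: le_measure; rewrite ?inE//; exact: measurable_circle.
have e0 : (fun j => (1 - abel_radius j ^+ 2) / k * fine (mu A)) @ \oo --> (0 : R).
  rewrite -(mul0r (fine (mu A))); apply: cvgMr_tmp.
  rewrite -(mul0r k^-1); apply: cvgMr_tmp.
  rewrite -(subrr 1); apply: cvgB; first exact: cvg_cst.
  rewrite -[X in _ --> X](expr1n _ 2).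
  exact: cvg_comp abel_radius_cvg (@exprn_continuous R 2 1).
apply/norm_cvg0P; move: e0; apply: (@squeeze_cvgr _ _ _ _ (fun=> 0)); last exact: cvg_cst.
near=> j; rewrite normr_ge0 /=.
have r01 := abel_radius01 j.
have cP := @continuous_poisson_shift R (abel_radius j) r01.
have cP' : continuous (fun t => poisson (abel_radius j) (th - t)).
  by under eq_fun do rewrite -poissonN opprB; exact: cP.
have iP : mu.-integrable A (EFin \o (fun t => poisson (abel_radius j) (th - t))).
  exact: continuous_circle_integrable.
rewrite (le_trans (le_normr_Rintegral _ _))//.
rewrite -Rintegral_cst//; apply: le_Rintegral => //.
- apply: (continuous_circle_integrable (f := fun t => `|poisson (abel_radius j) (th - t)|)) => // t.
  by apply: cvg_norm; exact: cP'.
- by apply: continuous_circle_integrable => //; exact: cst_continuous.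
- move=> t At; apply: poisson_le => //.
  rewrite poisson_den.
  have tpq := Apq t At; have := hmax t tpq; have := abel_radius_ge_half j => h1 h2.
  have : 0 <= (1 - abel_radius j) ^+ 2 by exact: sqr_ge0.
  have : k <= 1 - cos (th - t) by rewrite /k lerD2l lerN2.
  move=> h3 h4.
  have : 1 * (1 - cos (th - t)) <= 2 * abel_radius j * (1 - cos (th - t)).
    by rewrite ler_wpM2r//; lra.
  lra.
Unshelve. all: by end_near. Qed.

(** The Poisson integral of the indicator function of []x, y]]. *)
Definition window (x y r th : R) : R :=
  (2 * pi)^-1 * \int[mu]_(t in `]x, y]) poisson r (th - t).

Section window.
Variables (x y : R).
Hypothesis (x0 : - pi < x) (xy : x < y) (y1 : y < pi).

Let I := `]x, y]%classic.
Let mc := @measurable_circle R.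
Let mI : measurable (I : set (measurableTypeR R)). Proof. exact: measurable_itv. Qed.
Let Ic : I `<=` circle R.
Proof.
move=> t; rewrite /I /circle /= !in_itv/= => /andP[xt ty].
by rewrite (lt_trans x0 xt)/= (le_trans ty)// ltW.
Qed.

Let twopi_gt0 : 0 < 2 * pi :> R. Proof. by rewrite mulr_gt0// pi_gt0. Qed.

Let cP (r th : R) : 0 <= r < 1 -> continuous (fun t => poisson r (th - t)).
Proof.
by move=> r01; under eq_fun do rewrite -poissonN opprB; exact: continuous_poisson_shift.
Qed.

Let iP (r th : R) (A : set R) : 0 <= r < 1 -> measurable (A : set (measurableTypeR R)) ->
  A `<=` circle R -> mu.-integrable A (EFin \o (fun t => poisson r (th - t))).
Proof. by move=> r01 mA Ac; apply: continuous_circle_integrable => //; exact: cP. Qed.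

Let split_circle r th : 0 <= r < 1 ->
  2 * pi = \int[mu]_(t in `]- pi, x]) poisson r (th - t) +
    (\int[mu]_(t in I) poisson r (th - t) + \int[mu]_(t in `]y, pi]) poisson r (th - t)).
Proof.
move=> r01.
have yp : `]y, pi]%classic `<=` circle R.
  move=> t; rewrite /circle /= !in_itv/= => /andP[yt ->]; rewrite andbT.
  exact: lt_trans (lt_trans x0 xy) yt.
have xp : `]- pi, x]%classic `<=` circle R.
  move=> t; rewrite /circle /= !in_itv/= => /andP[-> tx]/=.
  by rewrite (le_trans tx)// ltW// (lt_trans xy).
rewrite -(integral_poisson r01 th).
have IyE : I `|` `]y, pi]%classic = `]x, pi]%classic.
  by rewrite /I -itv_bndbnd_setU// bnd_simp ltW.
have cE : circle R = `]- pi, x]%classic `|` (I `|` `]y, pi]%classic).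
  rewrite IyE -itv_bndbnd_setU// bnd_simp ?ltW//.
  exact: lt_trans xy y1.
rewrite cE Rintegral_setU//=.
- congr (_ + _); rewrite Rintegral_setU//=.
  + by apply: iP; rewrite // IyE; [exact: measurable_itv|rewrite -IyE => t [/Ic|/yp]].
  + apply/disj_setPS => t; rewrite /I /= !in_itv/= => -[/andP[_ ty] /andP[yt _]].
    by move: (lt_le_trans yt ty); rewrite ltxx.
- by rewrite IyE; exact: measurable_itv.
- by rewrite -cE; apply: iP.
- rewrite IyE; apply/disj_setPS => t; rewrite /= !in_itv/= => -[/andP[_ tx] /andP[xt _]].
  by move: (lt_le_trans xt tx); rewrite ltxx.
Qed.

Let int_ge0 r th A : 0 <= r < 1 -> 0 <= \int[mu]_(t in A) poisson r (th - t).
Proof. by move=> r01; apply: Rintegral_ge0 => t _; exact/ltW/poisson_gt0. Qed.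

Lemma window_bound r th : 0 <= r < 1 -> `|window x y r th| <= 1.
Proof.
move=> r01; have := split_circle th r01.
have h1 := int_ge0 th `]- pi, x]%classic r01.
have h2 := int_ge0 th I r01.
have h3 := int_ge0 th `]y, pi]%classic r01.
rewrite /window -/I => h.
rewrite ger0_norm; last by rewrite mulr_ge0// invr_ge0 ltW.
by rewrite mulrC ler_pdivrMr// mul1r; lra.
Qed.

Lemma window_cvg_out th : circle R th -> (th < x) || (y < th) ->
  (fun j => window x y (abel_radius j) th) @ \oo --> (0 : R).
Proof.
rewrite /circle /= in_itv/= => /andP[th0 th1] out.
rewrite -(mulr0 (2 * pi)^-1); apply: cvgMl_tmp.
apply: (@poisson_away th x y I) => //.
- exact: ltW.
- move=> t /andP[xt ty]; rewrite normr_gt0 subr_eq0; apply/andP; split.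
    by apply/eqP => tht; case/orP: out; rewrite tht ltNge ?xt ?ty.
  have tx : - pi < t := lt_le_trans x0 xt; have tp : t < pi := le_lt_trans ty y1.
  by apply: (dist_lt th0 th1 (ltW tx) (ltW tp)); rewrite tx orbT.
- by move=> t; rewrite /I /= !in_itv/= => /andP[/ltW -> ->].
Qed.

Lemma window_cvg_in th : x < th < y ->
  (fun j => window x y (abel_radius j) th) @ \oo --> (1 : R).
Proof.
move=> /andP[xth thy].
have -> : (fun j => window x y (abel_radius j) th) = (fun j => (2 * pi)^-1 * (2 * pi -
    \int[mu]_(t in `]- pi, x]) poisson (abel_radius j) (th - t) -
    \int[mu]_(t in `]y, pi]) poisson (abel_radius j) (th - t))).
  apply/funext => j; rewrite {2}(split_circle th (abel_radius01 j)) /window -/I; congr (_ * _);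
    ring.
rewrite -[X in _ --> X](mulVf (lt0r_neq0 twopi_gt0)); apply: cvgMl_tmp.
rewrite -[X in _ --> X]subr0 -[X in _ --> X]subr0.
apply: cvgB; [apply: cvgB; first exact: cvg_cst|].
- apply: (@poisson_away th (- pi) x) => //.
  + exact: ltW.
  + move=> t /andP[pt tx]; rewrite normr_gt0 subr_eq0; apply/andP; split.
      by apply/eqP => tht; move: xth; rewrite tht ltNge tx.
    have thp : th < pi := lt_trans thy y1.
    have tp : t <= pi := le_trans tx (ltW (lt_trans xy y1)).
    by apply: (dist_lt (lt_trans x0 xth) (ltW thp) pt tp); rewrite thp.
  + move=> t; rewrite /circle /= !in_itv/= => /andP[-> tx]/=.
    by rewrite (le_trans tx)// ltW// (lt_trans xy).
  + by move=> t; rewrite /= !in_itv/= => /andP[/ltW -> ->].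
- apply: (@poisson_away th y pi) => //.
  + exact: ltW.
  + move=> t /andP[yt tp]; rewrite normr_gt0 subr_eq0; apply/andP; split.
      by apply/eqP => tht; move: thy; rewrite tht ltNge yt.
    have thp : th < pi := lt_trans thy y1.
    have pt : - pi <= t := le_trans (ltW (lt_trans x0 xy)) yt.
    by apply: (dist_lt (lt_trans x0 xth) (ltW thp) pt tp); rewrite thp.
  + move=> t; rewrite /circle /= !in_itv/= => /andP[yt ->]; rewrite andbT.
    exact: lt_trans (lt_trans x0 xy) yt.
  + by move=> t; rewrite /= !in_itv/= => /andP[/ltW -> ->].
Qed.

End window.
End poisson_localization.

Section log_poisson_limit.
Context {R : realType}.
Local Notation mu := (@lebesgue_measure R).
Variable Delta : R -> R.
Hypothesis ilog : mu.-integrable (circle R) (EFin \o (fun t => ln (Delta t))).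

Section limit.
Variables (x y : R).
Hypothesis (x0 : - pi < x) (xy : x < y) (y1 : y < pi).

Let mc := @measurable_circle R.
Let mI : measurable (`]x, y]%classic : set (measurableTypeR R)).
Proof. exact: measurable_itv. Qed.
Let fI : (mu `]x, y]%classic < +oo)%E.
Proof. by rewrite lebesgue_measure_itv/=; case: ifP => _; rewrite -?EFinD ltry. Qed.
Let Ic : `]x, y]%classic `<=` circle R.
Proof.
move=> t; rewrite /circle /= !in_itv/= => /andP[xt ty].
by rewrite (lt_trans x0 xt)/= (le_trans ty)// ltW.
Qed.
Let c1 : continuous (fun _ : R => 1 : R). Proof. exact: cst_continuous. Qed.
Let b1 (z : R) : `|1 : R| <= 1. Proof. by rewrite normr1. Qed.

Lemma integral_log_poisson (r : R) : 0 <= r < 1 ->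
  \int[mu]_(t in `]x, y]) log_poisson Delta r t =
  \int[mu]_(th in circle R) (ln (Delta th) * window x y r th).
Proof.
move=> r01.
pose k s : R := (2 * pi)^-1 * poisson r s.
have ck : continuous k by move=> s; apply: cvgMl_tmp; exact: poisson_continuous.
have kK s : `|k s| <= `|(2 * pi)^-1| * ((1 - r ^+ 2) / (1 - r) ^+ 2).
  by rewrite normrM ler_wpM2l// poisson_bound.
transitivity (\int[mu]_(t in `]x, y]) (1 * \int[mu]_(th in circle R) (k (th - t) * ln (Delta th)))).
  apply: eq_Rintegral => t _; rewrite mul1r /log_poisson -RintegralZl//.
    by apply: eq_Rintegral => th _; rewrite mulrA.
  exact: poisson_mul_integrable.
rewrite (convolution_swap ck c1 kK b1 mc mI fI ilog).
apply: eq_Rintegral => th _; congr (_ * _); rewrite /window -RintegralZl//.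
  by apply: eq_Rintegral => t _; rewrite mulr1.
apply: continuous_circle_integrable => //.
by under eq_fun do rewrite -poissonN opprB; exact: continuous_poisson_shift.
Qed.

Lemma measurable_window (r : R) : 0 <= r < 1 ->
  measurable_fun (circle R : set (measurableTypeR R)) (window x y r).
Proof.
move=> r01.
have i1 : mu.-integrable `]x, y]%classic (EFin \o (fun _ : R => 1 : R)).
  exact: continuous_circle_integrable.
have fc : (mu (circle R) < +oo)%E by rewrite circle_measure ltry.
have := convolution_integrable (@poisson_continuous _ _ r01) c1 (poisson_bound r01) b1 mI mc fc i1.
move=> /(measurable_int _)/measurable_EFinP h.
have -> : window x y r = (fun t => (2 * pi)^-1 *
    (1 * \int[mu]_(th in `]x, y]) (poisson r (th - t) * 1))).
  apply/funext => t; rewrite /window mul1r; congr (_ * _); apply: eq_Rintegral => th _.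
  by rewrite mulr1 -poissonN opprB.
exact: measurable_funM.
Qed.

(** The integral over []x, y]] is the pairing of ln Delta with [window], which is bounded by 1 and
    tends to the indicator function off the two endpoints; |ln Delta| dominates. *)
Lemma integral_log_poisson_cvg :
  (fun j => \int[mu]_(t in `]x, y]) log_poisson Delta (abel_radius j) t) @ \oo -->
  \int[mu]_(t in `]x, y]) ln (Delta t).
Proof.
have mlog : measurable_fun (circle R : set (measurableTypeR R)) (fun t => ln (Delta t)).
  by apply/measurable_EFinP; apply: measurable_int ilog.
pose f j t := (ln (Delta t) * window x y (abel_radius j) t)%:E.
pose g t := (ln (Delta t) * (\1_(`]x, y]%classic) t : R))%:E.
have mg : measurable_fun (circle R : set (measurableTypeR R)) g.
  by apply/measurable_EFinP; apply: measurable_funM.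
have mf j : measurable_fun (circle R : set (measurableTypeR R)) (f j).
  apply/measurable_EFinP; apply: measurable_funM => //.
  exact: (measurable_window (abel_radius01 j)).
have fg : {ae mu, forall t, circle R t -> f ^~ t @ \oo --> g t}.
  have : mu.-negligible [set x; y].
    have m1 z : measurable ([set z] : set (measurableTypeR R)) by exact: measurable_set1.
    apply/negligibleP; first exact: measurableU.
    apply: countable_lebesgue_measure0; exact: finite_set_countable.
  apply: negligibleS => t /= /not_implyP[ct ft].
  apply: contrapT => /not_orP[/eqP tx /eqP ty]; apply: ft.
  rewrite /f /g; apply: cvg_EFin; first by apply: nearW.
  apply: (@cvgMl_tmp _ _ _ _ _ (ln (Delta t))).
  rewrite indicE; have [tI|tI] := boolP (t \in `]x, y]%classic).
    apply: window_cvg_in => //; move: tI; rewrite inE /= in_itv/= => /andP[-> ty'].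
    by rewrite lt_neqAle ty.
  apply: window_cvg_out => //; move/negP: tI; rewrite inE /= in_itv/= => /negP.
  rewrite negb_and -!leNgt -ltNge le_eqVlt (negbTE tx)/=.
  by [].
have abs_int : mu.-integrable (circle R) (fun t => `|(ln (Delta t))%:E|%E).
  exact: integrable_abse ilog.
have dom : {ae mu, forall t j, circle R t -> (`|f j t| <= `|(ln (Delta t))%:E|)%E}.
  apply: aeW => t j ct; rewrite /f /= lee_fin normrM ler_piMr//.
  exact: window_bound (abel_radius01 j).
have [ig _ lim] := dominated_convergence mc mf mg fg abs_int dom.
have gE : (\int[mu]_(t in circle R) g t)%E = (\int[mu]_(t in `]x, y]) (ln (Delta t))%:E)%E.
  rewrite [RHS](_ : _ = \int[mu]_(t in circle R `&` `]x, y]) (ln (Delta t))%:E)%E; last first.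
    by rewrite setIidr.
  rewrite [RHS]integral_mkcondr; apply: eq_integral => t _.
  rewrite /g patchE indicE; case: ifP => tI; rewrite ?tI ?mulr1//.
  by rewrite mulr0.
have fin : (\int[mu]_(t in circle R) g t)%E \is a fin_num by exact: integrable_fin_num.
move: lim; rewrite -(fineK fin) => /fine_cvg; rewrite gE; apply: cvg_trans; apply: near_eq_cvg;
  near=> j.
rewrite integral_log_poisson//; exact: abel_radius01.
Unshelve. all: by end_near. Qed.

End limit.
End log_poisson_limit.

Section boundary_values.
Context {R : realType}.
Local Notation mu := (@lebesgue_measure R).
Variables (Delta : R -> R) (m : R * R -> R).
Hypothesis Delta_gt0 : forall t, circle R t -> 0 < Delta t.
Hypothesis ilog : mu.-integrable (circle R) (EFin \o (fun t => ln (Delta t))).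
Hypothesis cm : continuous m.
Hypothesis clog : forall j, continuous (fun t => expR (log_poisson Delta (abel_radius j) t)).
Hypothesis mE : forall j t, expR (log_poisson Delta (abel_radius j) t) * m (abel_radius j, t) = 1.

Let mc := @measurable_circle R.
Let v : R -> R := (fun t => ln (Delta t)) \_ (circle R).

Lemma log_poisson_continuous j : continuous (log_poisson Delta (abel_radius j)).
Proof.
have -> : log_poisson Delta (abel_radius j) =
    @ln R \o (fun t => expR (log_poisson Delta (abel_radius j) t)).
  by apply/funext => t /=; rewrite expRK.
by move=> t; apply: continuous_comp; [exact: clog|exact/continuous_ln/expR_gt0].
Qed.

(* If [1 / m] stayed below some [s < Delta t] near the boundary point [t], so would the
   exponential of the Poisson integral, and the averages of [ln Delta] over short intervals
   [`]t, t + h]] would be at most [ln s]; at a Lebesgue point they tend to [ln (Delta t)]. *)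
Lemma boundary_density_le (t : R) : - pi < t < pi ->
  derivable (fun y => \int[mu]_(x in `]- pi, y]) v x) t 1 /\
    derive1 (fun y => \int[mu]_(x in `]- pi, y]) v x) t = v t ->
  Delta t * m (1, t) <= 1.
Proof.
move=> /andP[t0 t1]; set F := (fun y => _) => -[dF F't].
have ct : circle R t by rewrite /circle /= in_itv/= t0 ltW.
have vt : v t = ln (Delta t) by rewrite /v patchE mem_set.
rewrite leNgt; apply/negP => Dm.
have D0 := Delta_gt0 ct.
have m0 : 0 < m (1, t) by rewrite -(pmulr_rgt0 _ D0) (lt_trans ltr01).
have [s [s0 sD sm]] : exists s : R, [/\ 0 < s, s < Delta t & 1 < s * m (1, t)].
  have h : (m (1, t))^-1 < Delta t by rewrite -[_^-1]mul1r ltr_pdivrMr.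
  exists (((m (1, t))^-1 + Delta t) / 2); split.
  - by rewrite divr_gt0// addr_gt0// invr_gt0.
  - by rewrite ltr_pdivrMr//; lra.
  - rewrite -ltr_pdivrMr// mul1r ltr_pdivlMr//; lra.
(* Joint continuity of [m] provides one bound for all radii near 1 and all angles near [t], as
   integration over an interval requires. *)
have : \forall p \near (1 : R, t), s^-1 < m p.
  have h : s^-1 < m (1, t) by rewrite -[_^-1]mul1r ltr_pdivrMr// mulrC.
  exact: (@cvgr_gt _ _ _ _ m (m (1, t)) (@cm (1, t)) _ h).
move=> [[A B] /= [nA nB] AB].
have [N _ hN] : \forall j \near \oo, A (abel_radius j) by exact: abel_radius_cvg nA.
have log_le j y : (N <= j)%N -> B y -> log_poisson Delta (abel_radius j) y <= ln s.
  move=> Nj By; rewrite -(ler_expR (log_poisson Delta (abel_radius j) y)) lnK ?posrE//.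
  have := AB (abel_radius j, y) (conj (hN j Nj) By) => /= h.
  have mp : 0 < m (abel_radius j, y) by apply: lt_trans h; rewrite invr_gt0.
  rewrite -(ler_pM2r mp) mE -ler_pdivrMl// mulr1; exact: ltW.
have vI y : mu.-integrable `]- pi, y]%classic (EFin \o v).
  apply: (@integrableS _ _ _ mu setT) => //.
  by rewrite /v -restrict_EFin; apply: (integrable_mkcond _ mc).1.
have [e /= e0 eB] : \forall y \near t, B y /\ y < pi.
  apply: filterI => //; exact: lt_nbhsl.
have Fh h : 0 < h -> h < e -> F (h + t) - F t <= h * ln s.
  move=> h0 he.
  have tB y : t < y -> y <= h + t -> B y /\ y < pi.
    move=> ty yh; apply: eB => /=; rewrite ler0_norm ?subr_le0 ?ltW//; lra.
  have htp : h + t < pi by case: (tB (h + t)) => //; rewrite ltrDr.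
  have tht : t < h + t by rewrite ltrDr.
  rewrite /F Rintegral_itvB//; [|by rewrite bnd_simp ltW|by rewrite bnd_simp ltW].
  have vE : \int[mu]_(x in `]t, h + t]) v x = \int[mu]_(x in `]t, h + t]) ln (Delta x).
    apply: eq_Rintegral => x; rewrite inE /= in_itv/= => /andP[tx xh].
    rewrite /v patchE mem_set// /circle /= in_itv/= (lt_trans t0 tx)/=.
    by rewrite (le_trans xh)// ltW.
  rewrite vE.
  have lim := integral_log_poisson_cvg ilog t0 tht htp.
  apply: (ler_cvg_to lim (cvg_cst (h * ln s))); exists N => // j /= Nj.
  have hI : fine (mu `]t, h + t]%classic) = h.
    by rewrite lebesgue_measure_itv/= lte_fin tht -EFinD/= addrK.
  rewrite -[X in X * _]hI mulrC -Rintegral_cst; last exact: measurable_itv.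
  have mI : measurable (`]t, h + t]%classic : set (measurableTypeR R)) by exact: measurable_itv.
  have Ic : `]t, h + t]%classic `<=` circle R.
    move=> x; rewrite /circle /= !in_itv/= => /andP[tx xh].
    by rewrite (lt_trans t0 tx)/= (le_trans xh)// ltW.
  apply: le_Rintegral => //.
  - exact: (continuous_circle_integrable (@log_poisson_continuous j) mI Ic).
  - exact: (continuous_circle_integrable (@cst_continuous _ _ (ln s)) mI Ic).
  - move=> x /=; rewrite in_itv/= => /andP[tx xh].
    by apply: log_le => //; case: (tB x tx xh).
have : (fun h => h^-1 *: (F (h + t) - F t)) @ 0^'+ --> ln (Delta t).
  apply: cvg_dnbhs_at_right; rewrite -vt -F't derive1E.
  have -> : (fun h => h^-1 *: (F (h + t) - F t)) =
    (fun h => h^-1 *: ((F \o shift t) (h *: 1) - F t)).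
    by apply/funext => h /=; rewrite [h *: 1]mulr1.
  exact: dF.
move=> /ler_cvg_to/(_ (cvg_cst (ln s))) h.
suff : ln (Delta t) <= ln s by rewrite ler_ln ?posrE// leNgt sD.
apply: h; near=> h.
have h0 : 0 < h by near: h; exact: nbhs_right_gt.
rewrite [_ *: _]mulrC ler_pdivrMr// mulrC; apply: Fh => //.
Unshelve. all: by end_near. Qed.

Lemma ae_boundary_density_le : {ae mu, forall t, circle R t -> Delta t * m (1, t) <= 1}.
Proof.
have vT : mu.-integrable setT (EFin \o v).
  by rewrite /v -restrict_EFin; apply: (integrable_mkcond _ mc).1.
have vI y : mu.-integrable [set` Interval (BRight (- pi)) (BRight y)] (EFin \o v).
  exact: (@integrableS _ _ _ mu setT).
have lv : locally_integrable [set: R] v by apply: open_integrable_locally => //; exact: openT.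
have ftc := FTC1 vI lv.
have npi : mu.-negligible [set (pi : R)].
  apply/negligibleP; first exact: measurable_set1.
  exact: lebesgue_measure_set1.
have nep : {ae mu, forall t : R, t != pi}.
  by apply: negligibleS npi => t /= /negP; rewrite negbK => /eqP.
apply: (@filterS2 _ _ (ae_filter_ringOfSetsType mu) _ _ _ _ ftc nep) => t {}ftc tp ct.
move: (ct); rewrite /circle /= in_itv/= => /andP[t0 t1].
have tpi : - pi < t < pi by rewrite t0 lt_neqAle tp.
apply: boundary_density_le => //; exact: (ftc t0).
Qed.

(** Only a lower bound on the limit is available. The minimum with Delta cuts off a possible excess
    and supplies the integrable majorant for [integral_density_le]. *)
Lemma ae_min_cvg : {ae mu, forall t, circle R t ->
  (fun j => Num.min (expR (log_poisson Delta (abel_radius j) t)) (Delta t)) @ \oo --> Delta t}.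
Proof.
apply: (@filterS _ _ (ae_filter_ringOfSetsType mu) _ _ _ ae_boundary_density_le) =>
  t /= /[swap] ct /(_ ct) ht; have D0 := Delta_gt0 ct.
have mt : (fun j => m (abel_radius j, t)) @ \oo --> m (1, t).
  have h : (abel_radius j, t) @[j --> \oo] --> (1 : R, t : R).
    exact: (cvg_pair abel_radius_cvg (cvg_cst t)).
  exact: cvg_comp h (@cm (1, t)).
apply/cvgrPdist_le => e e0.
(* The product form covers boundary points where [m] vanishes, at which no quotient is available. *)
have : \forall j \near \oo, m (abel_radius j, t) * (Delta t - e) <= 1.
  have [De|De] := leP (Delta t) e.
    apply: nearW => j; rewrite (@le_trans _ _ 0)// mulr_ge0_le0 ?subr_le0//.
    have := mE j t; have := expR_gt0 (log_poisson Delta (abel_radius j) t) => E0 h.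
    by apply: ltW; rewrite -(pmulr_rgt0 _ E0) h.
  apply: (cvgr_le (m (1, t) * (Delta t - e))); first exact: cvgMr_tmp.
  have [m0|m0] := leP (m (1, t)) 0.
    by rewrite (@le_lt_trans _ _ 0)// mulr_le0_ge0// subr_ge0 ltW.
  apply: lt_le_trans ht; rewrite mulrC ltr_pM2r// ltrBlDr ltrDl//.
apply: filterS => j hj.
have E0 := expR_gt0 (log_poisson Delta (abel_radius j) t).
have hE : Delta t - e <= expR (log_poisson Delta (abel_radius j) t).
  have := ler_wpM2l (ltW E0) hj; rewrite mulr1 mulrA mE mul1r. done.
rewrite ger0_norm ?subr_ge0 ?ge_min ?lexx ?orbT// lerBlDl -lerBlDr.
by rewrite le_min hE/= gerBl ltW.
Qed.

Lemma integral_density_le (K : R) : mu.-integrable (circle R) (EFin \o Delta) ->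
  (forall j, \int[mu]_(t in circle R) expR (log_poisson Delta (abel_radius j) t) <= K) ->
  \int[mu]_(t in circle R) Delta t <= K.
Proof.
move=> iD EK.
have mD : measurable_fun (circle R : set (measurableTypeR R)) Delta.
  by apply/measurable_EFinP; apply: measurable_int iD.
have iE j : mu.-integrable (circle R) (EFin \o (fun t =>
  expR (log_poisson Delta (abel_radius j) t))).
  exact: continuous_circle_integrable.
have mE' j : measurable_fun (circle R : set (measurableTypeR R))
    (fun t => expR (log_poisson Delta (abel_radius j) t)).
  by apply/measurable_EFinP; apply: measurable_int (iE j).
pose f j t := (Num.min (expR (log_poisson Delta (abel_radius j) t)) (Delta t))%:E.
have mf j : measurable_fun (circle R : set (measurableTypeR R)) (f j).
  by apply/measurable_EFinP; apply: measurable_minr.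
have fD : {ae mu, forall t, circle R t -> f ^~ t @ \oo --> (Delta t)%:E}.
  apply: (@filterS _ _ (ae_filter_ringOfSetsType mu) _ _ _ ae_min_cvg) => t h ct; apply: cvg_EFin;
    first exact: nearW.
  exact: h.
have dom : {ae mu, forall t j, circle R t -> (`|f j t| <= (Delta t)%:E)%E}.
  apply: aeW => t j ct; rewrite /f /= lee_fin ger0_norm ?ge_min ?lexx ?orbT//.
  by rewrite le_min expR_ge0 ltW// Delta_gt0.
have [_ _ lim] := dominated_convergence mc mf (measurable_int _ iD) fD iD dom.
have fin : (\int[mu]_(t in circle R) (Delta t)%:E)%E \is a fin_num by exact: integrable_fin_num.
move: lim; rewrite -(fineK fin) => /fine_cvg lim.
apply: (ler_cvg_to lim (cvg_cst K)); apply: nearW => j /=.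
apply: le_trans (EK j); apply: le_Rintegral => //.
- apply: (le_integrable mc (mf j) _ iD) => t ct.
  rewrite /f /= lee_fin !ger0_norm ?ge_min ?lexx ?orbT//; first by rewrite ltW// Delta_gt0.
  by rewrite le_min expR_ge0 ltW// Delta_gt0.
- by move=> t ct; rewrite ge_min lexx.
Qed.

End boundary_values.

(** * Autocovariances *)

Section autocovariance.
Context {R : realType}.
Local Notation mu := (@lebesgue_measure R).
Variables (Delta : R -> R) (c a : nat -> R).
Hypothesis Delta_gt0 : forall t, circle R t -> 0 < Delta t.
Hypothesis iDelta : mu.-integrable (circle R) (EFin \o Delta).
Hypothesis ilog : mu.-integrable (circle R) (EFin \o (fun t => ln (Delta t))).
Hypothesis hc : MA_coefficients Delta c.
Hypothesis ha : AR_coefficients Delta a.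

Let mc := @measurable_circle R.
Let twopi_gt0 : 0 < 2 * pi :> R. Proof. by rewrite mulr_gt0// pi_gt0. Qed.

Let moment (m : nat) : R := \int[mu]_(t in circle R) (Delta t * cos (m%:R * t)).
Let E (r t : R) : R := expR (log_poisson Delta r t).

Lemma exp_log_poissonE r t : 0 <= r < 1 ->
  E r t = (2 * pi)^-1 * (cos_sum c r t ^+ 2 + sin_sum c r t ^+ 2).
Proof.
by move=> r01; have [-> _] := szego_polar_modulus t hc ha r01; rewrite mulKf// gt_eqF.
Qed.

Lemma exp_log_poisson_continuous r : 0 <= r < 1 -> continuous (E r).
Proof.
move=> r01; have /andP[r0 _] := r01.
have -> : E r = (fun t => (2 * pi)^-1 * (cos_sum c r t ^+ 2 + sin_sum c r t ^+ 2)).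
  by apply/funext => t; rewrite exp_log_poissonE.
have cc := disk_abs_cvg hc r01.
move=> t; apply: cvgMl_tmp; apply: cvgD.
  have h : cos_sum c r x @[x --> t] --> cos_sum c r t by exact: cos_sum_continuous.
  exact: cvg_comp h (@exprn_continuous R 2 _).
have h : sin_sum c r x @[x --> t] --> sin_sum c r t by exact: sin_sum_continuous.
exact: cvg_comp h (@exprn_continuous R 2 _).
Qed.

Lemma series_abel_moment r (m : nat) : 0 <= r < 1 ->
  series (fun k => c k * c (k + m)%N * r ^+ (k.*2 + m)) @ \oo -->
  \int[mu]_(t in circle R) (E r t * cos (m%:R * t)).
Proof.
move=> r01; have /andP[r0 _] := r01.
rewrite (_ : \int[mu]_(t in circle R) (E r t * cos (m%:R * t)) = (2 * pi)^-1 *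
    \int[mu]_(t in circle R) ((cos_sum c r t ^+ 2 + sin_sum c r t ^+ 2) * cos (m%:R * t))).
  exact: parseval (disk_abs_cvg hc r01).
have cE : continuous (fun t => E r t * cos (m%:R * t)).
  by move=> t; apply: cvgM; [exact: exp_log_poisson_continuous|exact: continuous_cos_scale].
rewrite (_ : (fun t => (cos_sum c r t ^+ 2 + _) * _) =
    (fun t => 2 * pi * (E r t * cos (m%:R * t)))); last first.
  by apply/funext => t; rewrite mulrA exp_log_poissonE// mulVKf// gt_eqF.
by rewrite RintegralZl ?mulKf ?gt_eqF//; exact: continuous_circle_integrable.
Qed.

Lemma moment_integrable m : mu.-integrable (circle R) (EFin \o (fun t => Delta t * cos (m%:R * t))).
Proof.
have h1 := weighted_Delta_integrable iDelta m (e := 1); rewrite normr1 lexx in h1.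
have h := integrableB mc (h1 isT) iDelta.
apply: eq_integrable h => // t _ /=; rewrite -EFinB; congr EFin; ring.
Qed.

(* Jensen against the weight [1 + e cos (m t)], which is nonnegative. *)
Lemma abel_moment_le r (m : nat) (e : R) : 0 <= r < 1 -> `|e| <= 1 ->
  limn (series (fun k => c k * c (k + 0)%N * r ^+ (k.*2 + 0))) +
    e * limn (series (fun k => c k * c (k + m)%N * r ^+ (k.*2 + m))) <=
  moment 0 + e * r ^+ m * moment m.
Proof.
move=> r01 e1; have cE := exp_log_poisson_continuous r01.
rewrite !(cvg_lim _ (@series_abel_moment r _ r01))//.
have iE n : mu.-integrable (circle R) (EFin \o (fun t => E r t * cos (n%:R * t))).
  apply: continuous_circle_integrable => // t.
  by apply: cvgM; [exact: cE|exact: continuous_cos_scale].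
rewrite -RintegralZl// -RintegralD//; last first.
  by rewrite (_ : EFin \o _ = (fun x => e%:E * (E r x * cos (m%:R * x))%R%:E)%E)//;
    exact/(integrableZl mc)/iE.
rewrite /moment -RintegralZl//; last exact: moment_integrable.
rewrite -RintegralD//; first last.
- rewrite (_ : EFin \o _ =
    (fun x => (e * r ^+ m)%:E * (Delta x * cos (m%:R * x))%R%:E)%E)//.
  exact/(integrableZl mc)/moment_integrable.
- exact: moment_integrable.
have := integral_exp_log_poisson_le Delta_gt0 iDelta ilog r01 m e1 cE.
rewrite (_ : (fun t => (1 + e * cos (m%:R * t)) * _) =
  (fun t => E r t * cos (0%:R * t) + e * (E r t * cos (m%:R * t)))); last first.
  by apply/funext => t; rewrite mul0r cos0 /E; ring.
rewrite (_ : (fun t => Delta t * (1 + e * r ^+ m * cos (m%:R * t))) =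
  (fun t => Delta t * cos (0%:R * t) + e * r ^+ m * (Delta t * cos (m%:R * t))))//.
by apply/funext => t; rewrite mul0r cos0; ring.
Qed.

(** For e = 0 the Jensen bound reads sum c_k^2 r^(2k) <= gamma(0), uniformly in r; r tends to 1 in
    each partial sum. *)
Lemma MA_square_summable : c \in square_summable.
Proof.
apply: (@square_summable_bounded _ _ (moment 0)) => N.
have h : (fun j => \sum_(0 <= i < N) c i ^+ 2 * abel_radius j ^+ i.*2) @ \oo -->
    \sum_(0 <= i < N) c i ^+ 2.
  apply: cvg_big => [|i _]; first exact: add_continuous.
  rewrite -[X in _ --> X]mulr1; apply: cvgMl_tmp.
  rewrite -(expr1n _ i.*2); exact: cvg_comp abel_radius_cvg (@exprn_continuous R _ 1).
apply: (ler_cvg_to h (cvg_cst (moment 0))); apply: nearW => j /=.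
have r01 := @abel_radius01 R j; have /andP[r0 _] := r01.
have := @abel_moment_le _ 0%N 0 r01; rewrite normr0 ler01 => /(_ isT).
rewrite !mul0r !addr0; apply: le_trans.
have cv := cvgP _ (@series_abel_moment _ 0%N r01).
rewrite (_ : \sum_(0 <= i < N) _ =
    series (fun k => c k * c (k + 0)%N * abel_radius j ^+ (k.*2 + 0)) N); last first.
  by rewrite /series/=; apply: eq_bigr => i _; rewrite !addn0.
apply: nondecreasing_cvgn_le => //; apply: nondecreasing_series => i _ _.
by rewrite addn0 -expr2 mulr_ge0 ?sqr_ge0// exprn_ge0.
Qed.

Lemma MA_mul_summable m : cvgn (series (fun k => `|c k * c (k + m)%N|)).
Proof.
have nc (u : nat -> R) : u \in square_summable -> (fun k => `|u k|) \in square_summable.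
  by move=> /asboolP h; apply/asboolP; under eq_fun do rewrite real_normK ?num_real//.
under eq_fun do rewrite normrM.
apply: (square_summable_mul (nc _ MA_square_summable)); apply: (nc (fun k => c (k + m)%N)).
apply: square_summable_bounded => N.
apply: le_trans (square_summable_le (N + m) MA_square_summable).
rewrite (@big_cat_nat _ _ _ m 0 (N + m))//= ?leq_addl// -[X in X <= _]add0r lerD//.
  by rewrite sumr_ge0// => i _; exact: sqr_ge0.
by rewrite -{2}(add0n m) big_addn addnK.
Qed.

(** The M-test makes the sum continuous in the radius up to 1 included, [clamp] extending it to all
    real radii. *)
Lemma abel_moment_cvg m :
  (fun j => limn (series (fun k => c k * c (k + m)%N * abel_radius j ^+ (k.*2 + m)))) @ \oo -->
  acov c m.
Proof.
pose f k (x : R) := c k * c (k + m)%N * clamp x ^+ (k.*2 + m).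
have fM k x : `|f k x| <= `|c k * c (k + m)%N|.
  have /andP[x0 x1] := clamp_bound x.
  by rewrite /f normrM ler_piMr// normrX ger0_norm// exprn_ile1.
have cf k : continuous (f k).
  move=> x; apply: cvgMl_tmp; exact: cvg_comp (@clamp_continuous R x) (@exprn_continuous R _ _).
have cF := mtest_continuous cf fM (@MA_mul_summable m).
have acE : acov c m = limn (series (f^~ 1)).
  rewrite /acov; congr (limn (series _)); apply/funext => k.
  by rewrite /f clamp_id ?ler01 ?lexx// expr1n mulr1.
rewrite acE; have := cvg_comp _ _ abel_radius_cvg (cF 1); apply: cvg_trans.
apply: near_eq_cvg; apply: nearW => j /=; congr (limn (series _)); apply/funext => k.
by rewrite /f clamp_id//; have /andP[-> /ltW] := @abel_radius01 R j.
Qed.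

Lemma acov_le (m : nat) (e : R) : `|e| <= 1 ->
  acov c 0 + e * acov c m <= moment 0 + e * moment m.
Proof.
move=> e1.
pose A n j := limn (series (fun k => c k * c (k + n)%N * abel_radius j ^+ (k.*2 + n))).
have h1 : (fun j => A 0%N j + e * A m j) @ \oo --> acov c 0 + e * acov c m.
  by apply: cvgD; [|apply: cvgMl_tmp]; exact: abel_moment_cvg.
have h2 : (fun j => moment 0 + e * abel_radius j ^+ m * moment m) @ \oo --> moment 0 + e * moment m.
  apply: cvgD; first exact: cvg_cst.
  apply: cvgMr_tmp; rewrite -[X in _ --> X]mulr1; apply: cvgMl_tmp; rewrite -(expr1n _ m);
    exact: cvg_comp abel_radius_cvg (@exprn_continuous R _ 1).
apply: (ler_cvg_to h1 h2); apply: nearW => j; exact: abel_moment_le (abel_radius01 j) e1.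
Qed.

Hypothesis a1 : cvgn (series (fun n => `|a n|)).

(** The function 2 pi / |h|^2 in polar coordinates, continued to the boundary. Summability of [a]
    makes it continuous up to radius 1, and [clamp] extends it to the plane. *)
Let ar (p : R * R) : R :=
  2 * pi * (cos_sum a (clamp p.1) p.2 ^+ 2 + sin_sum a (clamp p.1) p.2 ^+ 2).

Let ar_continuous : continuous ar.
Proof.
have aM (f : R -> R) (p : R * R) n : (forall x, `|f x| <= 1) ->
    `|a n * clamp p.1 ^+ n * f (n%:R * p.2)| <= `|a n|.
  move=> f1; have /andP[x0 x1] := clamp_bound p.1.
  rewrite -mulrA normrM ler_piMr// normrM mulr_ile1// normrX ger0_norm// exprn_ile1//.
have ca (f : R -> R) n : continuous f ->
    continuous (fun p : R * R => a n * clamp p.1 ^+ n * f (n%:R * p.2)).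
  move=> cf p; apply: cvgM.
    apply: cvgMl_tmp.
    have h1 : q.1 @[q --> p] --> p.1 by exact: cvg_fst.
    have h : clamp q.1 @[q --> p] --> clamp p.1 by exact: cvg_comp h1 (@clamp_continuous R _).
    exact: cvg_comp h (@exprn_continuous R _ _).
  have h : n%:R * q.2 @[q --> p] --> n%:R * p.2 by apply: cvgMl_tmp; exact: cvg_snd.
  exact: cvg_comp h (cf _).
have ccos : continuous (fun p : R * R => cos_sum a (clamp p.1) p.2).
  apply: (@mtest_continuous _ _ (fun n (p : R * R) => a n * clamp p.1 ^+ n * cos (n%:R * p.2))
    (fun n => `|a n|)) => // [n|n p]; first exact/ca/continuous_cos.
  by apply: (aM (@cos R)) => x; rewrite ler_norml cos_geN1 cos_le1.
have csin : continuous (fun p : R * R => sin_sum a (clamp p.1) p.2).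
  apply: (@mtest_continuous _ _ (fun n (p : R * R) => a n * clamp p.1 ^+ n * sin (n%:R * p.2))
    (fun n => `|a n|)) => // [n|n p]; first exact/ca/continuous_sin.
  by apply: (aM (@sin R)) => x; rewrite ler_norml sin_geN1 sin_le1.
move=> p; apply: cvgMl_tmp; apply: cvgD.
  exact: cvg_comp (ccos p) (@exprn_continuous R 2 _).
exact: cvg_comp (csin p) (@exprn_continuous R 2 _).
Qed.

Lemma moment0_le : moment 0 <= acov c 0.
Proof.
rewrite (_ : moment 0 = \int[mu]_(t in circle R) Delta t); last first.
  by apply: eq_Rintegral => t _; rewrite mul0r cos0 mulr1.
apply: (@integral_density_le _ _ ar) => //.
- by move=> j; apply: exp_log_poisson_continuous; exact: abel_radius01.
- move=> j t; have r01 := @abel_radius01 R j.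
  have [h1 h2] := szego_polar_modulus t hc ha r01.
  rewrite /ar /= clamp_id; last by case/andP: r01 => -> /ltW ->.
  by rewrite mulrA [_ * (2 * pi)]mulrC -h1.
- move=> j; have r01 := @abel_radius01 R j; have /andP[r0 r1] := r01.
  have h := @series_abel_moment _ 0%N r01.
  rewrite (_ : \int[mu]_(t in circle R) _ =
      \int[mu]_(t in circle R) (E (abel_radius j) t * cos (0%:R * t))); last first.
    by apply: eq_Rintegral => t _; rewrite mul0r cos0 mulr1.
  have cv : series (fun k => c k * c (k + 0)%N) @ \oo --> acov c 0.
    exact: (normed_cvg (@MA_mul_summable 0%N)).
  apply: (ler_cvg_to h cv); apply: nearW => N; rewrite /series/=; apply: ler_sum => k _.
  by rewrite addn0 -expr2 ler_piMr ?sqr_ge0// exprn_ile1// ltW.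
Qed.

Theorem moment_acov m : \int[mu]_(t in circle R) (Delta t * cos (m%:R * t)) = acov c m.
Proof.
have h0 := moment0_le.
have := @acov_le m 1; rewrite normr1 lexx !mul1r => /(_ isT) h1.
have := @acov_le m (- 1); rewrite normrN1 lexx !mulN1r => /(_ isT) h2.
rewrite -/(moment m); lra.
Qed.

End autocovariance.

(** * The partial autocorrelations of the given process *)

Lemma A2_AR_nonneg d (Omega : measurableType d) (R : realType) (P : probability Omega R)
    (X : int -> {RV P >-> R}) (c a : nat -> R) : A2 X c a -> \forall n \near \oo, 0 <= a n.
Proof.
move=> [_ [e [ell [/andP[e0 e2] [A [ellA _ _]] _ aq]]]].
near=> n.
have n0 : (0 < n)%N by near: n; exact: nbhs_infty_gt.
have An : A <= n%:R by near: n; exact: nbhs_infty_ger.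
have : 0 < a n / (n%:R `^ (- (1 + e)) * (1 / ell n%:R) * (e * sin (pi * e) / pi)).
  by near: n; exact: (cvgr_gt 1 aq) ltr01.
suff q0 : 0 < n%:R `^ (- (1 + e)) * (1 / ell n%:R) * (e * sin (pi * e) / pi).
  by rewrite pmulr_lgt0 ?invr_gt0// => /ltW.
have p0 := pi_gt0 R.
have se : 0 < sin (pi * e) by apply: sin_gt0_pi; rewrite mulr_gt0//= gtr_pMr//; lra.
apply: mulr_gt0; last by rewrite divr_gt0// mulr_gt0.
by apply: mulr_gt0; [rewrite powR_gt0// ltr0n|rewrite divr_gt0// ellA].
Unshelve. all: by end_near. Qed.

Lemma autocov_moment d (Omega : measurableType d) (R : realType) (P : probability Omega R)
    (X : int -> {RV P >-> R}) (Delta : R -> R) (m : nat) : spectral_density X Delta ->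
  autocov X m%:Z = \int[@lebesgue_measure R]_(t in circle R) (Delta t * cos (m%:R * t)).
Proof.
move=> [_ _ _ _ /(_ m%:Z) /(congr1 (@complex.Re R)) h].
rewrite -[LHS]/(complex.Re (autocov X m%:Z)%:C%C) h /cintegral.
rewrite -[LHS]/(\int[@lebesgue_measure R]_(t in circle R)
  complex.Re (expi (m%:Z%:~R * t) * (Delta t)%:C%C)).
by apply: eq_Rintegral => t _; rewrite Re_realMr expiE /= mulrC.
Qed.

Theorem theorem2p1 (R : realType) (d : measure_display) (Omega : measurableType d)
    (P : probability Omega R) (X : int -> {RV P >-> R})
    (Delta : R -> R) (c a : nat -> R)
    (hX : stationary_process X)
    (hDelta : spectral_density X Delta)
    (hc : MA_coefficients Delta c) (ha : AR_coefficients Delta a)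
    (hA : A1 X c a \/ A2 X c a) :
  forall n : nat, (2 <= n)%N ->
    (fun M : nat => \sum_(1 <= k < M.+1) alpha_ c a (2 * k - 1)%N n) @ \oo
      --> pacf X n.
Proof.
move=> n n2; have [wX _] := hX; have [Delta_gt0 _ iDelta lDelta _] := hDelta.
have mDelta : measurable_fun (circle R : set (measurableTypeR R)) Delta.
  by apply/measurable_EFinP; apply: measurable_int iDelta.
have ilog : (@lebesgue_measure R).-integrable (circle R) (EFin \o (fun t => ln (Delta t))).
  apply/integrableP; split => //.
  by apply/measurable_EFinP; apply: measurableT_comp mDelta; exact: measurable_ln.
have a1 : cvgn (series (fun n => `|a n|)).
  case: hA => [[_ a1 _]//|/A2_AR_nonneg a0]; exact: AR_abs_summable hc ha a0.
have /asboolP c2 := MA_square_summable Delta_gt0 iDelta ilog hc ha.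
have ac := MA_AR_convolution hc ha.
have n0 : (0 < n)%N by apply: ltnW.
have n1 : (0 < n.-1)%N by rewrite -ltnS prednK.
have [phi [phin [_ phi_lim]]] := finite_predictor c2 a1 ac n0.
(* Order n - 1 provides the residuals that define the PACF at n, together with their nonzero
   variance. *)
have [psi [psin [psi_neq _]]] := finite_predictor c2 a1 ac n1.
have acovE (m : nat) : autocov X m%:Z = acov c m.
  by rewrite (autocov_moment m hDelta) (moment_acov Delta_gt0 iDelta ilog hc ha a1).
by rewrite (pacf_predictor wX acovE n2 phin psin psi_neq).
Qed.
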